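(* Let $N\ge 1$, $d\ge 1$, $H=(H_1,\dots,H_N)\in(0,1)^N$ with $\min\{H_1,\dots,H_N\}>\frac14$, $a=(a_1,\dots,a_N)\in\mathbb{R}^N\setminus\{0\}$, and let $M_t=M_t^H(a)=\sum_{k=1}^N a_kB_t^{H_k}$, $t\in[0,T]$, be the corresponding $\mathbb{R}^d$-valued generalized mixed fractional Brownian motion. For $m\ge1$ let $M^m$ be the $m$-th dyadic piecewise linear approximation of $M$ and let $\mathbb{M}^m$ be the smooth rough path above $M^m$ defined by iterated integrals. Then, for every $p>\frac{1}{\min\{H_k\}}$, the sequence $(\mathbb{M}^m)_{m\ge1}$ converges almost surely in the $p$-variation topology to a geometric rough path $\mathbb{M}$ above $M$ (that is, $\mathbb{M}^{(1)}_{s,t}=M_t-M_s$). Moreover, the limit $\mathbb{M}$ is independent of the choice of dyadic approximation: two sequences of dyadic linear approximations of $M$ yield the same limit.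
   Context: Fix $T>0$. All processes live on a complete probability space. $B^{H_1},\dots,B^{H_N}$ are independent; each $B^{H_k}$ is an $\mathbb{R}^d$-valued fractional Brownian motion with independent components of Hurst parameter $H_k$, i.e. centred Gaussian with each component having covariance $\frac12(t^{2H_k}+s^{2H_k}-|t-s|^{2H_k})$. Dyadic approximation: with $t_l^m=l2^{-m}T$, $l=0,\dots,2^m$, $M^m$ is the continuous path which agrees with $M$ at all $t_l^m$ and is affine on each $[t_{l-1}^m,t_l^m]$. Let $V=\mathbb{R}^d$, $T^n(V)=\mathbb{R}\oplus V\oplus\cdots\oplus V^{\otimes n}$ with truncated tensor multiplication, and $\Delta_T=\{(s,t):0\le s\le t\le T\}$. A multiplicative functional of degree $n$ is a map $X:\Delta_T\to T^n(V)$, $X_{s,t}=(1,X^1_{s,t},\dots,X^n_{s,t})$, with $X_{s,u}=X_{s,t}\otimes X_{t,u}$ for $s\le t\le u$. Its $p$-variation is $\|X\|_{p\text{-var}}=\max_{1\le k\le\lfloor p\rfloor}\sup_{\mathcal D}\big(\sum_{[u,v]\in\mathcal D}|X^k_{u,v}|^{p/k}\big)^{k/p}$ (supremum over partitions $\mathcal D$ of $[0,T]$). A $p$-rough path is a multiplicative functional of degree $\lfloor p\rfloor$ with finite $p$-variation. The $p$-variation topology is that of the distance $d_p(X,Y)=\max_{1\le k\le\lfloor p\rfloor}\sup_{\mathcal D}\big(\sum_{[u,v]\in\mathcal D}|X^k_{u,v}-Y^k_{u,v}|^{p/k}\big)^{k/p}$. The smooth rough path above a piecewise smooth path $x$ has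 $k$-th level $\int_{s<u_1<\cdots<u_k<t}dx_{u_1}\otimes\cdots\otimes dx_{u_k}$, $1\le k\le\lfloor p\rfloor$. A $p$-rough path is geometric if it is a $d_p$-limit of smooth rough paths.
   Formalization: The fractional Brownian motions are assumed to have almost surely continuous sample paths (the usual convention); for a version altered at an independent random time, M is discontinuous and no geometric rough path satisfies M_t − M_s as its first level for all s, t. *)

(* Defs.v *)
From HB Require Import structures.
From mathcomp Require Import all_boot all_order all_algebra.
From mathcomp Require Import all_classical all_reals all_analysis.

Set Implicit Arguments.
Unset Strict Implicit.
Unset Printing Implicit Defensive.

Import Order.TTheory GRing.Theory Num.Theory.
Import numFieldNormedType.Exports.

Local Open Scope classical_set_scope.
Local Open Scope ring_scope.

(* ------------------------------------------------------------------------ *)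
(* Gaussian processes, independence, fractional Brownian motion             *)
(* ------------------------------------------------------------------------ *)

(* [normal_prob m 0] is a junk value in the library, so the degenerate law is
   listed separately; it does occur, e.g. for a fractional Brownian motion at
   time 0. *)
Definition gaussian_rv d (Omega : measurableType d) (R : realType)
    (P : probability Omega R) (X : {RV P >-> R}) : Prop :=
  exists m s : R,
    (s != 0 /\ forall A, measurable A -> distribution P X A = normal_prob m s A)
    \/ (forall A, measurable A -> distribution P X A = dirac m A).

Arguments gaussian_rv {d Omega R} P X.

(* A family indexed by an arbitrary type, restricted to a set [D] of indices:
   the processes below live on [0, T], and their values outside are ignored. *)
Definition gaussian_family d (Omega : measurableType d) (R : realType)
    (P : probability Omega R) (J : Type) (D : set J)
    (X : J -> {RV P >-> R}) : Prop :=
  forall (n : nat) (z : 'I_n -> J) (c : 'I_n -> R),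
    (forall i, D (z i)) -> gaussian_rv P (\sum_(i < n) c i *: X (z i)).

Arguments gaussian_family {d Omega R} P {J} D X.

Definition generated_sigma_algebra d (Omega : measurableType d) (R : realType)
    (P : probability Omega R) (J : Type) (D : set J)
    (X : J -> {RV P >-> R}) : set (set Omega) :=
  <<s \bigcup_(z in D) preimage_set_system setT (X z) measurable >>.

Arguments generated_sigma_algebra {d Omega R} P {J} D X.

Definition mutually_independent d (Omega : measurableType d) (R : realType)
    (P : probability Omega R) (I : finType) (F : I -> set (set Omega)) : Prop :=
  forall (J : {set I}) (A : I -> set Omega), (forall i, i \in J -> F i (A i)) ->
    P (\bigcap_(i in [set` J]) A i) = (\prod_(i in J) P (A i))%E.

(* An R^dim-valued process is a family of real processes [X j], j : 'I_dim; its
   sample path at omega is a map from R to row vectors. *)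
Definition sample_path d (Omega : measurableType d) (R : realType)
    (P : probability Omega R) (dim : nat) (X : 'I_dim -> R -> {RV P >-> R})
    (omega : Omega) (t : R) : 'rV[R]_dim :=
  \row_j X j t omega.

Arguments sample_path {d Omega R} P {dim} X omega t.

Definition process_sigma_algebra d (Omega : measurableType d) (R : realType)
    (P : probability Omega R) (T : R) (dim : nat)
    (X : 'I_dim -> R -> {RV P >-> R}) : set (set Omega) :=
  generated_sigma_algebra P (setT `*` `[0, T]) (fun z => X z.1 z.2).

Arguments process_sigma_algebra {d Omega R} P T {dim} X.

Definition fBm_cov (R : realType) (H s t : R) : R :=
  2^-1 * (t `^ (2 * H) + s `^ (2 * H) - `|t - s| `^ (2 * H)).

Record is_fBm d (Omega : measurableType d) (R : realType)
    (P : probability Omega R) (T H : R) (dim : nat)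
    (B : 'I_dim -> R -> {RV P >-> R}) : Prop := IsFBm {
  fBm_gaussian :
    gaussian_family P (setT `*` `[0, T]) (fun z : 'I_dim * R => B z.1 z.2);
  fBm_centred : forall j t, 0 <= t <= T -> ('E_P[B j t] = 0)%E;
  fBm_covariance : forall j s t, 0 <= s <= T -> 0 <= t <= T ->
    covariance P (B j s) (B j t) = (fBm_cov H s t)%:E;
  fBm_components : mutually_independent P
    (fun j => generated_sigma_algebra P `[0, T] (B j));
  (* The covariance only determines the law; as usual, a version with
     continuous paths is meant. *)
  fBm_continuous : {ae P, forall omega, forall j,
    {within `[0, T], continuous (fun t => B j t omega)}} }.

Arguments is_fBm {d Omega R} P T H {dim} B.

(* The sample paths of M^H(a). *)
Definition mixed_fBm d (Omega : measurableType d) (R : realType)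
    (P : probability Omega R) (N dim : nat) (a : 'I_N -> R)
    (B : 'I_N -> 'I_dim -> R -> {RV P >-> R}) (omega : Omega) (t : R)
    : 'rV[R]_dim :=
  \sum_(k < N) a k *: sample_path P (B k) omega t.

Arguments mixed_fBm {d Omega R} P {N dim} a B omega t.

(* The smallest entry of [H], for 0 < N and entries of [H] below 1: then the
   default value 1 of the iterated minimum is irrelevant. *)
Definition min_hurst (R : realType) (N : nat) (H : 'I_N -> R) : R :=
  \big[Num.min/1]_(k < N) H k.

(* ------------------------------------------------------------------------ *)
(* Truncated tensor algebra                                                 *)
(* ------------------------------------------------------------------------ *)

(* T^n(R^dim), in coordinates: the words of length k over 'I_dim index the
   canonical basis of the k-th tensor power of R^dim. *)
Notation trunc_tensor R dim n := {ffun n.-bseq 'I_dim -> R}.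

(* All the words to which [insub_bseq] is applied here have length at most n,
   so that its default value is not used. *)
Definition tensor_mul (R : realType) (dim n : nat) (x y : trunc_tensor R dim n)
    : trunc_tensor R dim n :=
  [ffun w : n.-bseq 'I_dim => \sum_(i < (size w).+1)
     x (insub_bseq n (take i w)) * y (insub_bseq n (drop i w))].

(* The Euclidean norm of the component of level k. *)
Definition level_norm (R : realType) (dim n : nat) (k : nat)
    (x : trunc_tensor R dim n) : R :=
  Num.sqrt (\sum_(w : n.-bseq 'I_dim | size w == k) x w ^+ 2).

(* The component of level 1, as a vector; meaningful for 0 < n. *)
Definition level1 (R : realType) (dim n : nat) (x : trunc_tensor R dim n)
    : 'rV[R]_dim :=
  \row_j x (insub_bseq n [:: j]).

(* ------------------------------------------------------------------------ *)
(* Rough paths                                                              *)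
(* ------------------------------------------------------------------------ *)

(* Functionals on the simplex 0 <= s <= t <= T are total maps whose values off
   the simplex are ignored. *)
Definition multiplicative_functional (R : realType) (T : R) (dim n : nat)
    (X : R -> R -> trunc_tensor R dim n) : Prop :=
  (forall s t, 0 <= s -> s <= t -> t <= T -> X s t [bseq] = 1) /\
  (forall s t u, 0 <= s -> s <= t -> t <= u -> u <= T ->
     X s u = tensor_mul (X s t) (X t u)).

Definition eq_on_simplex (R : realType) (T : R) (dim n : nat)
    (X Y : R -> R -> trunc_tensor R dim n) : Prop :=
  forall s t, 0 <= s -> s <= t -> t <= T -> X s t = Y s t.

(* The partition of [0, T] with points 0 = nth T (0 :: D) 0 < nth T (0 :: D) 1
   < ... < T, as in [variation] of the library. *)
Definition level_pvar (R : realType) (T p : R) (dim n : nat) (k : nat)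
    (X : R -> R -> trunc_tensor R dim n) : \bar R :=
  ereal_sup [set ((\sum_(i < size D)
      level_norm k (X (nth T (0 :: D) i) (nth T (0 :: D) i.+1))
        `^ (p / k%:R)) `^ (k%:R / p))%:E | D in itv_partition 0 T].

Definition pvar (R : realType) (T p : R) (dim n : nat)
    (X : R -> R -> trunc_tensor R dim n) : \bar R :=
  \big[Order.max/0%E]_(1 <= k < (Num.truncn p).+1) level_pvar T p k X.

Definition rough_dist (R : realType) (T p : R) (dim n : nat)
    (X Y : R -> R -> trunc_tensor R dim n) : \bar R :=
  pvar T p (fun s t => X s t - Y s t).

Definition pvar_cvg (R : realType) (T p : R) (dim n : nat)
    (X : nat -> R -> R -> trunc_tensor R dim n)
    (Y : R -> R -> trunc_tensor R dim n) : Prop :=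
  (fun m => rough_dist T p (X m) Y) @ \oo --> 0%E.

Definition rough_path (R : realType) (T p : R) (dim : nat)
    (X : R -> R -> trunc_tensor R dim (Num.truncn p)) : Prop :=
  multiplicative_functional T X /\ (pvar T p X < +oo)%E.

Arguments rough_path {R} T p {dim} X.

(* Agreement with smooth maps on the closed pieces makes [x] continuous. *)
Definition piecewise_smooth (R : realType) (T : R) (dim : nat)
    (x : R -> 'rV[R]_dim) : Prop :=
  exists D : seq R, itv_partition 0 T D /\
    forall i, (i < size D)%N -> exists f : 'I_dim -> R -> R,
      (forall j (r : nat) u, derivable (derive1n r (f j)) u 1) /\
      (forall j u, nth T (0 :: D) i <= u <= nth T (0 :: D) i.+1 ->
         x u 0 j = f j u).

(* The integral of dx^{j_1}_{u_1} ... dx^{j_k}_{u_k} over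
   s < u_1 < ... < u_k < t, where w = [:: j_1; ...; j_k]; the outermost
   integral is over u_1.  For a piecewise smooth [x], dx_u is x'(u) du, x being
   differentiable off a finite set. *)
Fixpoint iterated_integral (R : realType) (dim : nat) (x : R -> 'rV[R]_dim)
    (w : seq 'I_dim) (s t : R) : R :=
  if w is j :: w' then
    \int[lebesgue_measure]_(u in `[s, t])
      (derive1 (fun v => x v 0 j) u * iterated_integral x w' u t)
  else 1.

Definition smooth_rough_path (R : realType) (dim n : nat)
    (x : R -> 'rV[R]_dim) (s t : R) : trunc_tensor R dim n :=
  [ffun w : n.-bseq 'I_dim => iterated_integral x w s t].

Definition geometric_rough_path (R : realType) (T p : R) (dim : nat)
    (X : R -> R -> trunc_tensor R dim (Num.truncn p)) : Prop :=
  rough_path T p X /\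
  exists x : nat -> R -> 'rV[R]_dim, (forall m, piecewise_smooth T (x m)) /\
    pvar_cvg T p (fun m => smooth_rough_path (Num.truncn p) (x m)) X.

Arguments geometric_rough_path {R} T p {dim} X.

(* ------------------------------------------------------------------------ *)
(* Dyadic piecewise linear approximation                                    *)
(* ------------------------------------------------------------------------ *)

Definition dyadic_point (R : realType) (T : R) (m l : nat) : R :=
  l%:R * 2 ^- m * T.

(* Here l is such that t_l <= t < t_(l+1).  At t = T one has l = 2^m, and the
   coefficient of the value at the extra point t_(l+1) is 0. *)
Definition dyadic_linear_approx (R : realType) (T : R) (dim : nat)
    (x : R -> 'rV[R]_dim) (m : nat) (t : R) : 'rV[R]_dim :=
  let l := Num.truncn (t * 2 ^+ m / T) in
  let t0 := dyadic_point T m l in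
  let t1 := dyadic_point T m l.+1 in
  x t0 + ((t - t0) / (t1 - t0)) *: (x t1 - x t0).

Definition dyadic_rough_path (R : realType) (T p : R) (dim : nat)
    (x : R -> 'rV[R]_dim) (m : nat)
    : R -> R -> trunc_tensor R dim (Num.truncn p) :=
  smooth_rough_path (Num.truncn p) (dyadic_linear_approx T x m).

(* Main.v *)
Require Import Defs.
From HB Require Import structures.
From mathcomp Require Import all_boot all_order all_algebra.
From mathcomp Require Import all_classical all_reals all_analysis.
From mathcomp Require Import measurable_realfun ring lra zify.

Set Implicit Arguments.
Unset Strict Implicit.
Unset Printing Implicit Defensive.

Import Order.TTheory GRing.Theory Num.Theory.
Import numFieldNormedType.Exports.

Local Open Scope classical_set_scope.
Local Open Scope ring_scope.

(** Write [X^m_w(I)] for the iterated integral of the [m]-th dyadic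
    interpolation along the word [w] over the dyadic interval [I = I_{n,l}].
    Let H be the smallest Hurst parameter, fix [1/p < al < H] and let
    [k0 = 3] (with [al > 1/4]) if [H <= 1/2], and [k0 = 1] (with [al > 1/2])
    otherwise, so that words of length at least [k0 + 1] have regularity
    [(k0 + 1) al >= 1].

    Deterministic part.  If [q n m l >= 0] is summable over all indices and
    [|X^{m+1}_w(I) - X^m_w(I)| <= (c rho^(n+m) (q n m l)^al)^|w|] for
    [1 <= |w| <= k0], then the words of length at most [k0] are controlled on
    arbitrary intervals by chaining over dyadic intervals, and the longer ones
    inductively, by Chen's relation, since the cross terms form a geometric
    series while [z^(|w| al)] is superadditive.  The sum of the [q]'s over the
    dyadic subintervals of [[s, t]] is a control, so [X^m] is Cauchy in
    p-variation.

    Probabilistic part.  For [n >= m] the interpolation is affine on [I] and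
    fourth moments of Gaussian increments suffice.  For [n <= m] the level one
    difference vanishes, and Chen's relation writes the differences of level
    two and three as sums over the [2^(m-n)] subintervals of terms
    [G_i zeta_i], where [zeta_i] is an increment of a component on which
    [G_i] does not depend.  As distinct components are independent,
    [E (sum_i G_i zeta_i)^2 = sum_{i,i'} E (G_i G_i') E (zeta_i zeta_i')], and
    the row sums of [|E (zeta_i zeta_i')|] are of the order of the variance,
    because second differences of [t^(2H)] have constant sign and telescope.
    The gain is [2^(-(m-n)(4H-1))], whence the condition [H > 1/4].  Finally
    [q n m l], a weighted sum of these normalised moments, has a summable
    expectation. *)

(** * Iterated integrals *)

(** Since [p] is arbitrary, all words up to its integer part must be controlled, whereas moments are
    computed for at most three letters. The form of the bounds makes this possible: as a weight is
    raised to the power [al |w|] with [al >= 1/4], a fourth moment serves one letter and a second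
    moment serves two or three, because [1/4 <= al] and [1/2 <= 2 al]. The Gaussian law therefore
    enters only through the comparison of the fourth moment of an increment with its variance; the
    rest uses covariances and independence. The pathwise part knows nothing but the weights [q]. It
    compares the interpolations [M <= M'] by the relation [close], whose relative error is of order
    [rho^M] and which is stable under Chen's product; letting [M'] tend to infinity yields the
    limit, its bounds and the rate of convergence together. *)

Section iterated_integrals.
Context {R : realType} {dim : nat}.
Implicit Types (x : R -> 'rV[R]_dim) (w : seq 'I_dim) (a b c s t u T K : R).
Local Notation mu := (@lebesgue_measure R).

Definition velocity x (j : 'I_dim) (u : R) : R := derive1 (fun v => x v 0 j) u.

(** At a breakpoint of a piecewise affine path [derive1] still has some real value, so the bound can
    be asked on the whole closed interval. *)
Definition bounded_velocity T K x := forall j : 'I_dim,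
  measurable_fun `[0, T]%classic (velocity x j) /\
  forall u, 0 <= u <= T -> `|velocity x j u| <= K.

Lemma bounded_integrable_itv a b K (f : R -> R) :
  measurable_fun `[a, b]%classic f -> (forall u, a <= u <= b -> `|f u| <= K) ->
  mu.-integrable `[a, b]%classic (EFin \o f).
Proof.
move=> mf fK; apply: measurable_bounded_integrable => //=.
  by rewrite lebesgue_measure_itv; case: ifPn => _; rewrite -?EFinD ltry.
exists K; split; first exact: num_real.
move=> M KM u /=; rewrite in_itv /= => uab.
exact: le_trans (fK u uab) (ltW KM).
Qed.

Lemma Rintegral_itv_split a b c (f : R -> R) : a <= b -> b <= c ->
  mu.-integrable `[a, c]%classic (EFin \o f) ->
  \int[mu]_(u in `[a, c]) f u =
  \int[mu]_(u in `[a, b]) f u + \int[mu]_(u in `[b, c]) f u.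
Proof.
move=> ab bc fi.
have fi' : mu.-integrable `]b, c]%classic (EFin \o f).
  apply: integrableS fi => //; apply: subset_itvr.
  by rewrite bnd_simp.
rewrite -(@Rintegral_itv_obnd_cbnd _ b (BRight c)) // -(@Rintegral_itvB _ f (BLeft a) (BRight c) b)//.
by rewrite addrC subrK.
Qed.

Lemma le_Rintegral_itv a b K (f : R -> R) : a <= b ->
  measurable_fun `[a, b]%classic f -> (forall u, a <= u <= b -> `|f u| <= K) ->
  `|\int[mu]_(u in `[a, b]) f u| <= K * (b - a).
Proof.
move=> ab mf fK; have fi := bounded_integrable_itv mf fK.
apply: le_trans (le_normr_Rintegral _ fi) _ => //.
apply: (@le_trans _ _ (\int[mu]_(u in `[a, b]) K)).
  apply: le_Rintegral => //.
  - apply: (@bounded_integrable_itv _ _ K) => [|u /fK]; last by rewrite normr_id.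
    exact: measurableT_comp.
  - by apply: (@bounded_integrable_itv _ _ `|K|) => // u _; rewrite lexx.
have ab_len : fine (lebesgue_measure (`[a, b]%classic : set R)) = b - a.
  rewrite lebesgue_measure_itv /= lte_fin; case: ltP => [//|ba] /=.
  by have -> : a = b by [apply/eqP; rewrite eq_le ab ba]; rewrite subrr.
by rewrite -ab_len Rintegral_cst.
Qed.

Lemma Rintegral_itv_cc a (f : R -> R) : \int[mu]_(u in `[a, a]) f u = 0.
Proof. by rewrite set_itv1 Rintegral_set1. Qed.

(** Continuity of the primitive in its upper limit gives measurability in the lower one by
    subtraction. Inner iterated integrals depend on their lower limit, so this is what allows them
    to be integrated again. *)
Lemma measurable_Rintegral_left t K (f : R -> R) : 0 <= t ->
  measurable_fun `[0, t]%classic f -> (forall u, 0 <= u <= t -> `|f u| <= K) ->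
  measurable_fun `[0, t]%classic (fun s => \int[mu]_(u in `[s, t]) f u).
Proof.
move=> t0 mf fK; have fi := bounded_integrable_itv mf fK.
have e : {in `[0, t]%classic, (fun s => \int[mu]_(u in `[0, t]) f u -
    \int[mu]_(u in `[0, s]) f u) =1 (fun s => \int[mu]_(u in `[s, t]) f u)}.
  move=> s; rewrite inE /= in_itv /= => /andP[s0 st].
  by rewrite (Rintegral_itv_split s0 st fi) addrC addKr.
apply: (eq_measurable_fun _ e); apply: measurable_funB => //.
apply: subspace_continuous_measurable_fun => //.
exact: parameterized_integral_continuous.
Qed.

(** Measurability and the bound go through one induction on the word, because the integrability of
    the next integrand needs both. The factor [1/k!] is given up; only the order in [t - s] is
    kept. *)
Lemma iterated_integral_bound T K x w t : 0 <= K -> bounded_velocity T K x ->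
  0 <= t <= T ->
  measurable_fun `[0, t]%classic (fun s => iterated_integral x w s t) /\
  forall s, 0 <= s <= t -> `|iterated_integral x w s t| <= (K * (t - s)) ^+ size w.
Proof.
move=> K0 xK /andP[t0 tT]; elim: w => [|j w [mI bI]] /=.
  by split=> // s _; rewrite expr0 normr1.
have [mv bv] := xK j.
have mvt : measurable_fun `[0, t]%classic (velocity x j).
  by apply: measurable_funS mv => //; apply: subset_itvl; rewrite bnd_simp.
have mf : measurable_fun `[0, t]%classic
    (fun u => velocity x j u * iterated_integral x w u t).
  exact: measurable_funM.
have fK s : 0 <= s -> forall u, s <= u <= t ->
    `|velocity x j u * iterated_integral x w u t| <= K * (K * (t - s)) ^+ size w.
  move=> s0 u /andP[su ut]; rewrite normrM ler_pM //.
    by apply: bv; rewrite (le_trans s0 su) (le_trans ut tT).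
  apply: le_trans (bI u _) _; first by rewrite (le_trans s0 su) ut.
  have ut0 : 0 <= t - u by rewrite subr_ge0.
  have st0 : 0 <= t - s by rewrite subr_ge0 (le_trans su ut).
  rewrite lerXn2r ?nnegrE ?mulr_ge0//.
  by rewrite ler_wpM2l// lerD2l lerN2.
split.
  exact: (measurable_Rintegral_left t0 mf (fK 0 (lexx 0))).
move=> s /andP[s0 st].
apply: le_trans (le_Rintegral_itv st _ (fK s s0)) _.
  by apply: measurable_funS mf => //; apply: subset_itvr; rewrite bnd_simp.
by rewrite exprS -mulrA [_ * (t - s)]mulrC mulrA.
Qed.

(** Induction on the word, splitting the range of the outermost variable at [t]: beyond [t] it
    leaves the term [i = 0]; before [t] the relation for the tail of the word applies at that
    variable. *)
Lemma iterated_integral_chen T K x w s t u : 0 <= K -> bounded_velocity T K x ->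
  0 <= s -> s <= t -> t <= u -> u <= T ->
  iterated_integral x w s u = \sum_(i < (size w).+1)
    iterated_integral x (take i w) s t * iterated_integral x (drop i w) t u.
Proof.
move=> K0 xK s0 st tu uT; elim: w s s0 st => [|j w IH] s s0 st.
  by rewrite big_ord1 /= mul1r.
have t0 := le_trans s0 st; have u0 := le_trans t0 tu; have tT := le_trans tu uT.
have [mv bv] := xK j.
rewrite big_ord_recl take0 drop0 mul1r /=.
have intf (r v : R) (w' : seq 'I_dim) : 0 <= r -> r <= v -> v <= T ->
    mu.-integrable `[r, v]%classic
      (EFin \o (fun y => velocity x j y * iterated_integral x w' y v)).
  move=> r0 rv vT; have v0 := le_trans r0 rv.
  have [|mI bI] := @iterated_integral_bound T K x w' v K0 xK; first by rewrite v0.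
  suff fi : mu.-integrable `[0, v]%classic
      (EFin \o (fun y => velocity x j y * iterated_integral x w' y v)).
    by apply: integrableS fi => //; apply: subset_itvr; rewrite bnd_simp.
  apply: (@bounded_integrable_itv _ _ (K * (K * v) ^+ size w')).
    apply: measurable_funM => //.
    by apply: measurable_funS mv => //; apply: subset_itvl; rewrite bnd_simp.
  move=> y /andP[y0 yv]; rewrite normrM ler_pM //.
    by apply: bv; rewrite y0 (le_trans yv vT).
  apply: le_trans (bI y _) _; first by rewrite y0.
  rewrite lerXn2r ?nnegrE ?mulr_ge0// ?subr_ge0//.
  by rewrite ler_wpM2l// gerBl.
rewrite (Rintegral_itv_split st tu); last exact: intf (le_trans st tu) uT.
rewrite addrC; congr (_ + _).
transitivity (\int[mu]_(r in `[s, t]) \sum_(i < (size w).+1)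
   (velocity x j r * iterated_integral x (take i w) r t) *
     iterated_integral x (drop i w) t u).
  apply: eq_Rintegral => r; rewrite inE /= in_itv /= => /andP[sr rt].
  rewrite -/(velocity x j r) IH ?(le_trans s0 sr)// big_distrr /=.
  by apply: eq_bigr => i _; rewrite mulrA.
rewrite /Rintegral.
under eq_integral do rewrite -sumEFin.
have intr (i : 'I_(size w).+1) : mu.-integrable `[s, t]%classic (fun y =>
    (velocity x j y * iterated_integral x (take i w) y t *
     iterated_integral x (drop i w) t u)%:E).
  exact: (integrableZr _ _ (intf s t (take i w) s0 st tT)).
rewrite integral_sum //=.
rewrite -sum_fine //; last first.
  move=> i _; exact: integrable_fin_num.
apply: eq_bigr => i _.
by rewrite /= add0n -RintegralZr //; exact: intf.
Qed.

(** The velocity of an interpolation is known only inside the linear pieces; the two endpoints form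
    a null set. *)
Lemma eq_Rintegral_oo a b (f g : R -> R) :
  measurable_fun `]a, b[%classic g -> (forall u, a < u < b -> f u = g u) ->
  \int[mu]_(u in `[a, b]) f u = \int[mu]_(u in `[a, b]) g u.
Proof.
move=> mg fg.
have oo (h : R -> R) : measurable_fun `]a, b[%classic h ->
    \int[mu]_(u in `[a, b]) h u = \int[mu]_(u in `]a, b[) h u.
  move=> mh; have mh' : measurable_fun `]a, b[%classic (EFin \o h) by exact/measurable_EFinP.
  case: (ltP a b) => [ab|ba].
    rewrite /Rintegral -integral_itv_bndo_bndc.
      by rewrite -integral_itv_obnd_cbnd.
    have -> : `[a, b[%classic = [set a] `|` `]a, b[%classic :> set R.
      by rewrite setU1itv ?bnd_simp.
    by rewrite measurable_funU//; split=> //; exact: measurable_fun_set1.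
  rewrite (_ : `]a, b[%classic = set0) ?Rintegral_set0; last first.
    by apply/seteqP; split=> u //=; rewrite in_itv /= => /andP[/lt_trans/[apply]]; rewrite ltNge ba.
  move: ba; rewrite le_eqVlt => /predU1P[->|ba]; first exact: Rintegral_itv_cc.
  rewrite (_ : `[a, b]%classic = set0) ?Rintegral_set0//.
  by apply/seteqP; split=> u //=; rewrite in_itv /= => /andP[/le_trans/[apply]]; rewrite leNgt ba.
rewrite !oo //.
  by apply: eq_Rintegral => u; rewrite inE /= in_itv /= => /fg.
by apply: (eq_measurable_fun g) => // u; rewrite inE /= in_itv /= => /fg.
Qed.

Lemma continuous_subX t k : continuous (fun u : R => (t - u) ^+ k).
Proof.
move=> u; apply: (@continuous_comp _ _ _ (fun u => t - u) (fun z => z ^+ k)).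
  by apply: cvgB; [exact: cvg_cst|exact: cvg_id].
exact: exprn_continuous.
Qed.

Lemma Rintegral_subX s t k : s <= t ->
  \int[mu]_(u in `[s, t]) (t - u) ^+ k = (t - s) ^+ k.+1 / k.+1%:R.
Proof.
rewrite le_eqVlt => /predU1P[->|st].
  by rewrite Rintegral_itv_cc subrr expr0n /= mul0r.
pose F u : R := - ((t - u) ^+ k.+1 / k.+1%:R).
have dF (u : R) : is_derive u 1 F ((t - u) ^+ k).
  have FE : F = - (k.+1%:R^-1 \*: ((cst t - id) ^+ k.+1)).
    by apply/funext => v; rewrite /F exprfctE /= mulrC.
  rewrite FE.
  have d := is_deriveN (is_deriveZ (k.+1%:R^-1)
    (is_deriveX k.+1 (is_deriveB (is_derive_cst t u 1) (is_derive_id u 1)))).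
  apply: (is_derive_eq d).
  rewrite sub0r scalerN scalerN opprK /= !scalerA mulrA mulVf ?pnatr_eq0// mul1r.
  by rewrite /= -[LHS]/(_ * 1) mulr1.
have cF : continuous F by move=> u; apply/differentiable_continuous/derivable1_diffP/ex_derive.
have cf : continuous (fun u : R => (t - u) ^+ k).
  exact: continuous_subX.
rewrite /Rintegral (continuous_FTC2 (F := F) st).
- by rewrite -EFinB /= /F subrr expr0n /= mul0r oppr0 add0r opprK.
- exact: continuous_subspaceT.
- split=> [u _||]; first exact: ex_derive.
  + exact/cvg_at_right_filter/cF.
  + exact/cvg_at_left_filter/cF.
- by move=> u _; rewrite derive1E derive_val.
Qed.

(** The simplex [s < u_1 < ... < u_k < t] has volume [(t - s)^k / k!]. *)
Lemma iterated_integral_linear T K x (c : 'I_dim -> R) a b w s t :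
  0 <= K -> bounded_velocity T K x -> 0 <= s -> t <= T ->
  (forall j u, a < u < b -> velocity x j u = c j) ->
  a <= s -> s <= t -> t <= b ->
  iterated_integral x w s t = (\prod_(j <- w) c j) * ((t - s) ^+ size w / (size w)`!%:R).
Proof.
move=> K0 xK + tT xc; elim: w s => [|j w IH] s s0 as_ st tb.
  by rewrite big_nil mul1r divr1.
rewrite /= big_cons.
transitivity (\int[mu]_(u in `[s, t]) ((c j * \prod_(j <- w) c j / (size w)`!%:R)
    * (t - u) ^+ size w)).
  apply: eq_Rintegral_oo.
    by apply: measurable_funM => //; apply: measurable_funX; exact: measurable_funB.
  move=> u /andP[su ut]; rewrite -/(velocity x j u) xc; last first.
    by rewrite (le_lt_trans as_ su) (lt_le_trans ut tb).
  rewrite IH ?(le_trans s0 (ltW su)) ?(le_trans as_ (ltW su)) ?(ltW ut) //.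
  by rewrite !mulrA -!mulrA [_^-1 * _]mulrC.
rewrite RintegralZl //; last first.
  have cf : continuous (fun u : R => (t - u) ^+ size w).
    exact: continuous_subX.
  by apply: continuous_compact_integrable => //; [exact: segment_compact|exact: continuous_subspaceT].
rewrite Rintegral_subX // factS natrM invfM -!mulrA; congr (_ * _).
congr (_ * _); rewrite mulrCA; congr (_ * _).
by rewrite mulrC.
Qed.

Lemma eq_velocity_affine x j (al be : R) a b u : (forall v, a < v < b -> x v 0 j = al + be * v) ->
  a < u < b -> velocity x j u = be.
Proof.
move=> xE ub; rewrite /velocity derive1E.
have d : is_derive u 1 (fun v : R => al + be * v) be.
  have d := is_deriveD (is_derive_cst al u 1) (is_deriveZ be (is_derive_id u 1)).
  by apply: (is_derive_eq d); rewrite add0r -[LHS]/(be * 1) mulr1.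
rewrite -[RHS]derive_val; apply: near_eq_derive.
have : u \in `]a, b[ by rewrite in_itv.
move=> /near_in_itvoo; apply: filterS => v.
by rewrite in_itv /= => /xE.
Qed.

End iterated_integrals.

(** * Dyadic interpolations and their signatures *)

Section dyadic.
Context {R : realType} {dim : nat} (T : R).
Hypothesis T0 : 0 < T.
Implicit Types (x : R -> 'rV[R]_dim) (w : seq 'I_dim) (m l k : nat) (s t u : R).
Local Notation dp := (dyadic_point T).

Lemma dyadic_step_gt0 m : 0 < 2 ^- m * T :> R.
Proof. by rewrite mulr_gt0// invr_gt0 exprn_gt0. Qed.

Lemma dyadic_pointE m l : dp m l = l%:R * (2 ^- m * T).
Proof. by rewrite /dyadic_point mulrA. Qed.

Lemma ltr_dyadic m l k : (dp m l < dp m k) = (l < k)%N.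
Proof. by rewrite !dyadic_pointE ltr_pM2r ?dyadic_step_gt0// ltr_nat. Qed.

Lemma ler_dyadic m l k : (dp m l <= dp m k) = (l <= k)%N.
Proof. by rewrite !dyadic_pointE ler_pM2r ?dyadic_step_gt0// ler_nat. Qed.

Lemma dyadic_point0 m : dp m 0 = 0.
Proof. by rewrite dyadic_pointE mul0r. Qed.

Lemma dyadic_point_end m : dp m (2 ^ m) = T.
Proof. by rewrite dyadic_pointE natrX mulrA divff ?mul1r// expf_neq0. Qed.

Lemma dyadic_point_ge0 m l : 0 <= dp m l.
Proof. by rewrite -(dyadic_point0 m) ler_dyadic. Qed.

Lemma dyadic_point_leT m l : (dp m l <= T) = (l <= 2 ^ m)%N.
Proof. by rewrite -{2}(dyadic_point_end m) ler_dyadic. Qed.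

Lemma dyadic_pointS m l : dp m l.+1 - dp m l = 2 ^- m * T.
Proof. by rewrite !dyadic_pointE -mulrBl -natr1 addrAC subrr add0r mul1r. Qed.

Lemma dyadic_point_refine m r l : dp (m + r) (l * 2 ^ r) = dp m l.
Proof.
rewrite !dyadic_pointE natrM natrX exprD invfM.
have : 2 ^+ r != 0 :> R by rewrite expf_neq0.
by move: (2 ^+ r) => z z0; field; rewrite z0 expf_neq0.
Qed.

(** The formula extends to the right endpoint of the piece, where the truncation already selects
    [l.+1]: both affine pieces take the same value there. *)
Lemma dyadic_approx_affine x m l u : dp m l <= u <= dp m l.+1 ->
  dyadic_linear_approx T x m u =
  x (dp m l) + ((u - dp m l) / (2 ^- m * T)) *: (x (dp m l.+1) - x (dp m l)).
Proof.
move=> /andP[lu ul]; rewrite /dyadic_linear_approx.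
have h0 := dyadic_step_gt0 m.
have uE v k : (k%:R <= v * 2 ^+ m / T) = (dp m k <= v).
  rewrite dyadic_pointE ler_pdivlMr// -ler_pdivrMr ?exprn_gt0//.
  by rewrite -mulrA [T * _]mulrC.
have u0 : 0 <= u by apply: le_trans lu; exact: dyadic_point_ge0.
move: ul; rewrite le_eqVlt => /predU1P[->|ul]; last first.
  rewrite (@truncn_def _ _ l) ?dyadic_pointS// uE lu /=.
  by rewrite ltNge uE -ltNge.
rewrite (@truncn_def _ _ l.+1); last by rewrite uE lexx ltNge uE -ltNge ltr_dyadic ltnSn.
by rewrite subrr mul0r scale0r addr0 dyadic_pointS divff ?gt_eqF// scale1r addrC subrK.
Qed.

Lemma dyadic_approx_point x m l : dyadic_linear_approx T x m (dp m l) = x (dp m l).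
Proof.
have lb : dp m l <= dp m l <= dp m l.+1 by rewrite lexx ler_dyadic /=.
by rewrite (dyadic_approx_affine _ lb) subrr mul0r scale0r addr0.
Qed.

Definition increment x m l (j : 'I_dim) : R := x (dp m l.+1) 0 j - x (dp m l) 0 j.

Lemma velocity_dyadic_approx x m l j u : dp m l < u < dp m l.+1 ->
  velocity (dyadic_linear_approx T x m) j u = increment x m l j / (2 ^- m * T).
Proof.
move=> ub; apply: (@eq_velocity_affine _ _ _ _ (x (dp m l) 0 j -
   dp m l * (increment x m l j / (2 ^- m * T))) _ _ _ _ _ ub) => v /andP[vl lv].
rewrite (@dyadic_approx_affine _ _ l) ?(ltW vl) ?(ltW lv)// !mxE /increment.
by move: (2 ^- m * T)^-1 => h; ring.
Qed.

(** Induction on the number of pieces: each adds to the bound its slope and the value of [derive1]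
    at its right end. *)
Lemma bounded_velocity_dyadic_approx x m :
  exists2 K, 0 <= K & bounded_velocity T K (dyadic_linear_approx T x m).
Proof.
set y := dyadic_linear_approx T x m.
suff H l : exists2 K, 0 <= K & bounded_velocity (dp m l) K y.
  by have [K K0] := H (2 ^ m)%N; rewrite dyadic_point_end; exists K.
elim: l => [|l [K K0 yK]].
  exists (\sum_j `|velocity y j 0|); first by apply: sumr_ge0.
  move=> j; rewrite dyadic_point0; split.
    by rewrite set_itv1; exact: measurable_fun_set1.
  move=> u; rewrite -eq_le => /eqP <-.
  by rewrite (bigD1 j)//= lerDl sumr_ge0.
exists (K + \sum_j (`|increment x m l j / (2 ^- m * T)| + `|velocity y j (dp m l.+1)|)).
  by rewrite addr_ge0// sumr_ge0// => j _; rewrite addr_ge0.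
move=> j; have [mv bv] := yK j; split.
  have l1 : dp m l <= dp m l.+1 by rewrite ler_dyadic.
  have -> : `[0, dp m l.+1]%classic = `[0, dp m l]%classic `|`
      (`]dp m l, dp m l.+1[%classic `|` [set dp m l.+1]) :> set R.
    rewrite setUitv1 ?bnd_simp ?ltr_dyadic// -itv_bndbnd_setU// bnd_simp//.
    exact: dyadic_point_ge0.
  apply/measurable_funU => //; first exact: measurableU.
  split=> //; apply/measurable_funU => //; split; last exact: measurable_fun_set1.
  apply: (eq_measurable_fun (cst (increment x m l j / (2 ^- m * T)))) => //.
  by move=> u; rewrite inE /= in_itv /= => ub; rewrite /y (@velocity_dyadic_approx x m l).
move=> u /andP[u0 ul].
have S0 i : 0 <= `|increment x m l i / (2 ^- m * T)| + `|velocity y i (dp m l.+1)|.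
  by rewrite addr_ge0.
case: (leP u (dp m l)) => [lu|lu].
  rewrite (le_trans (bv u _)) ?u0// lerDl; exact: sumr_ge0.
rewrite (bigD1 j)//=.
have Sr : 0 <= \sum_(i < dim | i != j) (`|increment x m l i / (2 ^- m * T)| +
    `|velocity y i (dp m l.+1)|) by apply: sumr_ge0.
have N1 := normr_ge0 (increment x m l j / (2 ^- m * T)).
have N2 := normr_ge0 (velocity y j (dp m l.+1)).
move: ul; rewrite le_eqVlt => /predU1P[->|ul]; first lra.
rewrite [X in `|X|](@velocity_dyadic_approx x m l) ?lu//; lra.
Qed.

(** Words of all lengths are kept; truncation at level [Num.truncn p] takes place only when rough
    paths are formed. *)
Definition dyadic_signature x m (s t : R) w : R :=
  iterated_integral (dyadic_linear_approx T x m) w s t.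

Lemma dyadic_signature_chen x m w s t u : 0 <= s -> s <= t -> t <= u -> u <= T ->
  dyadic_signature x m s u w = \sum_(i < (size w).+1)
    dyadic_signature x m s t (take i w) * dyadic_signature x m t u (drop i w).
Proof.
have [K K0 yK] := bounded_velocity_dyadic_approx x m.
exact: iterated_integral_chen K0 yK.
Qed.

Lemma dyadic_signature_bound x m : exists2 K, 0 <= K & forall w s t,
  0 <= s -> s <= t -> t <= T -> `|dyadic_signature x m s t w| <= (K * (t - s)) ^+ size w.
Proof.
have [K K0 yK] := bounded_velocity_dyadic_approx x m; exists K => // w s t s0 st tT.
have t0T : 0 <= t <= T by rewrite (le_trans s0 st).
by apply: (iterated_integral_bound w K0 yK t0T).2; rewrite s0.
Qed.

Lemma dyadic_signature_linear x m l w s t : (l < 2 ^ m)%N ->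
  dp m l <= s -> s <= t -> t <= dp m l.+1 ->
  dyadic_signature x m s t w =
  (\prod_(j <- w) ((t - s) / (2 ^- m * T) * increment x m l j)) / (size w)`!%:R.
Proof.
move=> lm ls st tl; have [K K0 yK] := bounded_velocity_dyadic_approx x m.
rewrite /dyadic_signature (iterated_integral_linear _ K0 yK _ _
  (fun j u ub => @velocity_dyadic_approx x m l j u ub) ls st tl).
- rewrite mulrA; congr (_ / _); elim: w => [|j w IH]; first by rewrite !big_nil mulr1.
  by rewrite !big_cons exprS -IH; move: (2 ^- m * T)^-1 => h; ring.
- by rewrite (le_trans _ ls)// dyadic_point_ge0.
- by rewrite (le_trans tl)// dyadic_point_leT.
Qed.

Lemma dyadic_signature_nil x m s t : dyadic_signature x m s t [::] = 1.
Proof. by []. Qed.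

End dyadic.

(** * Chaining and extension to longer words *)

Section word_functionals.
Context {R : realType} {I : Type}.
Implicit Types (x y : seq I -> R) (w : seq I) (de th : R) (n : nat).

(** The product of the tensor algebra, read on words and without truncation. *)
Definition concat x y w : R := \sum_(i < (size w).+1) x (take i w) * y (drop i w).

(* The factor [size w] makes the constant [de] stable under concatenation. *)
Definition close n de th x y := [/\ x [::] = 1, y [::] = 1 &
  forall w, (size w <= n)%N -> [/\ `|x w| <= th ^+ size w, `|y w| <= th ^+ size w &
    `|x w - y w| <= de * (size w)%:R * th ^+ size w]].

(** Binomial formula, each coefficient being at least one. *)
Lemma sum_expr_le (a b : R) n : 0 <= a -> 0 <= b ->
  \sum_(i < n.+1) a ^+ i * b ^+ (n - i) <= (a + b) ^+ n.
Proof.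
move=> a0 b0; rewrite addrC exprDn; apply: ler_sum => i _.
rewrite [X in _ <= X *+ _]mulrC -mulr_natr ler_peMr ?mulr_ge0 ?exprn_ge0//.
by rewrite ler1n bin_gt0 -ltnS.
Qed.

(** Differences of products split as [(x - y) x' + y (x' - y')]. The lengths of prefix and suffix
    add up to [size w], so [de] is unchanged. *)
Lemma close_concat n de th1 th2 x y x' y' : 0 <= de -> 0 <= th1 -> 0 <= th2 ->
  close n de th1 x y -> close n de th2 x' y' ->
  close n de (th1 + th2) (concat x x') (concat y y').
Proof.
move=> de0 th10 th20 [x1 y1 xy] [x'1 y'1 xy'].
split; [by rewrite /concat big_ord1 /= x1 x'1 mulr1| by rewrite /concat big_ord1 /= y1 y'1 mulr1|].
move=> w wn.
have st (i : 'I_(size w).+1) : size (take i w) = i.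
  by rewrite size_takel // -ltnS.
have bd (i : 'I_(size w).+1) : [/\ `|x' (drop i w)| <= th2 ^+ (size w - i),
   `|y' (drop i w)| <= th2 ^+ (size w - i) &
   `|x' (drop i w) - y' (drop i w)| <= de * (size w - i)%:R * th2 ^+ (size w - i)].
  by have := xy' (drop i w); rewrite size_drop; apply; rewrite (leq_trans (leq_subr _ _)).
have bt (i : 'I_(size w).+1) : [/\ `|x (take i w)| <= th1 ^+ i,
   `|y (take i w)| <= th1 ^+ i & `|x (take i w) - y (take i w)| <= de * i%:R * th1 ^+ i].
  by have := xy (take i w); rewrite st; apply; rewrite (leq_trans _ wn)// -ltnS.
split.
- apply: le_trans (ler_norm_sum _ _ _) _; apply: le_trans (sum_expr_le _ th10 th20).
  apply: ler_sum => i _; rewrite normrM; have [? _ _] := bt i; have [? _ _] := bd i.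
  by rewrite ler_pM.
- apply: le_trans (ler_norm_sum _ _ _) _; apply: le_trans (sum_expr_le _ th10 th20).
  apply: ler_sum => i _; rewrite normrM; have [_ ? _] := bt i; have [_ ? _] := bd i.
  by rewrite ler_pM.
- rewrite /concat -sumrB; apply: le_trans (ler_norm_sum _ _ _) _.
  apply: le_trans (ler_wpM2l _ (sum_expr_le _ th10 th20)); last by rewrite mulr_ge0.
  rewrite big_distrr /=; apply: ler_sum => i _.
  have [_ b1 b2] := bt i; have [b3 _ b4] := bd i.
  have -> : x (take i w) * x' (drop i w) - y (take i w) * y' (drop i w) =
    (x (take i w) - y (take i w)) * x' (drop i w) + y (take i w) * (x' (drop i w) - y' (drop i w)).
    by ring.
  apply: le_trans (ler_normD _ _) _; rewrite !normrM.
  apply: (@le_trans _ _ (de * i%:R * th1 ^+ i * th2 ^+ (size w - i) +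
    th1 ^+ i * (de * (size w - i)%:R * th2 ^+ (size w - i)))).
    by rewrite lerD// ler_pM.
  have -> : (size w)%:R = i%:R + (size w - i)%:R :> R.
    by rewrite -natrD subnKC// -ltnS.
  by rewrite le_eqVlt; apply/orP; left; apply/eqP; ring.
Qed.

Lemma close_unit n de x y : x [::] = 1 -> y [::] = 1 ->
  (forall w, (0 < size w)%N -> x w = 0) -> (forall w, (0 < size w)%N -> y w = 0) ->
  close n de 0 x y.
Proof.
move=> x1 y1 x0 y0; split=> // -[|i w] _.
  by rewrite x1 y1 subrr expr0 !normr1 normr0 mulr0 mul0r.
by rewrite x0// y0// subrr expr0n /= !normr0 mulr0.
Qed.

Lemma close_le n de th th' x y : 0 <= de -> 0 <= th -> th <= th' ->
  close n de th x y -> close n de th' x y.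
Proof.
move=> de0 th0 thth' [x1 y1 xy]; split=> // w /xy[b1 b2 b3].
have e : th ^+ size w <= th' ^+ size w by rewrite lerXn2r ?nnegrE// (le_trans th0).
split; [exact: le_trans b1 e|exact: le_trans b2 e|].
by apply: le_trans b3 _; rewrite ler_wpM2l// mulr_ge0.
Qed.

Lemma close_leq n n' de th x y : (n' <= n)%N -> close n de th x y -> close n' de th x y.
Proof. by move=> nn' [x1 y1 xy]; split=> // w wn; apply: xy; exact: leq_trans wn nn'. Qed.

Lemma normr_prod_le (a : I -> R) th w : (forall j, `|a j| <= th) ->
  `|\prod_(j <- w) a j| <= th ^+ size w.
Proof.
move=> ath; elim: w => [|j w IH]; first by rewrite big_nil normr1.
by rewrite big_cons normrM exprS ler_pM.
Qed.

(** The functionals are tensor exponentials of the vectors [a] and [b]; replacing the letters one at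
    a time produces the factor [size w]. *)
Lemma close_prod n de th (a b : I -> R) x y : 0 <= de -> 0 <= th ->
  (forall w, x w = (\prod_(j <- w) a j) / (size w)`!%:R) ->
  (forall w, y w = (\prod_(j <- w) b j) / (size w)`!%:R) ->
  (forall j, `|a j| <= th) -> (forall j, `|b j| <= th) ->
  (forall j, `|a j - b j| <= de * th) -> close n de th x y.
Proof.
move=> de0 th0 xE yE ath bth abth.
have nf (z : R) w : `|z / (size w)`!%:R| <= `|z|.
  rewrite normrM normfV normr_nat ler_piMr// invf_le1 ?ler1n ?ltr0n//; exact: fact_gt0.
split; [by rewrite xE big_nil divr1|by rewrite yE big_nil divr1|].
move=> w _; rewrite xE yE -mulrBl; split.
- exact: le_trans (nf _ _) (normr_prod_le _ ath).
- exact: le_trans (nf _ _) (normr_prod_le _ bth).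
apply: le_trans (nf _ _) _; elim: w => [|j w IH].
  by rewrite !big_nil subrr normr0 mulr0 mul0r.
rewrite !big_cons.
have -> : a j * \prod_(j0 <- w) a j0 - b j * \prod_(j0 <- w) b j0 =
  (a j - b j) * \prod_(j0 <- w) a j0 + b j * (\prod_(j0 <- w) a j0 - \prod_(j0 <- w) b j0).
  by ring.
apply: le_trans (ler_normD _ _) _; rewrite !normrM.
apply: (@le_trans _ _ (de * th * th ^+ size w + th * (de * (size w)%:R * th ^+ size w))).
  by rewrite lerD// ler_pM// normr_prod_le.
rewrite /= exprS -natr1 le_eqVlt; apply/orP; left; apply/eqP; ring.
Qed.

End word_functionals.

(** * Chaining between dyadic points *)

Section chaining.
Context {R : realType} {I : Type} (T : R).
Hypothesis T0 : 0 < T.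
Implicit Types (X Y : R -> R -> seq I -> R) (n r l a b k : nat) (de rho : R).
Local Notation dp := (dyadic_point T).

Definition chen X :=
  [/\ forall s t, 0 <= s -> s <= t -> t <= T -> X s t [::] = 1,
      forall s w, 0 <= s <= T -> (0 < size w)%N -> X s s w = 0 &
      forall s t u w, 0 <= s -> s <= t -> t <= u -> u <= T ->
        X s u w = concat (X s t) (X t u) w].

Lemma chen_close_concat X Y n de th1 th2 s t u : chen X -> chen Y ->
  0 <= de -> 0 <= th1 -> 0 <= th2 -> 0 <= s -> s <= t -> t <= u -> u <= T ->
  close n de th1 (X s t) (Y s t) -> close n de th2 (X t u) (Y t u) ->
  close n de (th1 + th2) (X s u) (Y s u).
Proof.
move=> [_ _ cX] [_ _ cY] de0 th10 th20 s0 st tu uT c1 c2.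
have := close_concat de0 th10 th20 c1 c2.
rewrite /close => -[e1 e2 b]; split; rewrite ?(cX s t u) ?(cY s t u) //.
by move=> w /b; rewrite (cX s t u) ?(cY s t u).
Qed.

Lemma chen_close_refl X Y n de s : chen X -> chen Y -> 0 <= s <= T ->
  close n de 0 (X s s) (Y s s).
Proof.
move=> [X1 X0 _] [Y1 Y0 _] sT; have /andP[s0 sT'] := sT.
by apply: close_unit; rewrite ?X1 ?Y1// => w w0; rewrite ?X0 ?Y0.
Qed.

(** Induction on the generation: the even points between [a] and [b] in generation [r.+1] are points
    of generation [r], and at most one cell remains at each end. Hence each [th i] is counted
    twice. *)
Lemma chaining X Y n de (th : nat -> R) r a b : chen X -> chen Y -> 0 <= de ->
  (forall i, 0 <= th i) -> (a <= b)%N -> (b <= 2 ^ r)%N ->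
  (forall i l, (i <= r)%N -> (a <= l * 2 ^ (r - i))%N -> (l.+1 * 2 ^ (r - i) <= b)%N ->
     close n de (th i) (X (dp i l) (dp i l.+1)) (Y (dp i l) (dp i l.+1))) ->
  close n de (2 * \sum_(i < r.+1) th i) (X (dp r a) (dp r b)) (Y (dp r a) (dp r b)).
Proof.
move=> cX cY de0 th0; elim: r a b => [|r IH] a b ab br H.
  rewrite big_ord1.
  case: (ltngtP a b) ab => // [ab _|-> _]; last first.
    apply: close_le (chen_close_refl _ _ cX cY _) => //; first by rewrite mulr_ge0.
    by rewrite dyadic_point_ge0// dyadic_point_leT.
  have -> : b = a.+1 by move: br; rewrite expn0; lia.
  apply: close_le (H 0%N a _ _ _) => //; first by rewrite ler_peMl// ler1n.
  - by rewrite subnn muln1.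
  - by rewrite subnn muln1.
(* No even point lies between [a] and [b] only if [a = b] is odd. *)
case: (leqP (uphalf a) (half b)) => [ab'|ba]; last first.
  have -> : a = b by lia.
  apply: close_le (chen_close_refl _ _ cX cY _) => //.
    by rewrite mulr_ge0// sumr_ge0.
  by rewrite dyadic_point_ge0// dyadic_point_leT.
have br' : (half b <= 2 ^ r)%N by move: br; rewrite expnS; lia.
have dd k : dp r k = dp r.+1 (k * 2).
  by rewrite -(dyadic_point_refine T r 1) addn1.
have mid : close n de (2 * \sum_(i < r.+1) th i)
  (X (dp r (uphalf a)) (dp r (half b))) (Y (dp r (uphalf a)) (dp r (half b))).
  apply: IH => // i l ir al lb; apply: H; first exact: leq_trans ir _.
  - by rewrite subSn// expnS; lia.
  - by rewrite subSn// expnS; lia.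
have left : close n de (th r.+1) (X (dp r.+1 a) (dp r (uphalf a))) (Y (dp r.+1 a) (dp r (uphalf a))).
  rewrite dd; have [e|e] : (uphalf a * 2 = a \/ uphalf a * 2 = a.+1)%N by lia.
    rewrite e.
    apply: close_le (chen_close_refl _ _ cX cY _) => //.
    by rewrite dyadic_point_ge0// dyadic_point_leT// (leq_trans ab).
  by rewrite e; apply: H; rewrite // subnn expn0; lia.
have right : close n de (th r.+1) (X (dp r (half b)) (dp r.+1 b)) (Y (dp r (half b)) (dp r.+1 b)).
  rewrite dd; have [->|e] : (half b * 2 = b \/ b = (half b * 2).+1)%N by lia.
    apply: close_le (chen_close_refl _ _ cX cY _) => //.
    by rewrite dyadic_point_ge0// dyadic_point_leT.
  by rewrite {2 4}e; apply: H; rewrite // subnn expn0; lia.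
have S0 : 0 <= 2 * \sum_(i < r.+1) th i by rewrite mulr_ge0// sumr_ge0.
have -> : 2 * \sum_(i < r.+2) th i = th r.+1 + (2 * \sum_(i < r.+1) th i) + th r.+1.
  by rewrite big_ord_recr /=; ring.
apply: chen_close_concat right => //.
- by rewrite addr_ge0.
- by rewrite dyadic_point_ge0.
- by rewrite dd ler_dyadic//; lia.
- by rewrite dd ler_dyadic//; lia.
- by rewrite dyadic_point_leT.
apply: chen_close_concat mid => //.
- by rewrite dyadic_point_ge0.
- by rewrite dd ler_dyadic//; lia.
- by rewrite ler_dyadic.
- by rewrite dyadic_point_leT.
Qed.

End chaining.

(** * Extension to longer words *)

Section extension.
Context {R : realType} {I : Type} (T : R).
Hypothesis T0 : 0 < T.
Implicit Types (X Y : R -> R -> seq I -> R) (n r l a b k : nat) (de rho al : R).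
Local Notation dp := (dyadic_point T).

(** For [v] equal to [z1] or [z2], [v^be <= v z^(be - 1)]. *)
Lemma powR_superadd (be z z1 z2 : R) : 1 <= be -> 0 <= z1 -> 0 <= z2 -> z1 + z2 <= z ->
  z1 `^ be + z2 `^ be <= z `^ be.
Proof.
move=> be1 z10 z20 zz.
have z0 : 0 <= z by apply: le_trans zz; rewrite addr_ge0.
have H (v : R) : 0 <= v -> v <= z -> v `^ be <= v * z `^ (be - 1).
  move=> v0 vz; have [->|vn0] := eqVneq v 0.
    by rewrite powR0 ?mul0r// gt_eqF// (lt_le_trans ltr01).
  have -> : v `^ be = v * v `^ (be - 1).
    by rewrite -{2}(powRr1 v0) -powRD ?vn0 ?implybT// addrC subrK.
  rewrite ler_wpM2l// ge0_ler_powR// ?nnegrE// subr_ge0//.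
apply: le_trans (lerD (H z1 z10 _) (H z2 z20 _)) _.
- by apply: le_trans zz; rewrite lerDl.
- by apply: le_trans zz; rewrite lerDr.
rewrite -mulrDl; apply: le_trans (ler_wpM2r (powR_ge0 _ _) zz) _.
have [->|zn0] := eqVneq z 0; first by rewrite mul0r powR_ge0.
by rewrite -{1}(powRr1 z0) -powRD ?zn0 ?implybT// addrC subrK.
Qed.

Lemma powRX (z al : R) k : 0 <= z -> (z `^ al) ^+ k = z `^ (al * k%:R).
Proof. by move=> z0; rewrite powRrM powR_mulrn// powR_ge0. Qed.

Lemma concat_split (x y : seq I -> R) w : (0 < size w)%N -> x [::] = 1 -> y [::] = 1 ->
  concat x y w = x w + y w +
    \sum_(1 <= i < size w) x (take i w) * y (drop i w).
Proof.
move=> w0 x1 y1; rewrite /concat -(big_mkord xpredT (fun i => x (take i w) * y (drop i w))).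
rewrite big_ltn// take0 drop0 x1 mul1r big_nat_recr //= take_size drop_size y1 mulr1.
by ring.
Qed.

(* The factor [C] absorbs the geometric series of the cross terms over the
   generations: rho ^+ K <= rho and K <= (1 - rho) * C ^+ K. *)
Lemma level_step (rho C A c z z1 z2 : R) K n al : (1 < K)%N -> 0 <= rho < 1 ->
  1 <= K%:R * al -> K%:R <= (1 - rho) * C -> 1 <= C -> 0 <= A -> 0 <= c ->
  0 <= z1 -> 0 <= z2 -> z1 + z2 <= z ->
  c * (A * C * rho ^+ n.+1 * z1 `^ al) ^+ K + c * (A * C * rho ^+ n.+1 * z2 `^ al) ^+ K +
    c * (K%:R * (A * rho ^+ n * z `^ al) ^+ K) <=
  c * (A * C * rho ^+ n * z `^ al) ^+ K.
Proof.
move=> K1 /andP[rho0 rho1] Kal KC C1 A0 c0 z10 z20 zz; rewrite -!mulrDr ler_wpM2l//.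
have z0 : 0 <= z by apply: le_trans zz; rewrite addr_ge0.
rewrite !exprMn !powRX// -/(_ `^ _) [al * _]mulrC.
have sup := powR_superadd Kal z10 z20 zz.
set P := z `^ _ in sup *; have P0 : 0 <= P by exact: powR_ge0.
have AK : 0 <= A ^+ K by rewrite exprn_ge0.
have rK : (rho ^+ n.+1) ^+ K <= (rho ^+ n) ^+ K * rho.
  rewrite exprS exprMn mulrC ler_wpM2l ?exprn_ge0//.
  by rewrite -[leRHS]expr1 ler_wiXn2l// ?ltW// ltnW.
have CK : C <= C ^+ K by rewrite -{1}[C]expr1 ler_weXn2l// ltnW.
have C0 : 0 <= C := le_trans ler01 C1.
have rn0 : 0 <= (rho ^+ n) ^+ K by rewrite !exprn_ge0.
apply: (@le_trans _ _ (A ^+ K * C ^+ K * ((rho ^+ n) ^+ K * rho) * P +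
    (1 - rho) * C ^+ K * (A ^+ K * (rho ^+ n) ^+ K * P))).
  apply: lerD.
    rewrite -mulrDr ler_pM ?mulr_ge0 ?exprn_ge0 ?addr_ge0 ?powR_ge0//.
    by rewrite ler_wpM2l// mulr_ge0// exprn_ge0.
  rewrite ler_wpM2r ?mulr_ge0//; apply: le_trans KC _.
  by rewrite ler_wpM2l// subr_ge0 ltW.
by rewrite le_eqVlt; apply/orP; left; apply/eqP; ring.
Qed.

(** In the cross terms prefix and suffix are both proper, so closeness up to length [k] controls
    them for words of length [k.+1]. *)
Lemma cross_terms_le k de B (x y x' y' : seq I -> R) w : 0 <= de -> 0 <= B ->
  close k de B x y -> close k de B x' y' -> size w = k.+1 ->
  [/\ `|\sum_(1 <= i < size w) x (take i w) * x' (drop i w)| <= k.+1%:R * B ^+ k.+1,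
      `|\sum_(1 <= i < size w) y (take i w) * y' (drop i w)| <= k.+1%:R * B ^+ k.+1 &
      `|\sum_(1 <= i < size w) x (take i w) * x' (drop i w) -
        \sum_(1 <= i < size w) y (take i w) * y' (drop i w)| <=
        de * k.+1%:R * (k.+1%:R * B ^+ k.+1)].
Proof.
move=> de0 B0 [_ _ xy] [_ _ xy'] sw.
have E (f : nat -> R) c : 0 <= c -> (forall i, (0 < i < k.+1)%N -> `|f i| <= c) ->
    `|\sum_(1 <= i < size w) f i| <= k.+1%:R * c.
  move=> c0 fc; apply: le_trans (ler_norm_sum _ _ _) _.
  rewrite big_nat_cond.
  apply: (@le_trans _ _ (\sum_(1 <= i < size w | (1 <= i < size w)%N && true) c)).
    by apply: ler_sum => i; rewrite andbT sw => /fc.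
  rewrite -big_nat_cond big_const_nat iter_addr_0 sw subn1 /= -[leLHS]mulr_natl ler_wpM2r// ler_nat leqW//.
have bt i : (0 < i < k.+1)%N -> [/\ `|x (take i w)| <= B ^+ i, `|y (take i w)| <= B ^+ i &
    `|x (take i w) - y (take i w)| <= de * i%:R * B ^+ i].
  move=> /andP[i0 ik]; have st : size (take i w) = i by rewrite size_takel// sw ltnW.
  by have := xy (take i w); rewrite st; apply.
have bd i : (0 < i < k.+1)%N -> [/\ `|x' (drop i w)| <= B ^+ (k.+1 - i),
    `|y' (drop i w)| <= B ^+ (k.+1 - i) &
    `|x' (drop i w) - y' (drop i w)| <= de * (k.+1 - i)%:R * B ^+ (k.+1 - i)].
  move=> /andP[i0 ik]; have st : size (drop i w) = (k.+1 - i)%N by rewrite size_drop sw.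
  have := xy' (drop i w); rewrite st; apply; lia.
have Bi i : (0 < i < k.+1)%N -> B ^+ k.+1 = B ^+ i * B ^+ (k.+1 - i).
  by move=> /andP[_ ik]; rewrite -exprD subnKC// ltnW.
have BK0 : 0 <= B ^+ k.+1 by rewrite exprn_ge0.
split.
- apply: E => // i ik; rewrite normrM (Bi i ik); have [? _ _] := bt i ik; have [? _ _] := bd i ik.
  by rewrite ler_pM.
- apply: E => // i ik; rewrite normrM (Bi i ik); have [_ ? _] := bt i ik; have [_ ? _] := bd i ik.
  by rewrite ler_pM.
rewrite -sumrB [de * _ * _]mulrCA; apply: E; first by rewrite !mulr_ge0.
move=> i ik; have [_ b1 b2] := bt i ik; have [b3 _ b4] := bd i ik.
have -> : x (take i w) * x' (drop i w) - y (take i w) * y' (drop i w) =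
    (x (take i w) - y (take i w)) * x' (drop i w) + y (take i w) * (x' (drop i w) - y' (drop i w)).
    by ring.
apply: le_trans (ler_normD _ _) _; rewrite !normrM (Bi i ik).
apply: (@le_trans _ _ (de * i%:R * B ^+ i * B ^+ (k.+1 - i) +
    B ^+ i * (de * (k.+1 - i)%:R * B ^+ (k.+1 - i)))).
  by rewrite lerD// ler_pM.
have -> : k.+1%:R = i%:R + (k.+1 - i)%:R :> R.
  by rewrite -natrD subnKC// ltnW//; case/andP: ik.
by rewrite le_eqVlt; apply/orP; left; apply/eqP; ring.
Qed.

(** Two inductions: on the word length [k0 + k] and, for each length, downwards from generation [N],
    where [top] controls all lengths up to [kmax]. A downward step halves an interval: the linear
    terms come from the halves, the cross terms from shorter words, and [level_step] shows that the
    constant does not grow. *)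
Lemma extension X Y (om : nat -> nat -> R) N k0 kmax de A rho al :
  chen T X -> chen T Y -> 0 <= de -> 0 <= A -> 0 <= rho < 1 -> (0 < k0)%N ->
  1 <= k0.+1%:R * al -> 0 <= al ->
  (forall n l, 0 <= om n l) ->
  (forall n l, om n.+1 (l * 2)%N + om n.+1 (l * 2).+1 <= om n l) ->
  (forall n l, (l < 2 ^ n)%N -> close k0 de (A * rho ^+ n * om n l `^ al)
     (X (dp n l) (dp n l.+1)) (Y (dp n l) (dp n l.+1))) ->
  (forall l, (l < 2 ^ N)%N -> close kmax de (A * rho ^+ N * om N l `^ al)
     (X (dp N l) (dp N l.+1)) (Y (dp N l) (dp N l.+1))) ->
  forall k, (k0 + k <= kmax)%N -> forall n l, (n <= N)%N -> (l < 2 ^ n)%N ->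
    close (k0 + k) de (A * (kmax%:R / (1 - rho)) ^+ k * rho ^+ n * om n l `^ al)
     (X (dp n l) (dp n l.+1)) (Y (dp n l) (dp n l.+1)).
Proof.
move=> cX cY de0 A0 rho01 k00 k0al al0 om0 omS base top; have /andP[rho0 rho1] := rho01.
elim=> [|k IH] kk n l nN ln.
  by rewrite addn0 expr0 mulr1; exact: base.
(* This ratio meets the requirement [K <= (1 - rho) C] of [level_step] for all lengths
   [K <= kmax]. *)
set C := kmax%:R / (1 - rho); have rho1' : 0 < 1 - rho by rewrite subr_gt0.
have C1 : 1 <= C.
  rewrite /C ler_pdivlMr// mul1r (@le_trans _ _ 1) ?gerBl// ler1n.
  by rewrite (leq_trans _ kk)// (leq_trans k00)// leq_addr.
have C0 : 0 <= C := le_trans ler01 C1.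
rewrite addnS exprSr mulrA.
have AC0 : 0 <= A * C ^+ k by rewrite mulr_ge0// exprn_ge0.
(* Here [j] counts the generations left before [N]. *)
suff H j : forall n l, (n + j = N)%N -> (l < 2 ^ n)%N ->
    close (k0 + k).+1 de (A * C ^+ k * C * rho ^+ n * om n l `^ al)
    (X (dp n l) (dp n l.+1)) (Y (dp n l) (dp n l.+1)).
  by apply: (H (N - n)%N) => //; rewrite subnKC.
have om0' p l' : 0 <= om p l' `^ al by exact: powR_ge0.
have ACC0 : 0 <= A * C ^+ k * C by rewrite mulr_ge0.
elim: j => [|j IHj] {nN ln}n {}l nj ln.
  move: nj; rewrite addn0 => nN; rewrite nN in ln *.
  apply: close_leq (_ : close kmax _ _ _ _); first by rewrite -addnS.
  apply: close_le (top _ ln) => //; first by rewrite !mulr_ge0// exprn_ge0.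
  rewrite ler_wpM2r// ler_wpM2r ?exprn_ge0// -mulrA ler_peMr// -exprSr.
  by rewrite exprn_ege1.
have nN : (n < N)%N by rewrite -nj addnS ltnS leq_addr.
set K := (k0 + k).+1.
have K1 : (1 < K)%N by rewrite /K ltnS (leq_trans k00)// leq_addr.
have Kal : 1 <= K%:R * al.
  by apply: le_trans k0al _; rewrite ler_wpM2r// ler_nat /K ltnS leq_addr.
have KC : K%:R <= (1 - rho) * C.
  by rewrite /C mulrC divfK ?gt_eqF// ler_nat /K -addnS.
pose B := A * C ^+ k * rho ^+ n * om n l `^ al.
have B0 : 0 <= B by rewrite !mulr_ge0// exprn_ge0.
have eqd l' : dp n l' = dp n.+1 (l' * 2) by rewrite -(dyadic_point_refine T n 1) addn1.
have l1 : (l * 2 < 2 ^ n.+1)%N by rewrite expnS mulnC ltn_pmul2l.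
have l2 : ((l * 2).+1 < 2 ^ n.+1)%N by clear -ln; rewrite expnS; lia.
have z12 := omS n l.
have z1 : om n.+1 (l * 2)%N <= om n l by apply: le_trans z12; rewrite lerDl.
have z2 : om n.+1 (l * 2).+1 <= om n l by apply: le_trans z12; rewrite lerDr.
have nj' : (n.+1 + j = N)%N by rewrite addSnnS.
have low l' : (l' < 2 ^ n.+1)%N -> om n.+1 l' <= om n l ->
    close (k0 + k) de B (X (dp n.+1 l') (dp n.+1 l'.+1)) (Y (dp n.+1 l') (dp n.+1 l'.+1)).
  move=> l'n zl; have kk' : (k0 + k <= kmax)%N by rewrite (leq_trans _ kk)// leq_add2l.
  apply: close_le (IH kk' n.+1 l' nN l'n) => //.
    by rewrite !mulr_ge0// ?exprn_ge0.
  rewrite /B ler_pM ?mulr_ge0 ?exprn_ge0//.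
    by rewrite ler_wpM2l// exprS ler_piMl ?exprn_ge0// ltW.
  by rewrite ge0_ler_powR// nnegrE.
have c1 := low _ l1 z1; have c2 := low _ l2 z2.
have [h1 h1' H1] := IHj _ _ nj' l1; have [h2 h2' H2] := IHj _ _ nj' l2.
have [X1 _ cX'] := cX; have [Y1 _ cY'] := cY.
have s0 : 0 <= dp n.+1 (l * 2) by rewrite dyadic_point_ge0.
have s1 : dp n.+1 (l * 2) <= dp n.+1 (l * 2).+1 by rewrite ler_dyadic.
have s2 : dp n.+1 (l * 2).+1 <= dp n.+1 (l * 2).+2 by rewrite ler_dyadic.
have s3 : dp n.+1 (l * 2).+2 <= T by rewrite dyadic_point_leT.
have kk' : (k0 + k <= kmax)%N by rewrite (leq_trans _ kk)// leq_add2l.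
have : close (k0 + k) de (A * C ^+ k * C * rho ^+ n * om n l `^ al)
    (X (dp n l) (dp n l.+1)) (Y (dp n l) (dp n l.+1)).
  apply: close_le (IH kk' n l (ltnW nN) ln) => //.
  by rewrite ler_wpM2r// ler_wpM2r ?exprn_ge0// ler_peMr.
rewrite !eqd [(l.+1 * 2)%N]mulSn add2n => -[_ _ lowP].
split; [by rewrite X1 ?(le_trans s1)|by rewrite Y1 ?(le_trans s1)|].
move=> w; rewrite leq_eqVlt => /predU1P[wK|]; last first.
  exact: lowP.
have w0 : (0 < size w)%N by rewrite wK.
have [b1 b2 b3] := cross_terms_le de0 B0 c1 c2 wK.
have [x1 y1 d1] := H1 w (eq_leq wK); have [x2 y2 d2] := H2 w (eq_leq wK).
rewrite (cX' _ _ _ w s0 s1 s2 s3) (cY' _ _ _ w s0 s1 s2 s3).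
rewrite !concat_split ?h1 ?h1' ?h2 ?h2'//.
have st (c : R) : 0 <= c -> _ := fun c0 => @level_step rho C _ c _ _ _ K n al K1 rho01 Kal KC C1 AC0 c0
  (om0 n.+1 (l * 2)%N) (om0 n.+1 (l * 2).+1) z12.
rewrite -/K in b1 b2 b3; rewrite -wK in st b1 b2 b3.
have := st _ ler01; rewrite !mul1r -/B => st1.
split.
- apply: le_trans st1; apply: le_trans (ler_normD _ _) _; apply: lerD => //.
  by apply: le_trans (ler_normD _ _) _; apply: lerD.
- apply: le_trans st1; apply: le_trans (ler_normD _ _) _; apply: lerD => //.
  by apply: le_trans (ler_normD _ _) _; apply: lerD.
have c0 : 0 <= de * (size w)%:R by rewrite mulr_ge0.
apply: le_trans (st _ c0); rewrite -/B.
set U := X _ _ w; set V := X _ _ w; set W := \sum_(_ <= _ < _) _.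
set U' := Y _ _ w; set V' := Y _ _ w; set W' := \sum_(_ <= _ < _) _.
have -> : U + V + W - (U' + V' + W') = (U - U') + (V - V') + (W - W') by ring.
apply: le_trans (ler_normD _ _) _; apply: lerD => //.
by apply: le_trans (ler_normD _ _) _; apply: lerD.
Qed.

End extension.

(** * The pathwise limit *)

Section control.
Context {R : realType} (T : R) (q : nat -> nat -> nat -> R) (S : R).
Hypothesis T0 : 0 < T.
Hypothesis q0 : forall n m l, 0 <= q n m l.
Hypothesis qS : forall N, \sum_(n < N) \sum_(m < N) \sum_(l < 2 ^ n) q n m l <= S.
Local Notation dp := (dyadic_point T).

(** Truncation to [N] generations and [N] interpolations keeps the sums finite; the properties of a
    control are proved for them and passed to the supremum. *)
Definition partial_control N (s t : R) : R :=
  \sum_(n < N) \sum_(m < N) \sum_(l < 2 ^ n | (s <= dp n l) && (dp n l.+1 <= t)) q n m l.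

Definition control (s t : R) : R := sup (range (fun N => partial_control N s t)).

Lemma partial_control_ge0 N s t : 0 <= partial_control N s t.
Proof. by do 3 (apply: sumr_ge0 => ? _). Qed.

Lemma partial_control_homo N N' s t : (N <= N')%N ->
  partial_control N s t <= partial_control N' s t.
Proof.
move=> NN; rewrite /partial_control.
pose g n m := \sum_(l < 2 ^ n | (s <= dp n l) && (dp n l.+1 <= t)) q n m l.
have g0 n m : 0 <= g n m by apply: sumr_ge0.
have E (f : nat -> R) : (forall i, 0 <= f i) -> \sum_(i < N) f i <= \sum_(i < N') f i.
  move=> f0; rewrite -!(big_mkord xpredT f) (big_cat_nat _ NN) //= lerDl.
  by apply: sumr_ge0.
apply: (@le_trans _ _ (\sum_(n < N) \sum_(m < N') g n m)).
  by apply: ler_sum => n _; exact: (E (g n)).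
by apply: (E (fun n => \sum_(m < N') g n m)) => n; apply: sumr_ge0.
Qed.

Lemma partial_control_le N s t : partial_control N s t <= S.
Proof.
apply: le_trans (qS N); do 2 (apply: ler_sum => ? _).
by rewrite big_mkcond; apply: ler_sum => l _; case: ifPn.
Qed.

Lemma partial_control_mono N s t s' t' : s' <= s -> t <= t' ->
  partial_control N s t <= partial_control N s' t'.
Proof.
move=> ss tt; do 2 (apply: ler_sum => ? _).
rewrite [leLHS]big_mkcond [leRHS]big_mkcond; apply: ler_sum => l _.
case: ifPn => [/andP[a b]|_]; first by rewrite (le_trans ss a) (le_trans b tt).
by case: ifPn.
Qed.

(** A dyadic interval has positive length, so none lies in both [[s, t]] and [[t, u]]; those lying
    in one of them lie in [[s, u]]. *)
Lemma partial_control_superadd N s t u : s <= t -> t <= u ->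
  partial_control N s t + partial_control N t u <= partial_control N s u.
Proof.
move=> st tu; rewrite /partial_control -big_split; apply: ler_sum => n _ /=.
rewrite -big_split; apply: ler_sum => m _ /=.
rewrite !(big_mkcond (fun l => (_ <= dp n _) && _)) /= -big_split /=; apply: ler_sum => l _.
have lt : dp n l < dp n l.+1 by rewrite ltr_dyadic.
case: (boolP ((s <= dp n l) && (dp n l.+1 <= t))) => [/andP[a b]|_].
  rewrite [in X in _ + X]leNgt (lt_le_trans lt b) /= addr0 a /=.
  by rewrite (le_trans b tu).
rewrite add0r; case: ifPn => [/andP[a b]|_]; first by rewrite (le_trans st a) b.
by case: ifPn.
Qed.

Lemma cvg_partial_control s t : partial_control N s t @[N --> \oo] --> control s t.
Proof.
apply: nondecreasing_cvgn.
  by move=> N N' NN; exact: partial_control_homo.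
by exists S => _ [N _ <-]; exact: partial_control_le.
Qed.

Lemma partial_control_le_control N s t : partial_control N s t <= control s t.
Proof.
apply: ub_le_sup; last by exists N.
by exists S => _ [N' _ <-]; exact: partial_control_le.
Qed.

Lemma control_ge0 s t : 0 <= control s t.
Proof. exact: le_trans (partial_control_ge0 0 s t) (partial_control_le_control 0 s t). Qed.

Lemma control_le s t : control s t <= S.
Proof.
apply: ge_sup; first by exists (partial_control 0 s t), 0%N.
by move=> _ [N' _ <-]; exact: partial_control_le.
Qed.

Lemma control_mono s t s' t' : s' <= s -> t <= t' -> control s t <= control s' t'.
Proof.
move=> ss tt; apply: ge_sup; first by exists (partial_control 0 s t), 0%N.
move=> _ [N _ <-]; apply: le_trans (partial_control_le_control N _ _).
exact: partial_control_mono.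
Qed.

Lemma control_superadd s t u : s <= t -> t <= u -> control s t + control t u <= control s u.
Proof.
move=> st tu.
have c : partial_control N s t + partial_control N t u @[N --> \oo] -->
    control s t + control t u by apply: cvgD; exact: cvg_partial_control.
apply: (ler_cvg_to c (@cvg_partial_control s u)); apply: nearW => N.
exact: partial_control_superadd.
Qed.

Lemma le_control n m l : (l < 2 ^ n)%N -> q n m l <= control (dp n l) (dp n l.+1).
Proof.
move=> ln; apply: le_trans (partial_control_le_control (maxn n m).+1 _ _).
have nN : (n < (maxn n m).+1)%N by rewrite ltnS leq_maxl.
have mN : (m < (maxn n m).+1)%N by rewrite ltnS leq_maxr.
rewrite /partial_control (bigD1 (Ordinal nN)) //= (bigD1 (Ordinal mN)) //=.
rewrite (bigD1 (Ordinal ln)) /= ?lexx//.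
by rewrite -!addrA lerDl !addr_ge0// ?sumr_ge0// => ? _; rewrite ?sumr_ge0// => ? _; rewrite sumr_ge0.
Qed.

Lemma control_dyadic_superadd n l :
  control (dp n.+1 (l * 2)) (dp n.+1 (l * 2).+1) +
  control (dp n.+1 (l * 2).+1) (dp n.+1 (l * 2).+2) <= control (dp n l) (dp n l.+1).
Proof.
rewrite -(dyadic_point_refine T n 1 l) -(dyadic_point_refine T n 1 l.+1) addn1 expn1.
rewrite [(l.+1 * 2)%N]mulSn add2n; apply: control_superadd; by rewrite ler_dyadic.
Qed.

Lemma control_sum_le (f : nat -> R) n : (forall i, (i < n)%N -> f i <= f i.+1) ->
  \sum_(i < n) control (f i) (f i.+1) <= control (f 0%N) (f n).
Proof.
elim: n => [_|n IH fn]; first by rewrite big_ord0 control_ge0.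
rewrite big_ord_recr /=.
have f0n k : (k <= n)%N -> f 0%N <= f k.
  elim: k => [//|k IHk kn]; apply: le_trans (IHk (ltnW kn)) (fn _ _); exact: ltnW.
apply: le_trans (control_superadd (f0n n (leqnn n)) (fn n (ltnSn n))).
by rewrite lerD2r; apply: IH => i i_n; apply: fn; exact: ltnW.
Qed.

End control.

(** * Uniform estimates and convergence for one path *)

Section pathwise.
Context {R : realType} {dim : nat} (T : R) (x : R -> 'rV[R]_dim).
Hypothesis T0 : 0 < T.
Local Notation dp := (dyadic_point T).
Local Notation sig := (dyadic_signature T x).

Lemma chen_dyadic_signature m : chen T (sig m).
Proof.
split=> //; last by move=> s t u w s0 st tu uT; exact: dyadic_signature_chen.
move=> s w /andP[s0 sT] w0; have [K _ /(_ w s s s0 (lexx _) sT)] := dyadic_signature_bound T0 x m.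
by rewrite subrr mulr0 expr0n gtn_eqF// normr_le0 => /eqP.
Qed.

(** For [m <= n] the interval lies in one piece of the interpolation, over which the signature is
    the tensor exponential of its first level. *)
Lemma dyadic_signature_fine m n l w : (m <= n)%N -> (l < 2 ^ n)%N ->
  sig m (dp n l) (dp n l.+1) w =
  (\prod_(j <- w) sig m (dp n l) (dp n l.+1) [:: j]) / (size w)`!%:R.
Proof.
move=> mn ln; pose l0 := (l %/ 2 ^ (n - m))%N.
have e k : dp m k = dp n (k * 2 ^ (n - m)).
  by have := dyadic_point_refine T m (n - m) k; rewrite subnKC.
have p0 : (0 < 2 ^ (n - m))%N by rewrite expn_gt0.
have l0m : (l0 < 2 ^ m)%N by rewrite ltn_divLR// -expnD subnKC.
have a1 : dp m l0 <= dp n l by rewrite e ler_dyadic// leq_divM.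
have a2 : dp n l <= dp n l.+1 by rewrite ler_dyadic.
have a3 : dp n l.+1 <= dp m l0.+1 by rewrite e ler_dyadic// ltn_ceil.
rewrite (dyadic_signature_linear T0 x w l0m a1 a2 a3); congr (_ / _).
apply: eq_bigr => j _.
by rewrite (dyadic_signature_linear T0 x _ l0m a1 a2 a3) big_seq1 divr1.
Qed.

Lemma dyadic_signature_lipschitz m w : exists2 C, 0 <= C & forall s s' t' t,
  0 <= s -> s <= s' -> s' <= t' -> t' <= t -> t <= T ->
  `|sig m s t w - sig m s' t' w| <= C * ((s' - s) + (t - t')).
Proof.
have [K K0 bK] := dyadic_signature_bound T0 x m.
have [c1 c2 c3] := chen_dyadic_signature m.
set k := size w; pose C := K * (1 + K * T) ^+ k.
have T0' := ltW T0.
have KT1 : 1 <= 1 + K * T by rewrite lerDl mulr_ge0.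
have KT0 : 0 <= 1 + K * T := le_trans ler01 KT1.
have C0 : 0 <= C by rewrite mulr_ge0// exprn_ge0.
have small s t w' : 0 <= s -> s <= t -> t <= T -> (0 < size w')%N ->
    `|sig m s t w'| <= K * (t - s) * (1 + K * T) ^+ (size w').-1.
  move=> s0 st tT w'0; apply: le_trans (bK _ _ _ s0 st tT) _.
  have ts0 : 0 <= t - s by rewrite subr_ge0.
  rewrite -{1}(prednK w'0) exprS ler_wpM2l ?mulr_ge0// lerXn2r ?nnegrE ?mulr_ge0//.
  apply: (@le_trans _ _ (K * T)); last by rewrite lerDr.
  by rewrite ler_wpM2l// lerBlDr (le_trans tT)// lerDl.
have big s t w' : 0 <= s -> s <= t -> t <= T -> `|sig m s t w'| <= (1 + K * T) ^+ size w'.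
  move=> s0 st tT; apply: le_trans (bK _ _ _ s0 st tT) _.
  have ts0 : 0 <= t - s by rewrite subr_ge0.
  rewrite lerXn2r ?nnegrE ?mulr_ge0//.
  apply: (@le_trans _ _ (K * T)); last by rewrite lerDr.
  by rewrite ler_wpM2l// lerBlDr (le_trans tT)// lerDl.
have prodle (a b : nat) d : (0 < a)%N -> (a + b = k)%N -> 0 <= d ->
    K * d * (1 + K * T) ^+ a.-1 * (1 + K * T) ^+ b <= C * d.
  move=> a0 ab d0; rewrite -mulrA -exprD /C mulrAC ler_wpM2r// ler_wpM2l//.
  by rewrite ler_weXn2l// -ab leq_add2r leq_pred.
exists (k%:R * C); first by rewrite mulr_ge0.
move=> s s' t' t s0 ss' s't' t't tT.
have s'0 := le_trans s0 ss'; have s't := le_trans s't' t't; have s'T := le_trans s't tT.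
have t'T := le_trans t't tT; have t'0 := le_trans s'0 s't'.
have H1 : `|sig m s t w - sig m s' t w| <= k%:R * (C * (s' - s)).
  rewrite (c3 s s' t)// /concat big_ord_recl take0 drop0 c1// mul1r addrAC subrr add0r.
  apply: le_trans (ler_norm_sum _ _ _) _.
  apply: (@le_trans _ _ (\sum_(i < k) C * (s' - s))); last by rewrite sumr_const card_ord mulr_natl.
  apply: ler_sum => i _; rewrite normrM /= /bump /= add1n.
  have st : size (take i.+1 w) = i.+1 by rewrite size_takel.
  have sd : size (drop i.+1 w) = (k - i.+1)%N by rewrite size_drop.
  apply: le_trans (ler_pM (normr_ge0 _) (normr_ge0 _) (small _ _ _ s0 ss' s'T _)
    (big _ _ _ s'0 s't tT)) _; first by rewrite st.
  by rewrite st sd; apply: prodle; rewrite ?subnKC ?subr_ge0.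
have H2 : `|sig m s' t w - sig m s' t' w| <= k%:R * (C * (t - t')).
  rewrite (c3 s' t' t)// /concat big_ord_recr /= take_size drop_size c1// mulr1 addrK.
  apply: le_trans (ler_norm_sum _ _ _) _.
  apply: (@le_trans _ _ (\sum_(i < k) C * (t - t'))); last by rewrite sumr_const card_ord mulr_natl.
  apply: ler_sum => i _; rewrite normrM mulrC.
  have ik : (i < k)%N by [].
  have st : size (take i w) = i by rewrite size_takel// ltnW.
  have sd : size (drop i w) = (k - i)%N by rewrite size_drop.
  apply: le_trans (ler_pM (normr_ge0 _) (normr_ge0 _) (small _ _ _ t'0 t't tT _)
    (big _ _ _ s'0 s't' t'T)) _; first by rewrite sd subn_gt0.
  by rewrite st sd; apply: prodle; rewrite ?subn_gt0 ?subnK ?subr_ge0// ltnW.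
rewrite -mulrA mulrDr mulrDr.
have -> : sig m s t w - sig m s' t' w =
  (sig m s t w - sig m s' t w) + (sig m s' t w - sig m s' t' w) by rewrite addrA subrK.
by apply: le_trans (ler_normD _ _) _; exact: lerD.
Qed.

Lemma geometric_sum_le (rho : R) M M' : 0 <= rho < 1 -> (M <= M')%N ->
  \sum_(M <= m < M') rho ^+ m <= rho ^+ M / (1 - rho).
Proof.
move=> /andP[r0 r1] MM; have r1' : 0 < 1 - rho by rewrite subr_gt0.
rewrite ler_pdivlMr// mulr_suml.
under eq_bigr do rewrite mulrBr mulr1 -exprSr -opprB.
by rewrite sumrN telescope_sumr// opprB gerBl exprn_ge0.
Qed.

Context (q : nat -> nat -> nat -> R) (S rho al c : R) (k0 : nat).
Hypothesis q0 : forall n m l, 0 <= q n m l.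
Hypothesis qS : forall N, \sum_(n < N) \sum_(m < N) \sum_(l < 2 ^ n) q n m l <= S.
Hypothesis rho01 : 0 <= rho < 1.
Hypothesis c0 : 0 <= c.
Hypothesis k00 : (0 < k0)%N.
Hypothesis al01 : 0 <= al.
Hypothesis k0al : 1 <= k0.+1%:R * al.
Hypothesis sig0 : forall n l w, (l < 2 ^ n)%N -> (0 < size w <= k0)%N ->
  `|sig 0 (dp n l) (dp n l.+1) w| <= (c * rho ^+ n * q n 0 l `^ al) ^+ size w.
Hypothesis sigD : forall n m l w, (l < 2 ^ n)%N -> (0 < size w <= k0)%N ->
  `|sig m.+1 (dp n l) (dp n l.+1) w - sig m (dp n l) (dp n l.+1) w| <=
  (c * rho ^+ (n + m) * q n m l `^ al) ^+ size w.

Local Notation ctl := (control T q).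
Local Notation de M := (rho ^+ M / (1 - rho)).

Let rho0 : 0 <= rho. Proof. by case/andP: rho01. Qed.
Let rho1 : 0 < 1 - rho. Proof. by rewrite subr_gt0; case/andP: rho01. Qed.
Let de0 M : 0 <= de M. Proof. by rewrite divr_ge0 ?exprn_ge0// ltW. Qed.
(** A bound for all interpolations at once: the one with [m = 0] plus the geometric series of
    successive differences. *)
Let A0 := c * (1 + (1 - rho)^-1).
Let cA0 : c <= A0. Proof. by rewrite /A0 ler_peMr// lerDl invr_ge0 ltW. Qed.
Let A00 : 0 <= A0. Proof. exact: le_trans cA0. Qed.
Let geometric_ge0 (a z : R) n : 0 <= a -> 0 <= z -> 0 <= a * rho ^+ n * z.
Proof. by move=> a0 z0; apply: mulr_ge0 => //; apply: mulr_ge0 => //; exact: exprn_ge0. Qed.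

Lemma signature_base_close M M' n l : (M <= M')%N -> (l < 2 ^ n)%N ->
  close k0 (de M) (A0 * rho ^+ n * ctl (dp n l) (dp n l.+1) `^ al)
    (sig M (dp n l) (dp n l.+1)) (sig M' (dp n l) (dp n l.+1)).
Proof.
move=> MM ln; set z := ctl _ _ `^ al; pose B := c * rho ^+ n * z.
have z0 : 0 <= z by exact: powR_ge0.
have B0 : 0 <= B by rewrite !mulr_ge0// exprn_ge0.
have qz m : q n m l `^ al <= z.
  by rewrite /z ge0_ler_powR ?nnegrE ?(control_ge0 T q0 qS)//; exact: (le_control T q0 qS m ln).
have b0 w : (0 < size w <= k0)%N -> `|sig 0 (dp n l) (dp n l.+1) w| <= B ^+ size w.
  move=> wk; apply: le_trans (sig0 ln wk) _.
  by rewrite lerXn2r ?nnegrE ?mulr_ge0 ?exprn_ge0 ?powR_ge0// ler_wpM2l// mulr_ge0 ?exprn_ge0.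
have bD m w : (0 < size w <= k0)%N ->
    `|sig m.+1 (dp n l) (dp n l.+1) w - sig m (dp n l) (dp n l.+1) w| <= rho ^+ m * B ^+ size w.
  move=> wk; apply: le_trans (sigD m ln wk) _.
  apply: (@le_trans _ _ ((rho ^+ m * B) ^+ size w)).
    rewrite lerXn2r ?nnegrE ?mulr_ge0 ?exprn_ge0 ?powR_ge0// exprD /B.
    have -> : c * (rho ^+ n * rho ^+ m) * q n m l `^ al = rho ^+ m * (c * rho ^+ n) * q n m l `^ al by ring.
    by rewrite -[leLHS]mulrA ler_wpM2l ?exprn_ge0// ler_wpM2l// mulr_ge0 ?exprn_ge0.
  rewrite exprMn ler_wpM2r ?exprn_ge0//.
  (* The word is not empty, hence [(rho^m)^|w| <= rho^m]. *)
  case/andP: wk => w0 _; rewrite -[leRHS]expr1 ler_wiXn2l ?exprn_ge0//.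
  by rewrite exprn_ile1// ltW//; case/andP: rho01.
have bM m m' w : (m <= m')%N -> (0 < size w <= k0)%N ->
    `|sig m' (dp n l) (dp n l.+1) w - sig m (dp n l) (dp n l.+1) w| <= de m * B ^+ size w.
  move=> mm wk; rewrite -(telescope_sumr (fun i => sig i (dp n l) (dp n l.+1) w) mm).
  apply: le_trans (ler_norm_sum _ _ _) _.
  apply: (@le_trans _ _ (\sum_(m <= i < m') rho ^+ i * B ^+ size w)).
    by apply: ler_sum => i _; exact: bD.
  by rewrite -mulr_suml ler_wpM2r ?exprn_ge0// geometric_sum_le.
have BA : B <= A0 * rho ^+ n * z by rewrite ler_wpM2r// ler_wpM2r ?exprn_ge0.
have bA m w : (size w <= k0)%N ->
    `|sig m (dp n l) (dp n l.+1) w| <= (A0 * rho ^+ n * z) ^+ size w.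
  case: w => [|j w] wk; first by rewrite dyadic_signature_nil normr1 expr0.
  have -> : A0 * rho ^+ n * z = (1 + (1 - rho)^-1) * B by rewrite /A0 /B; ring.
  rewrite exprMn; apply: (@le_trans _ _ ((1 + (1 - rho)^-1) * B ^+ size (j :: w))).
    rewrite -[sig m _ _ _](subrK (sig 0 (dp n l) (dp n l.+1) (j :: w))) addrC mulrDl mul1r.
    apply: le_trans (ler_normD _ _) _; apply: lerD; first exact: b0.
    by have := bM 0%N m (j :: w) (leq0n _) wk; rewrite expr0 mul1r.
  rewrite ler_wpM2r ?exprn_ge0// -[leLHS]expr1 ler_weXn2l// lerDl invr_ge0 ltW//.
split=> // w wk; split; [exact: bA|exact: bA|].
case: w wk => [|j w] wk; first by rewrite !dyadic_signature_nil subrr normr0 mulr0 mul0r.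
rewrite distrC; apply: le_trans (bM M M' (j :: w) MM wk) _.
rewrite -[leRHS]mulrA ler_wpM2l// (@le_trans _ _ ((A0 * rho ^+ n * z) ^+ size (j :: w)))//.
  by rewrite lerXn2r ?nnegrE// (le_trans B0).
by rewrite ler_peMl ?exprn_ge0 ?ler1n// (le_trans B0).
Qed.

(** From generation [M'] on both paths are affine on the interval, so closeness at length one
    propagates to every length [kk]. *)
Lemma signature_fine_close kk M M' n l : (M <= M')%N -> (M' <= n)%N -> (l < 2 ^ n)%N ->
  close kk (de M) (A0 * rho ^+ n * ctl (dp n l) (dp n l.+1) `^ al)
    (sig M (dp n l) (dp n l.+1)) (sig M' (dp n l) (dp n l.+1)).
Proof.
move=> MM Mn ln; have [_ _ b] := signature_base_close MM ln.
have {}b j := b [:: j] k00.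
apply: (close_prod kk (a := fun j => sig M (dp n l) (dp n l.+1) [:: j])
  (b := fun j => sig M' (dp n l) (dp n l.+1) [:: j])) => //.
- by apply: geometric_ge0 => //; exact: powR_ge0.
- by move=> w; apply: dyadic_signature_fine => //; exact: leq_trans Mn.
- by move=> w; apply: dyadic_signature_fine.
- by move=> j; have [+ _ _] := b j; rewrite expr1.
- by move=> j; have [_ + _] := b j; rewrite expr1.
- by move=> j; have [_ _] := b j; rewrite /= expr1 mulr1.
Qed.

(** Generations from [M'] on fall under the affine case; the coarser ones are reached by the
    extension started at [N = M']. *)
Lemma signature_dyadic_close k M M' n l : (M <= M')%N -> (l < 2 ^ n)%N ->
  close (k0 + k) (de M) (A0 * ((k0 + k)%:R / (1 - rho)) ^+ k * rho ^+ n *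
      ctl (dp n l) (dp n l.+1) `^ al)
    (sig M (dp n l) (dp n l.+1)) (sig M' (dp n l) (dp n l.+1)).
Proof.
move=> MM ln; case: (leqP M' n) => [Mn|nM].
  apply: close_le (signature_fine_close _ MM Mn ln) => //.
    by apply: geometric_ge0 => //; exact: powR_ge0.
  rewrite ler_wpM2r ?powR_ge0// ler_wpM2r ?exprn_ge0// ler_peMr// exprn_ege1//.
  rewrite ler_pdivlMr// mul1r (@le_trans _ _ 1) ?gerBl// ler1n.
  by rewrite (leq_trans k00)// leq_addr.
apply: (@extension _ _ _ T0 (sig M) (sig M') (fun n l => ctl (dp n l) (dp n l.+1)) M' k0 (k0 + k)
   _ A0 rho al) => //.
- exact: chen_dyadic_signature.
- exact: chen_dyadic_signature.
- by move=> *; exact: (control_ge0 T q0 qS).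
- by move=> *; exact: (control_dyadic_superadd T0 q0 qS).
- by move=> *; exact: signature_base_close.
- by move=> *; exact: signature_fine_close.
- exact: ltnW.
Qed.

(** The constant of [signature_dyadic_close], summed over the generations, with the factor 2 from
    chaining. *)
Let A1 k := 2 * (A0 * ((k0 + k)%:R / (1 - rho)) ^+ k) / (1 - rho).

Lemma signature_grid_close k M M' r a b : (M <= M')%N -> (a <= b)%N -> (b <= 2 ^ r)%N ->
  close (k0 + k) (de M) (A1 k * ctl (dp r a) (dp r b) `^ al)
    (sig M (dp r a) (dp r b)) (sig M' (dp r a) (dp r b)).
Proof.
move=> MM ab br; set z := ctl _ _ `^ al; have z0 : 0 <= z by exact: powR_ge0.
set A := A0 * ((k0 + k)%:R / (1 - rho)) ^+ k.
have A_0 : 0 <= A by rewrite mulr_ge0// exprn_ge0// divr_ge0// ltW.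
apply: (@close_le _ _ _ _ (2 * \sum_(i < r.+1) (A * rho ^+ i * z))) => //.
- by rewrite mulr_ge0// sumr_ge0// => i _; exact: geometric_ge0.
- rewrite -mulr_suml -mulr_sumr.
  have -> : A1 k * z = 2 * (A * (1 / (1 - rho)) * z) by rewrite /A1 -/A; ring.
  rewrite ler_wpM2l// ler_wpM2r// ler_wpM2l//.
  by rewrite -(big_mkord xpredT (fun i => rho ^+ i)) -(expr0 rho) geometric_sum_le.
apply: (@chaining _ _ _ T0 _ _ _ _ (fun i => A * rho ^+ i * z)) => //.
- exact: chen_dyadic_signature.
- exact: chen_dyadic_signature.
- by move=> i; exact: geometric_ge0.
move=> i l ir al' lb.
have e l' : dp i l' = dp r (l' * 2 ^ (r - i)).
  by have := dyadic_point_refine T i (r - i) l'; rewrite subnKC.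
have p0 : (0 < 2 ^ (r - i))%N by rewrite expn_gt0.
have li : (l < 2 ^ i)%N.
  by rewrite -(ltn_pmul2r p0) -expnD subnKC// (leq_trans _ (leq_trans lb br))// ltn_pmul2r.
apply: close_le (signature_dyadic_close k MM li) => //.
  by apply: geometric_ge0 => //; exact: powR_ge0.
apply: ler_wpM2l; first by apply: mulr_ge0; [exact: A_0|exact: exprn_ge0].
rewrite /z ge0_ler_powR ?nnegrE ?(control_ge0 T q0 qS)//.
by apply: (control_mono T q0 qS); rewrite e ler_dyadic.
Qed.

(** The mesh is taken at most [(t - s) / 2], so that the two inner grid points do not cross. *)
Lemma grid_approx (s t d : R) : 0 <= s -> s < t -> t <= T -> 0 < d ->
  exists r a b, [/\ (a <= b)%N, (b <= 2 ^ r)%N, s <= dp r a, dp r b <= t &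
    dp r a - s <= d /\ t - dp r b <= d].
Proof.
move=> s0' st tT d0; pose d' := Num.min d ((t - s) / 2).
have d'0 : 0 < d' by rewrite lt_min d0 divr_gt0// subr_gt0.
have [r hr] : exists r : nat, 2 ^- r * T <= d'.
  exists (Num.truncn (T / d')).+1; rewrite mulrC ler_pdivrMr ?exprn_gt0//.
  rewrite mulrC -ler_pdivrMr//; apply: (@le_trans _ _ (Num.truncn (T / d')).+1%:R).
    by apply: ltW; case/andP: (truncn_itv (ltW (divr_gt0 T0 d'0))).
  by rewrite -natrX ler_nat ltnW// ltn_expl.
have h0 := dyadic_step_gt0 T0 r.
have itv u : 0 <= u -> dp r (Num.truncn (u / (2 ^- r * T))) <= u <
    dp r (Num.truncn (u / (2 ^- r * T))).+1.
  move=> u0; have := truncn_itv (divr_ge0 u0 (ltW h0)).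
  by rewrite !dyadic_pointE -ler_pdivlMr// -ltr_pdivrMr.
have t0' : 0 <= t := le_trans s0' (ltW st).
have /andP[s1 s2] := itv _ s0'; have /andP[t1 t2] := itv _ t0'.
have hd : 2 ^- r * T <= d by apply: le_trans hr _; rewrite ge_min lexx.
have hd2 : 2 ^- r * T <= (t - s) / 2 by apply: le_trans hr _; rewrite ge_min lexx orbT.
set a := Num.truncn _ in s1 s2; set b := Num.truncn _ in t1 t2.
have ea := dyadic_pointS T r a; have eb := dyadic_pointS T r b.
exists r, a.+1, b; split.
- by rewrite -(ler_dyadic T0 r); lra.
- by rewrite -(dyadic_point_leT T0) (le_trans t1).
- exact: ltW.
- by [].
- by split; lra.
Qed.

(** A bound that is uniform over the grid intervals inside [[s, t]] passes to [[s, t]] by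
    continuity; inner approximation is chosen because the control is monotone. *)
Lemma grid_extension (F : R -> R -> R) (C G s t : R) : 0 <= C ->
  0 <= s -> s < t -> t <= T ->
  (forall s' t', s <= s' -> s' <= t' -> t' <= t ->
     `|F s t - F s' t'| <= C * ((s' - s) + (t - t'))) ->
  (forall r a b, (a <= b)%N -> (b <= 2 ^ r)%N -> s <= dp r a -> dp r b <= t ->
     `|F (dp r a) (dp r b)| <= G) ->
  `|F s t| <= G.
Proof.
move=> C0 s0' st tT lip grid; apply/ler_addgt0Pr => e e0.
have d0 : 0 < e / (2 * (C + 1)) by rewrite divr_gt0// mulr_gt0// ltr_wpDl.
have [r [a [b [ab br sa bt [d1 d2]]]]] := grid_approx s0' st tT d0.
have ab' : dp r a <= dp r b by rewrite ler_dyadic.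
have := lip _ _ sa ab' bt; have := grid r a b ab br sa bt.
set u := F s t; set v := F _ _ => vG uv.
have -> : u = v + (u - v) by rewrite addrC subrK.
apply: le_trans (ler_normD _ _) _; apply: lerD => //; apply: le_trans uv _.
apply: (@le_trans _ _ (C * (e / (2 * (C + 1)) * 2))).
  by rewrite ler_wpM2l//; lra.
have C1 : 0 < C + 1 by rewrite ltr_wpDl.
have -> : e / (2 * (C + 1)) * 2 = e / (C + 1) by field; rewrite ?gt_eqF.
by rewrite mulrA ler_pdivrMr// mulrC ler_wpM2l ?ltW// ltrDl.
Qed.

Lemma signature_close k M M' s t : (M <= M')%N -> 0 <= s -> s <= t -> t <= T ->
  close (k0 + k) (de M) (A1 k * ctl s t `^ al) (sig M s t) (sig M' s t).
Proof.
move=> MM s0' st tT.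
have A10 : 0 <= A1 k.
  apply: divr_ge0; last exact: ltW.
  apply: mulr_ge0 => //; apply: mulr_ge0; first exact: A00.
  by apply: exprn_ge0; apply: divr_ge0 => //; exact: ltW.
have B0 : 0 <= A1 k * ctl s t `^ al by apply: mulr_ge0 => //; exact: powR_ge0.
have cM := chen_dyadic_signature M; have cM' := chen_dyadic_signature M'.
move: st; rewrite le_eqVlt => /predU1P[st|st].
  rewrite -{}st in B0 tT *; apply: close_le (chen_close_refl _ _ cM cM' _) => //.
  by rewrite s0'.
split=> // w wk.
have [C C0 lip] := dyadic_signature_lipschitz M w.
have [C' C'0 lip'] := dyadic_signature_lipschitz M' w.
have grid r a b : (a <= b)%N -> (b <= 2 ^ r)%N -> s <= dp r a -> dp r b <= t ->
    close (k0 + k) (de M) (A1 k * ctl s t `^ al) (sig M (dp r a) (dp r b)) (sig M' (dp r a) (dp r b)).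
  move=> ab br sa bt; apply: close_le (signature_grid_close k MM ab br) => //.
    by apply: mulr_ge0 => //; exact: powR_ge0.
  apply: ler_wpM2l => //; rewrite ge0_ler_powR ?nnegrE ?(control_ge0 T q0 qS)//.
  exact: (control_mono T q0 qS).
split.
- apply: (grid_extension C0 s0' st tT) => [s' t' ss s't tt|r a b ab br sa bt].
    exact: lip.
  by have [_ _ /(_ w wk)[]] := grid r a b ab br sa bt.
- apply: (grid_extension C'0 s0' st tT) => [s' t' ss s't tt|r a b ab br sa bt].
    exact: lip'.
  by have [_ _ /(_ w wk)[]] := grid r a b ab br sa bt.
apply: (grid_extension (F := fun s t => sig M s t w - sig M' s t w) (addr_ge0 C0 C'0) s0' st tT)
  => [s' t' ss s't tt|r a b ab br sa bt]; last first.
  by have [_ _ /(_ w wk)[]] := grid r a b ab br sa bt.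
have -> : sig M s t w - sig M' s t w - (sig M s' t' w - sig M' s' t' w) =
  (sig M s t w - sig M s' t' w) - (sig M' s t w - sig M' s' t' w) by ring.
apply: le_trans (ler_normB _ _) _; rewrite mulrDl.
by apply: lerD; [exact: lip|exact: lip'].
Qed.

Definition signature_limit s t w : R := limn (fun m => sig m s t w).

Lemma cvg_rate M0 : (fun M => de M * M0) @ \oo --> (0 : R).
Proof.
rewrite -(mul0r M0); apply: cvgM; last exact: cvg_cst.
rewrite -(mul0r (1 - rho)^-1); apply: cvgM; last exact: cvg_cst.
by apply: cvg_expr; rewrite ger0_norm//; case/andP: rho01.
Qed.

Lemma cvg_signature s t w : 0 <= s -> s <= t -> t <= T ->
  (fun m => sig m s t w) @ \oo --> signature_limit s t w.
Proof.
move=> s0' st tT; apply/cauchy_cvgP/cauchy_exP => e e0.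
(* The number [k] of additional letters is chosen as the length of the word. *)
have wk : (size w <= k0 + size w)%N by rewrite leq_addl.
set B := (size w)%:R * (A1 (size w) * ctl s t `^ al) ^+ size w.
have /cvgr0_norm_lt/(_ e e0)[M _ HM] := @cvg_rate B.
exists (sig M s t w), M => // m /= Mm.
have [_ _ /(_ w wk)[_ _ b]] := signature_close (size w) Mm s0' st tT.
rewrite /ball /=; apply: le_lt_trans b _; rewrite -mulrA -/B.
exact: le_lt_trans (ler_norm _) (HM M (leqnn M)).
Qed.

(** [M'] tends to infinity while [M] is fixed. *)
Lemma signature_limit_close k M s t : 0 <= s -> s <= t -> t <= T ->
  close (k0 + k) (de M) (A1 k * ctl s t `^ al) (sig M s t) (signature_limit s t).
Proof.
move=> s0' st tT.
have cvgL w := @cvg_signature s t w s0' st tT.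
have nearM (P : nat -> Prop) : (forall m, (M <= m)%N -> P m) -> \forall m \near \oo, P m.
  by move=> H; exists M.
split=> //.
  have := cvgL [::]; rewrite (_ : (fun m => _) = cst 1); last by apply/funext => m.
  by move=> /cvg_lim; rewrite lim_cst// => <-.
move=> w wk; split.
- by have [_ _ /(_ w wk)[]] := signature_close k (leqnn M) s0' st tT.
- apply: (cvgr_to_le (cvg_norm (cvgL w))).
  apply: nearM => m Mm.
  by have [_ _ /(_ w wk)[]] := signature_close k Mm s0' st tT.
- have cvgB' : (fun m => sig M s t w - sig m s t w) @ \oo --> sig M s t w - signature_limit s t w.
    by apply: cvgB (cvgL w); exact: cvg_cst.
  apply: (cvgr_to_le (cvg_norm cvgB')).
  apply: nearM => m Mm.
  by have [_ _ /(_ w wk)[]] := signature_close k Mm s0' st tT.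
Qed.

Lemma signature_limit_bounds n : exists2 C, 0 <= C & forall M s t w,
  0 <= s -> s <= t -> t <= T -> (size w <= n)%N ->
  `|signature_limit s t w| <= (C * ctl s t `^ al) ^+ size w /\
  `|sig M s t w - signature_limit s t w| <=
    de M * n%:R * (C * ctl s t `^ al) ^+ size w.
Proof.
have A10 : 0 <= A1 n.
  apply: divr_ge0; last exact: ltW.
  apply: mulr_ge0 => //; apply: mulr_ge0; first exact: A00.
  by apply: exprn_ge0; apply: divr_ge0 => //; exact: ltW.
exists (A1 n) => // M s t w s0' st tT wn.
have [_ _ /(_ w (leq_trans wn (leq_addl k0 n)))[_ b1 b2]] := signature_limit_close n M s0' st tT.
split=> //; apply: le_trans b2 _; apply: ler_wpM2r.
  by apply: exprn_ge0; apply: mulr_ge0 => //; exact: powR_ge0.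
by rewrite ler_wpM2l// ler_nat.
Qed.

End pathwise.

(** * Estimates in p-variation and uniqueness of limits *)

Section rough_path_bounds.
Context {R : realType} {dim : nat} (T p : R).
Hypothesis T0 : 0 < T.
Hypothesis p1 : 1 <= p.
Local Notation n := (Num.truncn p).
Local Notation tensor := (trunc_tensor R dim n).
Implicit Types (F X Y : R -> R -> tensor) (k : nat).

Lemma partition_point (D : seq R) i : itv_partition 0 T D -> (i <= size D)%N ->
  0 <= nth T (0 :: D) i <= T.
Proof.
by move=> DT iD; rewrite (itv_partition_nth_ge _ DT)// (itv_partition_nth_le _ DT).
Qed.

Lemma partition_lt (D : seq R) i : itv_partition 0 T D -> (i < size D)%N ->
  nth T (0 :: D) i < nth T (0 :: D) i.+1.
Proof. by move=> [/(pathP T) DT _] iD; exact: DT. Qed.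

Lemma sum_powR_le (be : R) (I : Type) (r : seq I) (z : I -> R) : 1 <= be ->
  (forall i, 0 <= z i) -> \sum_(i <- r) z i `^ be <= (\sum_(i <- r) z i) `^ be.
Proof.
move=> be1 z0; elim: r => [|i r IH]; first by rewrite !big_nil powR0// gt_eqF// (lt_le_trans ltr01).
rewrite !big_cons; apply: le_trans (_ : z i `^ be + (\sum_(j <- r) z j) `^ be <= _).
  by rewrite lerD2l.
by apply: powR_superadd; rewrite ?sumr_ge0.
Qed.

(** Counting all words gives a crude comparison, uniform in the level, between the Euclidean norm of
    a level and its largest coordinate. *)
Definition words_card : R := #|{: n.-bseq 'I_dim}|%:R.

Lemma words_card_ge1 : 1 <= words_card.
Proof. by rewrite ler1n; apply/card_gt0P; exists [bseq]. Qed.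

Lemma level_norm_ge0 k (x : tensor) : 0 <= level_norm k x.
Proof. exact: sqrtr_ge0. Qed.

Lemma level_norm_le k (x : tensor) (B : R) : 0 <= B ->
  (forall w : n.-bseq 'I_dim, size w = k -> `|x w| <= B) -> level_norm k x <= words_card * B.
Proof.
move=> B0 xB; rewrite /level_norm -[leRHS]ger0_norm ?mulr_ge0 ?ler0n// -sqrtr_sqr.
apply: ler_wsqrtr; rewrite exprMn.
apply: (@le_trans _ _ (\sum_(w : n.-bseq 'I_dim) B ^+ 2)).
  rewrite big_mkcond; apply: ler_sum => w _; case: eqP => [wk|_]; last exact: sqr_ge0.
  by rewrite -[leLHS]real_normK ?num_real// lerXn2r ?nnegrE// xB.
rewrite sumr_const cardT -cardE -[leLHS]mulr_natl ler_wpM2r ?sqr_ge0//.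
by rewrite -/words_card -[leLHS]expr1 ler_weXn2l// words_card_ge1.
Qed.

Lemma le_level_norm (x : tensor) (w : n.-bseq 'I_dim) : `|x w| <= level_norm (size w) x.
Proof.
rewrite /level_norm -sqrtr_sqr; apply: ler_wsqrtr.
by rewrite (bigD1 w)//= lerDl sumr_ge0// => ? _; exact: sqr_ge0.
Qed.

(** Level [k] is of order [control^(al k)]. Its power [p / k] is of order [control^(al p)], and
    since [1 <= al p] the sum over a partition is at most a constant times [S^(al p)]. *)
Lemma level_pvar_le (q : nat -> nat -> nat -> R) (S al C eta : R) F k :
  (forall n m l, 0 <= q n m l) ->
  (forall N, \sum_(n < N) \sum_(m < N) \sum_(l < 2 ^ n) q n m l <= S) ->
  (0 < k)%N -> 1 <= al * p -> 0 <= C -> 0 <= eta ->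
  (forall s t (w : n.-bseq 'I_dim), 0 <= s -> s <= t -> t <= T -> size w = k ->
     `|F s t w| <= eta * (C * control T q s t `^ al) ^+ k) ->
  (level_pvar T p k F <= (words_card * eta * (C * S `^ al) ^+ k)%:E)%E.
Proof.
move=> q0 qS k0 alp C0 eta0 FB; have p0 : 0 < p := lt_le_trans ltr01 p1.
have pn0 : p != 0 by rewrite gt_eqF.
have kn0 : k%:R != 0 :> R by rewrite pnatr_eq0 -lt0n.
have W0 : 0 <= words_card by exact: ler0n.
apply: ub_ereal_sup => _ [D DT <-]; rewrite lee_fin.
pose f i := nth T (0 :: D) i.
pose A := words_card * eta * C ^+ k.
have A0 : 0 <= A by rewrite !mulr_ge0// exprn_ge0.
have c0 s t : 0 <= control T q s t by exact: (control_ge0 T q0 qS).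
have S0 : 0 <= S by exact: le_trans (c0 0 0) (control_le T q0 qS _ _).
have term i : (i < size D)%N -> level_norm k (F (f i) (f i.+1)) `^ (p / k%:R) <=
    A `^ (p / k%:R) * control T q (f i) (f i.+1) `^ (al * p).
  move=> iD; have /andP[a1 a2] := partition_point DT (ltnW iD).
  have /andP[b1 b2] := partition_point DT iD.
  have ab := ltW (partition_lt DT iD).
  have cal : (control T q (f i) (f i.+1) `^ al) ^+ k =
      control T q (f i) (f i.+1) `^ (al * k%:R) by rewrite powRX.
  apply: (@le_trans _ _ ((A * (control T q (f i) (f i.+1) `^ al) ^+ k) `^ (p / k%:R))).
    rewrite ge0_ler_powR ?nnegrE ?divr_ge0 ?(ltW p0) ?level_norm_ge0//.
      by rewrite mulr_ge0// exprn_ge0 ?powR_ge0.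
    apply: le_trans (level_norm_le _ (fun w wk => FB _ _ w a1 ab b2 wk)) _.
      by rewrite mulr_ge0// exprn_ge0// mulr_ge0// powR_ge0.
    by rewrite /A exprMn !mulrA.
  rewrite powRM ?exprn_ge0 ?powR_ge0// cal -powRrM.
  by rewrite (_ : al * k%:R * (p / k%:R) = al * p)//; field.
have sumle : \sum_(i < size D) level_norm k (F (f i) (f i.+1)) `^ (p / k%:R) <=
    A `^ (p / k%:R) * S `^ (al * p).
  apply: (@le_trans _ _ (\sum_(i < size D) A `^ (p / k%:R) *
     control T q (f i) (f i.+1) `^ (al * p))); first by apply: ler_sum => i _; exact: term.
  rewrite -mulr_sumr ler_wpM2l ?powR_ge0//.
  apply: le_trans (sum_powR_le _ alp _) _ => //.
  rewrite ge0_ler_powR ?nnegrE ?sumr_ge0// ?(le_trans ler01)//.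
  apply: le_trans (control_sum_le T0 q0 qS (f := f) (n := size D) _) (control_le T q0 qS _ _).
  by move=> i iD; exact: ltW (partition_lt DT iD).
apply: (@le_trans _ _ ((A `^ (p / k%:R) * S `^ (al * p)) `^ (k%:R / p))).
  rewrite ge0_ler_powR ?nnegrE ?divr_ge0 ?(ltW p0)// ?mulr_ge0 ?powR_ge0//.
  by apply: sumr_ge0 => i _; exact: powR_ge0.
rewrite powRM ?powR_ge0// -!powRrM.
rewrite (_ : p / k%:R * (k%:R / p) = 1); last by field; rewrite pn0 kn0.
rewrite (_ : al * p * (k%:R / p) = al * k%:R); last by field.
by rewrite powRr1// /A exprMn powRX// !mulrA.
Qed.

Lemma pvar_le (q : nat -> nat -> nat -> R) (S al C eta : R) F :
  (forall n m l, 0 <= q n m l) ->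
  (forall N, \sum_(n < N) \sum_(m < N) \sum_(l < 2 ^ n) q n m l <= S) ->
  1 <= al * p -> 0 <= C -> 0 <= eta ->
  (forall s t (w : n.-bseq 'I_dim), 0 <= s -> s <= t -> t <= T ->
     `|F s t w| <= eta * (C * control T q s t `^ al) ^+ size w) ->
  (pvar T p F <= (words_card * eta * (1 + C * S `^ al) ^+ n)%:E)%E.
Proof.
move=> q0 qS alp C0 eta0 FB.
have W0 : 0 <= words_card by exact: ler0n.
have CS0 : 0 <= C * S `^ al by rewrite mulr_ge0// powR_ge0.
rewrite /pvar big_nat_cond; apply: bigmax_le.
  by rewrite lee_fin !mulr_ge0// exprn_ge0// addr_ge0.
move=> k; rewrite andbT => /andP[k0 kn].
have FBk s t (w : n.-bseq 'I_dim) : 0 <= s -> s <= t -> t <= T -> size w = k ->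
    `|F s t w| <= eta * (C * control T q s t `^ al) ^+ k.
  by move=> s0 st tT <-; exact: FB.
apply: le_trans (level_pvar_le q0 qS k0 alp C0 eta0 FBk) _.
rewrite lee_fin ler_wpM2l ?mulr_ge0//.
(* Adding 1 to the base allows all levels [k <= n] to be bounded by the power [n]. *)
apply: (@le_trans _ _ ((1 + C * S `^ al) ^+ k)).
  by rewrite lerXn2r ?nnegrE ?addr_ge0// lerDr.
by rewrite ler_weXn2l// lerDl.
Qed.

Lemma pvar_ge0 F : (0 <= pvar T p F)%E.
Proof.
by rewrite /pvar; elim/big_rec: _ => // k y _ y0; rewrite le_max y0 orbT.
Qed.

(** There is a partition with [s] and [t] as consecutive points. *)
Lemma le_pvar F s t (w : n.-bseq 'I_dim) : 0 <= s -> s < t -> t <= T -> (0 < size w)%N ->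
  (`|F s t w|%:E <= pvar T p F)%E.
Proof.
move=> s0 st tT w0; have p0 : 0 < p := lt_le_trans ltr01 p1.
(* Partitions are strictly increasing and omit the initial point 0, so [s] is listed only if it is
   positive and [T] only if [t < T]. *)
pose D := (if 0 < s then [:: s] else [::]) ++ t :: (if t < T then [:: T] else [::]).
have DT : itv_partition 0 T D.
  split; rewrite /D.
    case: (ltP 0 s) => s0' /=; rewrite ?s0' ?st ?(le_lt_trans s0 st) /=.
      by case: ifPn => //= ->.
    by case: ifPn => //= ->.
  rewrite last_cat /=; case: ltP => //= Tt; by rewrite eq_le tT Tt.
pose i0 := size (if 0 < s then [:: s] else [::]).
have i0D : (i0 < size D)%N by rewrite /D size_cat /= addnS ltnS leq_addr.
have e0 : nth T (0 :: D) i0 = s.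
  rewrite /i0 /D; case: (ltP 0 s) => //= s0'.
  by apply/eqP; rewrite eq_le s0 s0'.
have e1 : nth T (0 :: D) i0.+1 = t.
  by rewrite /i0 /D; case: (ltP 0 s).
set k := size w.
have kn0 : k%:R != 0 :> R by rewrite pnatr_eq0 -lt0n.
have pn0 : p != 0 by rewrite gt_eqF.
apply: (@le_trans _ _ (level_pvar T p k F)); last first.
  rewrite /pvar; apply: (@le_bigmax_seq _ _ _ _ 0%E k xpredT (fun k => level_pvar T p k F)) => //.
  by rewrite mem_index_iota w0 ltnS size_bseq.
apply: (@le_trans _ _ (((\sum_(i < size D)
      level_norm k (F (nth T (0 :: D) i) (nth T (0 :: D) i.+1))
        `^ (p / k%:R)) `^ (k%:R / p))%:E)); last first.
  by apply: ereal_sup_ubound; exists D.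
rewrite lee_fin; apply: le_trans (le_level_norm _ _) _; rewrite -/k.
have -> : level_norm k (F s t) = (level_norm k (F s t) `^ (p / k%:R)) `^ (k%:R / p).
  rewrite -powRrM (_ : p / k%:R * (k%:R / p) = 1) ?powRr1 ?level_norm_ge0//.
  by field; rewrite pn0 kn0.
rewrite ge0_ler_powR ?nnegrE ?divr_ge0 ?(ltW p0) ?powR_ge0// ?sumr_ge0//.
  by move=> i _; exact: powR_ge0.
have e1' : nth T D i0 = t := e1.
rewrite (bigD1 (Ordinal i0D))//= e0 e1' lerDl sumr_ge0// => i _; exact: powR_ge0.
Qed.

Lemma insub_bseqK (s : seq 'I_dim) : (size s <= n)%N -> insub_bseq n s = s :> seq _.
Proof. by move=> sn; rewrite /insub_bseq val_insubd sn. Qed.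

(** By induction on the length, the cross terms in the product of [X s s] with itself vanish, which
    leaves [z = z + z] for the coordinate [z]. *)
Lemma multiplicative_diag X s (w : n.-bseq 'I_dim) : multiplicative_functional T X ->
  0 <= s <= T -> (0 < size w)%N -> X s s w = 0.
Proof.
move=> [X1 XM] /andP[s0 sT].
have [k] := ubnP (size w); elim: k w => // k IH w wk w0.
have e0 : insub_bseq n [::] = [bseq] :> n.-bseq 'I_dim by apply: val_inj; rewrite /= insub_bseqK.
have ew : insub_bseq n w = w by apply: val_inj; rewrite /= insub_bseqK// size_bseq.
pose x (v : seq 'I_dim) := X s s (insub_bseq n v).
have x1 : x [::] = 1 by rewrite /x e0 X1.
have : X s s w = concat x x w.
  by rewrite {1}(XM s s s)// /tensor_mul ffunE.
rewrite concat_split// {1 2}/x ew big_nat big1 => [|i /andP[i0 iw]].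
  by rewrite addr0 => /eqP; rewrite -subr_eq0 opprD addrA subrr add0r oppr_eq0 => /eqP.
have tn : (size (take i w) <= n)%N by rewrite size_takel ?(ltnW iw)// (leq_trans (ltnW iw)) ?size_bseq.
have st : size (take i w) = i by rewrite size_takel// ltnW.
by rewrite [x _]IH ?mul0r// insub_bseqK// st// (leq_trans iw).
Qed.

Lemma pvar_cvg_pointwise (Z : nat -> R -> R -> tensor) X s t (w : n.-bseq 'I_dim) :
  pvar_cvg T p Z X -> 0 <= s -> s < t -> t <= T -> (0 < size w)%N ->
  (fun m => Z m s t w) @ \oo --> X s t w.
Proof.
move=> ZX s0 st tT w0.
apply/cvgrPdist_lt => e e0; have e0' : (0 < e%:E)%E by rewrite lte_fin.
have : \forall m \near \oo, (rough_dist T p (Z m) X < e%:E)%E.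
  apply: (ZX [set y | (y < e%:E)%E]); apply: open_nbhs_nbhs; split=> //.
  exact: open_ereal_lt_ereal.
apply: filterS => m; rewrite /rough_dist => /(le_lt_trans (le_pvar _ s0 st tT w0)).
by rewrite lte_fin !ffunE distrC.
Qed.

(** Off the diagonal both limits agree with [L] in every coordinate. Partitions do not see the
    diagonal, where multiplicativity determines the value. *)
Lemma pvar_cvg_unique (Z : nat -> R -> R -> tensor) X Y (phi psi : nat -> nat) L :
  multiplicative_functional T X -> multiplicative_functional T Y ->
  pvar_cvg T p Z L -> phi @ \oo --> \oo -> psi @ \oo --> \oo ->
  pvar_cvg T p (Z \o phi) X -> pvar_cvg T p (Z \o psi) Y -> eq_on_simplex T X Y.
Proof.
move=> mX mY ZL phio psio ZX ZY s t s0 st tT; apply/ffunP => w.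
have sT : 0 <= s <= T by rewrite s0 (le_trans st).
have [w0|w0] := posnP (size w).
  have -> : w = [bseq] by apply: val_inj => /=; exact: size0nil.
  by rewrite mX.1// mY.1.
move: st; rewrite le_eqVlt => /predU1P[st|st].
  by rewrite -st !(multiplicative_diag _ sT w0).
have cL := pvar_cvg_pointwise ZL s0 st tT w0.
have cX := pvar_cvg_pointwise ZX s0 st tT w0.
have cY := pvar_cvg_pointwise ZY s0 st tT w0.
transitivity (L s t w).
  exact: (cvg_unique (@Rhausdorff R) cX (cvg_comp _ _ phio cL)).
exact: (cvg_unique (@Rhausdorff R) (cvg_comp _ _ psio cL) cY).
Qed.

End rough_path_bounds.

(** * The limit as a rough path *)

Section rough_limit.
Context {R : realType} {dim : nat} (T p : R) (x : R -> 'rV[R]_dim).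
Hypothesis T0 : 0 < T.
Hypothesis p1 : 1 <= p.
Context (q : nat -> nat -> nat -> R) (S rho al c : R) (k0 : nat).
Local Notation n := (Num.truncn p).
Local Notation dp := (dyadic_point T).
Local Notation sig := (dyadic_signature T x).
Hypothesis q0 : forall n m l, 0 <= q n m l.
Hypothesis qS : forall N, \sum_(n < N) \sum_(m < N) \sum_(l < 2 ^ n) q n m l <= S.
Hypothesis rho01 : 0 <= rho < 1.
Hypothesis c0 : 0 <= c.
Hypothesis k00 : (0 < k0)%N.
Hypothesis al0 : 0 <= al.
Hypothesis k0al : 1 <= k0.+1%:R * al.
Hypothesis alp : 1 <= al * p.
Hypothesis sig0 : forall n l w, (l < 2 ^ n)%N -> (0 < size w <= k0)%N ->
  `|sig 0 (dp n l) (dp n l.+1) w| <= (c * rho ^+ n * q n 0 l `^ al) ^+ size w.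
Hypothesis sigD : forall n m l w, (l < 2 ^ n)%N -> (0 < size w <= k0)%N ->
  `|sig m.+1 (dp n l) (dp n l.+1) w - sig m (dp n l) (dp n l.+1) w| <=
  (c * rho ^+ (n + m) * q n m l `^ al) ^+ size w.

Definition rough_limit (s t : R) : trunc_tensor R dim n :=
  [ffun w : n.-bseq 'I_dim => signature_limit T x s t w].

Lemma dyadic_signature_cvg s t (w : seq 'I_dim) : 0 <= s -> s <= t -> t <= T ->
  (fun m => sig m s t w) @ \oo --> signature_limit T x s t w.
Proof. exact: (cvg_signature T0 q0 qS rho01 c0 k00 al0 k0al sig0 sigD). Qed.

Lemma rough_limit_multiplicative : multiplicative_functional T rough_limit.
Proof.
split=> [s t s0 st tT|s t u s0 st tu uT].
  rewrite ffunE /=; have /cvg_lim <- // := @dyadic_signature_cvg s t [::] s0 st tT.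
  by rewrite (_ : (fun m => _) = cst 1) ?lim_cst//.
have [t0 tT] := (le_trans s0 st, le_trans tu uT).
apply/ffunP => w; rewrite /tensor_mul !ffunE.
have cu := @dyadic_signature_cvg s u w s0 (le_trans st tu) uT.
apply: (cvg_unique (@Rhausdorff R) cu).
rewrite (_ : (fun m => sig m s u w) = (fun m => \sum_(i < (size w).+1)
    sig m s t (take i w) * sig m t u (drop i w))); last first.
  by apply/funext => m; rewrite (dyadic_signature_chen T0 x m w s0 st tu uT).
apply: cvg_big => [|i _]; first exact: add_continuous.
rewrite !ffunE !insub_bseqK.
- by apply: cvgM; exact: dyadic_signature_cvg.
- by rewrite size_drop (leq_trans (leq_subr _ _)) ?size_bseq.
- by rewrite size_take_min (leq_trans (geq_minr _ _)) ?size_bseq.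
Qed.

Lemma rough_limit_pvar : (pvar T p rough_limit < +oo)%E.
Proof.
have [C C0 CB] := signature_limit_bounds T0 q0 qS rho01 c0 k00 al0 k0al sig0 sigD n.
apply: le_lt_trans (pvar_le T0 p1 q0 qS alp C0 ler01 _) (ltry _) => s t w s0 st tT.
by rewrite ffunE mul1r; have [] := CB 0%N s t w s0 st tT (size_bseq w).
Qed.

Lemma rough_limit_cvg : pvar_cvg T p (dyadic_rough_path T p x) rough_limit.
Proof.
have [C C0 CB] := signature_limit_bounds T0 q0 qS rho01 c0 k00 al0 k0al sig0 sigD n.
have /andP[rho0 rho1] := rho01; have rho1' : 0 < 1 - rho by rewrite subr_gt0.
have W0 : 0 <= words_card (R := R) (dim := dim) p by exact: ler0n.
pose G := n%:R * words_card (R := R) (dim := dim) p * (1 + C * S `^ al) ^+ n.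
have cG := @cvg_rate R rho rho01 G.
apply: (squeeze_cvge (f := cst 0%E) (h := fun M => (rho ^+ M / (1 - rho) * G)%:E)).
- apply: nearW => M; rewrite pvar_ge0 /=.
  have e0 : 0 <= rho ^+ M / (1 - rho) * n%:R.
    by rewrite mulr_ge0// divr_ge0// ?exprn_ge0// ltW.
  have -> : rho ^+ M / (1 - rho) * G = words_card (R := R) (dim := dim) p *
     (rho ^+ M / (1 - rho) * n%:R) * (1 + C * S `^ al) ^+ n by rewrite /G; ring.
  apply: (pvar_le T0 p1 q0 qS alp C0 e0) => s t w s0 st tT.
  by rewrite !ffunE; have [] := CB M s t w s0 st tT (size_bseq w).
- exact: cvg_cst.
- by apply: cvg_EFin cG; exact: nearW.
Qed.

Lemma rough_limit_rough_path : rough_path T p rough_limit.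
Proof. by split; [exact: rough_limit_multiplicative|exact: rough_limit_pvar]. Qed.

End rough_limit.

(** * First level and smoothness of the interpolations *)

Section dyadic_paths.
Context {R : realType} {dim : nat} (T : R) (x : R -> 'rV[R]_dim).
Hypothesis T0 : 0 < T.
Local Notation dp := (dyadic_point T).
Local Notation sig := (dyadic_signature T x).
Local Notation approx := (dyadic_linear_approx T x).

Lemma dyadic_piece m (t : R) : 0 <= t -> t < T ->
  exists2 l, (l < 2 ^ m)%N & dp m l <= t <= dp m l.+1.
Proof.
move=> t0 tT; have h0 := dyadic_step_gt0 T0 m.
have /andP[l1 l2] := truncn_itv (divr_ge0 t0 (ltW h0)).
exists (Num.truncn (t / (2 ^- m * T))).
  rewrite -(ltr_dyadic T0 m) dyadic_point_end; apply: le_lt_trans tT.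
  by rewrite dyadic_pointE -ler_pdivlMr.
by rewrite !dyadic_pointE -ler_pdivlMr// l1 -ler_pdivrMr// ltW.
Qed.

(** The first level is additive over adjacent intervals, which reduces the claim to a single affine
    piece. *)
Lemma dyadic_signature1 m (s t : R) j : 0 <= s -> s <= t -> t <= T ->
  sig m s t [:: j] = approx m t 0 j - approx m s 0 j.
Proof.
have add (a b c : R) : 0 <= a -> a <= b -> b <= c -> c <= T ->
    sig m a c [:: j] = sig m a b [:: j] + sig m b c [:: j].
  move=> a0 ab bc cT; rewrite (dyadic_signature_chen T0 x m [:: j] a0 ab bc cT).
  by rewrite !big_ord_recl big_ord0 /= !dyadic_signature_nil mul1r mulr1 addr0 addrC.
have piece l (a b : R) : (l < 2 ^ m)%N -> dp m l <= a -> a <= b -> b <= dp m l.+1 ->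
    sig m a b [:: j] = approx m b 0 j - approx m a 0 j.
  move=> lm la ab bl; rewrite (dyadic_signature_linear T0 x _ lm la ab bl) big_seq1 divr1.
  rewrite !(dyadic_approx_affine T0 x (l := l)) ?la ?(le_trans la ab) ?bl ?(le_trans ab bl)//.
  by rewrite !mxE /increment; move: (2 ^- m * T)^-1 => h; ring.
have from0 l (u : R) : (l <= 2 ^ m)%N -> 0 <= u -> u <= dp m l ->
    sig m 0 u [:: j] = approx m u 0 j - approx m 0 0 j.
  clear s t; elim: l u => [|l IH] t lm t0 tl.
    have -> : t = 0 by apply/eqP; rewrite eq_le t0 andbT -(dyadic_point0 T m).
    have [_ H _] := chen_dyadic_signature x T0 m.
    by rewrite H ?subrr// lexx ltW.
  have [tl'|lt] := leP t (dp m l); first by apply: IH => //; exact: ltnW.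
  have d0 : 0 <= dp m l by rewrite dyadic_point_ge0.
  rewrite (add 0 (dp m l) t)// ?(ltW lt)//; last first.
    by apply: le_trans tl _; rewrite dyadic_point_leT.
  rewrite (IH (dp m l) (ltnW lm) d0 (lexx _)) (piece l)// ?(ltW lt)//.
  by rewrite addrC addrA subrK.
have from0' (u : R) : 0 <= u -> u <= T -> sig m 0 u [:: j] = approx m u 0 j - approx m 0 0 j.
  by move=> u0 uT; apply: (from0 (2 ^ m)%N); rewrite ?dyadic_point_end.
move=> s0 st tT; have := add 0 s t (lexx _) s0 st tT.
rewrite !from0' ?(le_trans s0 st) ?(le_trans st tT)// => e.
by apply: (addrI (approx m s 0 j - approx m 0 0 j)); rewrite -e; ring.
Qed.

(** The interpolation at [t] is a convex combination of the values of the path at two grid points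
    within one mesh of [t]. *)
Lemma dyadic_approx_cvg j (t : R) : {within `[0, T], continuous (fun t => x t 0 j)} ->
  0 <= t <= T -> (fun m => approx m t 0 j) @ \oo --> x t 0 j.
Proof.
move=> /subspace_continuousP cx /andP[t0 tT].
move: (tT); rewrite le_eqVlt => /predU1P[->|tT'].
  rewrite (_ : (fun m => _) = cst (x T 0 j)); first exact: cvg_cst.
  by apply/funext => m; rewrite /= -{2 3}(dyadic_point_end T m) dyadic_approx_point.
have /cx/cvgrPdist_lt H : `[0, T]%classic t by rewrite /= in_itv /= t0.
apply/cvgrPdist_le => e e0; have e20 : 0 < e / 2 by rewrite divr_gt0.
have := H _ e20; rewrite near_withinE => /nbhs_ballP[d /= d0 Hd].
have hm : \forall m \near \oo, 2 ^- m * T < d.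
  have c : (fun m => 2^-1 ^+ m * T) @ \oo --> (0 : R).
    rewrite -(mul0r T); apply: cvgM; last exact: cvg_cst.
    by apply: cvg_expr; rewrite ger0_norm; lra.
  have /cvgr0_norm_lt/(_ d d0) := c; apply: filterS => m.
  by rewrite exprVn ger0_norm// ltW// dyadic_step_gt0.
apply: filterS hm => m hm.
have [l lm /andP[l1 l2]] := dyadic_piece m t0 tT'.
have dS := dyadic_pointS T m l.
have near u : `|t - u| < d -> 0 <= u <= T -> `|x t 0 j - x u 0 j| < e / 2.
  by move=> tu uT; apply: Hd => //; rewrite /= in_itv.
have n1 := near (dp m l); have n2 := near (dp m l.+1).
rewrite (dyadic_approx_affine T0 x (l := l)) ?l1// !mxE -dS.
set y0 := x (dp m l) 0 j in n1 *; set y1 := x (dp m l.+1) 0 j in n2 *.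
set la := (t - dp m l) / _.
have D0 : 0 < dp m l.+1 - dp m l by rewrite dS dyadic_step_gt0.
have la0 : 0 <= la by rewrite divr_ge0 ?subr_ge0// ltW// -subr_gt0.
have la1 : la <= 1 by rewrite ler_pdivrMr// mul1r lerD2r.
have {}n1 : `|x t 0 j - y0| < e / 2.
  apply: n1; first by rewrite ger0_norm ?subr_ge0//; lra.
  by rewrite dyadic_point_ge0// (le_trans l1).
have {}n2 : `|x t 0 j - y1| < e / 2.
  apply: n2; first by rewrite ler0_norm ?subr_le0//; lra.
  by rewrite dyadic_point_ge0// dyadic_point_leT.
have -> : x t 0 j - (y0 + la * (y1 - y0)) = (1 - la) * (x t 0 j - y0) + la * (x t 0 j - y1) by ring.
apply: le_trans (ler_normD _ _) _; rewrite (normrM la) (normrM (1 - la)).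
rewrite [`|la|]ger0_norm// [`|1 - la|]ger0_norm ?subr_ge0//.
move: n1 n2; set a := `|_|; set b := `|_| => n1 n2.
by nra.
Qed.

Lemma piecewise_smooth_dyadic_approx m : piecewise_smooth T (approx m).
Proof.
pose D := [seq dp m i.+1 | i <- iota 0 (2 ^ m)].
have sD : size D = (2 ^ m)%N by rewrite size_map size_iota.
have nD i : (i <= 2 ^ m)%N -> nth T (0 :: D) i = dp m i.
  case: i => [|i] im; first by rewrite /= dyadic_point0.
  by rewrite /= (nth_map 0%N) ?size_iota// nth_iota.
exists D; split.
  split.
    apply/(pathP T) => i; rewrite sD => im.
    have := nD i.+1 im; rewrite /= => ->; have := nD i (ltnW im) => ->.
    by rewrite ltr_dyadic.
  by rewrite (last_nth T) sD nD// dyadic_point_end.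
move=> l; rewrite sD => lm.
pose be j := increment T x m l j / (2 ^- m * T) : R.
pose al j := x (dp m l) 0 j - dp m l * be j.
exists (fun j u => al j + be j * u); split; last first.
  move=> j u; rewrite (nD l.+1)// (nD l (ltnW lm)) => ul; rewrite (dyadic_approx_affine T0 x ul) !mxE.
  by rewrite /al /be /increment; move: (2 ^- m * T)^-1 => h; ring.
move=> j r u.
have d (a b v : R) : is_derive v 1 (fun v : R => a + b * v) b.
  have d := is_deriveD (is_derive_cst a v 1) (is_deriveZ b (is_derive_id v 1)).
  by apply: (is_derive_eq d); rewrite add0r -[LHS]/(b * 1) mulr1.
have [a [b ->]] : exists a b, derive1n r (fun v : R => al j + be j * v) = (fun v => a + b * v).
  elim: r => [|r [a [b E]]]; first by exists (al j), (be j).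
  exists b, 0; rewrite derive1nS E; apply/funext => v.
  by rewrite derive1E (@derive_val _ _ _ _ _ _ _ (d a b v)) mul0r addr0.
by have [] := d a b u.
Qed.

End dyadic_paths.

(** * Moments and independence *)

Section gaussian_moments.
Context {R : realType}.
Local Notation mu := (@lebesgue_measure R).

(** The Radon-Nikodym derivative of [normal_prob] agrees almost everywhere with [normal_pdf], both
    having the same integral over every measurable set. *)
Lemma ge0_integral_normal_prob (m s : R) (f : R -> \bar R) : s != 0 ->
  measurable_fun setT f -> (forall x, (0 <= f x)%E) ->
  (\int[normal_prob m s]_x f x = \int[mu]_x (f x * (normal_pdf m s x)%:E))%E.
Proof.
move=> s0 mf f0; have dom := normal_prob_dominates m s.
rewrite -(Radon_Nikodym_SigmaFinite.change_of_variables dom f0 measurableT mf).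
have gi := Radon_Nikodym_SigmaFinite.f_integrable dom.
have mpdf : measurable_fun setT (fun x => (normal_pdf m s x)%:E).
  by apply/measurable_EFinP; exact: measurable_normal_pdf.
apply: ae_eq_integral => //.
- by apply: emeasurable_funM => //; exact: (measurable_int _ gi).
- exact: emeasurable_funM.
- apply: ae_eqe_mul2l; apply: integral_ae_eq => // A _ mA.
  by rewrite -(Radon_Nikodym_SigmaFinite.f_integral dom mA).
Qed.

(** With [u = (x - m)^2 / (4 s^2)] the densities are proportional to [exp(-2u)] and [exp(-u/2)], and
    [u^2 exp(-u) <= 2]. The right-hand side integrates to its constant, which bounds the fourth
    moment without computing it. *)
Lemma normal_pdf_fourth_le (m s x : R) : s != 0 ->
  (x - m) ^+ 4 * normal_pdf m s x <= 64 * s ^+ 4 * normal_pdf m (2 * s) x.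
Proof.
move=> s0; rewrite !normal_pdfE ?mulf_neq0// /normal_peak /normal_fun.
have s20 : 0 < s ^+ 2 by rewrite exprn_even_gt0.
have -> : Num.sqrt ((2 * s) ^+ 2 * pi *+ 2) = 2 * Num.sqrt (s ^+ 2 * pi *+ 2).
  rewrite exprMn -mulrA -mulrnAr sqrtrM ?sqr_ge0// sqrtr_sqr ger0_norm//.
set k := (Num.sqrt _)^-1; have k0 : 0 <= k by rewrite invr_ge0 sqrtr_ge0.
set y := x - m; pose u := y ^+ 2 / (4 * s ^+ 2).
have u0 : 0 <= u by rewrite /u divr_ge0 ?sqr_ge0// mulr_ge0 ?sqr_ge0.
have e1 : - y ^+ 2 / (s ^+ 2 *+ 2) = - u - u.
  by rewrite /u -mulr_natr; field; rewrite ?s0.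
have e2 : - y ^+ 2 / ((2 * s) ^+ 2 *+ 2) = - (u / 2).
  by rewrite /u -mulr_natr; field; rewrite ?s0.
have e3 : y ^+ 4 = 16 * s ^+ 4 * u ^+ 2 by rewrite /u; field; rewrite ?s0.
rewrite e1 e2 e3 expRD invfM -/k; clearbody k.
have h1 := expR_ge1Dxn 1 u0; rewrite (_ : 2`!%:R = 2) // in h1.
have h2 : u ^+ 2 * expR (- u) <= 2.
  rewrite expRN ler_pdivrMr ?expR_gt0//; lra.
have h3 : expR (- u) <= expR (- (u / 2)) by rewrite ler_expR; lra.
have E0 := expR_ge0 (- u).
have s4 : 0 <= s ^+ 4 by rewrite exprn_even_ge0.
have -> : 16 * s ^+ 4 * u ^+ 2 * (k * (expR (- u) * expR (- u))) =
   (16 * s ^+ 4 * k) * (u ^+ 2 * expR (- u) * expR (- u)) by ring.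
have -> : 64 * s ^+ 4 * (2^-1 * k * expR (- (u / 2))) =
   (16 * s ^+ 4 * k) * (2 * expR (- (u / 2))) by field.
apply: ler_wpM2l; first by apply: mulr_ge0 => //; exact: mulr_ge0.
by apply: ler_pM => //; rewrite mulr_ge0// sqr_ge0.
Qed.

Context d (Omega : measurableType d) (P : probability Omega R).

(** Collects [E X^4 <= 8 E (X - m)^4 + 8 m^4], [E (X - m)^4 <= 64 s^4], [|m| <= 65 |s|] and
    [s^4 <= 64 (E X^2)^2]. *)
Definition gaussian_constant : R := 64 * 8 * (64 + 65 ^+ 4).

(* [measurableTypeR R], which carries the Lebesgue measure and [normal_prob],
   and [R] itself have the same sigma-algebra under different displays. *)
Lemma normal_law (X : {RV P >-> R}) (m s : R) (f : R -> R) :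
  s != 0 -> (forall A, measurable A -> distribution P X A = normal_prob m s A) ->
  measurable_fun [set: measurableTypeR R] f -> (forall x, 0 <= f x) ->
  (\int[P]_w (f (X w))%:E = \int[mu]_x (f x * normal_pdf m s x)%:E)%E.
Proof.
move=> s0 XN mf f0.
have mX0 : measurable_fun setT X by exact: measurable_funPT.
have mX : @measurable_fun _ _ Omega (measurableTypeR R) setT X.
  by move=> mD A mA; exact: mX0.
have mf' : measurable_fun [set: measurableTypeR R] (EFin \o f) by exact/measurable_EFinP.
transitivity (\int[pushforward P (X : Omega -> measurableTypeR R)]_y (EFin \o f) y)%E.
  rewrite (ge0_integral_pushforward mX P measurableT mf')// => y _.
  by rewrite lee_fin.
transitivity (\int[normal_prob m s]_y (EFin \o f) y)%E.
  by apply: eq_measure_integral => A mA _; exact: XN.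
by rewrite ge0_integral_normal_prob.
Qed.

Lemma dirac_law (X : {RV P >-> R}) (m : R) (f : R -> R) :
  (forall A, measurable A -> distribution P X A = dirac m A) ->
  measurable_fun setT f -> (forall x, 0 <= f x) ->
  (\int[P]_w (f (X w))%:E = (f m)%:E)%E.
Proof.
move=> XD mf f0; have mf' : measurable_fun setT (EFin \o f) by exact/measurable_EFinP.
rewrite -(ge0_integral_distribution X mf'); last by move=> y; rewrite lee_fin.
transitivity (\int[dirac m]_y (EFin \o f) y)%E.
  by apply: eq_measure_integral => A mA _; exact: XD.
by rewrite integral_dirac// diracT mul1e.
Qed.

Lemma normal_fourth_moment (X : {RV P >-> R}) (m s : R) : s != 0 ->
  (forall A, measurable A -> distribution P X A = normal_prob m s A) ->
  (\int[P]_w ((X w - m) ^+ 4)%:E <= (64 * s ^+ 4)%:E)%E.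
Proof.
move=> s0 XN.
have mf : measurable_fun [set: measurableTypeR R] (fun x : R => (x - m) ^+ 4).
  by apply: measurable_funX; exact: measurable_funB.
rewrite (normal_law s0 XN mf); last by move=> x; rewrite exprn_even_ge0.
have mp t : measurable_fun [set: measurableTypeR R] (normal_pdf m t) by exact: measurable_normal_pdf.
have mpE t : measurable_fun [set: measurableTypeR R] (fun x => (normal_pdf m t x)%:E).
  by apply/measurable_EFinP; exact: mp.
apply: (@le_trans _ _ (\int[mu]_x ((64 * s ^+ 4)%:E * (normal_pdf m (2 * s) x)%:E))%E).
  apply: ge0_le_integral => //.
  - by move=> x _; rewrite lee_fin mulr_ge0 ?exprn_even_ge0 ?normal_pdf_ge0.
  - by apply/measurable_EFinP; exact: (measurable_funM mf (mp s)).
  - by apply: emeasurable_funM => //; exact: mpE.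
  - by move=> x _; rewrite -EFinM lee_fin normal_pdf_fourth_le.
rewrite ge0_integralZl//.
- by rewrite integral_normal_pdf mule1.
- by move=> x _; rewrite lee_fin normal_pdf_ge0.
- by rewrite lee_fin mulr_ge0// exprn_even_ge0.
Qed.

(** The density is at most [1 / (|s| sqrt(2 pi))], so [[-|s|/2, |s|/2]] has mass at most one half
    wherever the centre [m] lies; outside of it [x^2 >= s^2 / 4]. *)
Lemma normal_second_moment (X : {RV P >-> R}) (m s : R) : s != 0 ->
  (forall A, measurable A -> distribution P X A = normal_prob m s A) ->
  ((s ^+ 2 / 8)%:E <= \int[P]_w ((X w) ^+ 2)%:E)%E.
Proof.
move=> s0 XN; have sn0 : 0 < `|s| by rewrite normr_gt0.
have mf : measurable_fun [set: measurableTypeR R] (fun x : R => x ^+ 2) by exact: measurable_funX.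
rewrite (normal_law s0 XN mf); last by move=> x; rewrite sqr_ge0.
have mp t : measurable_fun [set: measurableTypeR R] (normal_pdf m t) by exact: measurable_normal_pdf.
have mpE : measurable_fun [set: measurableTypeR R] (fun x => (normal_pdf m s x)%:E).
  by apply/measurable_EFinP; exact: mp.
pose I := `[- (`|s| / 2), `|s| / 2]%classic : set R.
have mI : measurable I := measurable_itv _.
have small : (\int[mu]_(x in I) (normal_pdf m s x)%:E <= (1 / 2)%:E)%E.
  apply: (@le_trans _ _ (\int[mu]_(x in I) (normal_peak s)%:E)%E).
    apply: ge0_le_integral => //.
    - by move=> x _; rewrite lee_fin normal_pdf_ge0.
    - exact: measurable_funTS mpE.

    - by move=> x _; rewrite lee_fin normal_pdf_ub.
  have eI : lebesgue_measure I = `|s|%:E.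
    rewrite /I lebesgue_measure_itv /= lte_fin; have -> : - (`|s| / 2) < `|s| / 2 by lra.
    by rewrite -EFinD; congr EFin; lra.
  apply: (@le_trans _ _ ((normal_peak s)%:E * lebesgue_measure I)%E).
    by rewrite integral_cst.
  rewrite eI -EFinM lee_fin.
  have s20 : 0 < s ^+ 2 * pi *+ 2 by rewrite mulrn_wgt0// mulr_gt0 ?pi_gt0// exprn_even_gt0.
  rewrite /normal_peak mulrC ler_pdivrMr ?sqrtr_gt0// -sqrtr_sqr.
  have -> : 1 / 2 * Num.sqrt (s ^+ 2 * pi *+ 2) = Num.sqrt (s ^+ 2 * pi *+ 2 / 4).
    rewrite [in RHS]sqrtrM ?(ltW s20)// mulrC; congr (_ * _).
    by rewrite (_ : 4^-1 = (1 / 2) ^+ 2 :> R) ?sqrtr_sqr ?ger0_norm//; field.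
  apply: ler_wsqrtr; rewrite ler_pdivlMr// -mulr_natr.
  have := sqr_ge0 s; have := @pi_ge2 R; nra.
have big : ((1 / 2)%:E <= \int[mu]_(x in ~` I) (normal_pdf m s x)%:E)%E.
  have t1 := integral_normal_pdf m s.
  rewrite -(setUv I) ge0_integral_setU// in t1; first last.
  - by rewrite disj_set2E setICr.
  - by move=> x _; rewrite lee_fin normal_pdf_ge0.
  - exact: measurable_funTS mpE.
  - exact: measurableC.
  rewrite leNgt; apply/negP => lt; move: t1; apply/eqP; rewrite lt_eqF//.
  have -> : 1%E = ((1 / 2)%:E + (1 / 2)%:E)%E :> \bar R by rewrite -EFinD; congr EFin; lra.
  apply: lee_ltD => //; rewrite ge0_fin_numE; first exact: le_lt_trans small (ltry _).
  by apply: integral_ge0 => x _; rewrite lee_fin normal_pdf_ge0.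
apply: (@le_trans _ _ (\int[mu]_(x in ~` I) ((s ^+ 2 / 4)%:E * (normal_pdf m s x)%:E))%E).
  rewrite ge0_integralZl//; first last.
  - by rewrite lee_fin divr_ge0 ?sqr_ge0.
  - by move=> x _; rewrite lee_fin normal_pdf_ge0.
  - exact: measurable_funTS mpE.
  - exact: measurableC.
  apply: (@le_trans _ _ ((s ^+ 2 / 4)%:E * (1 / 2)%:E)%E).
    by rewrite -EFinM lee_fin; lra.
  by rewrite lee_wpmul2l// lee_fin divr_ge0 ?sqr_ge0.
have mg : measurable_fun [set: measurableTypeR R]
    (fun x : R => (x ^+ 2 * normal_pdf m s x)%:E).
  by apply/measurable_EFinP; exact: (measurable_funM mf (mp s)).
apply: (@le_trans _ _ (\int[mu]_(x in ~` I) (x ^+ 2 * normal_pdf m s x)%:E)%E).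
  apply: ge0_le_integral => //.
  - exact: measurableC.
  - by move=> x _; rewrite -EFinM lee_fin mulr_ge0 ?divr_ge0 ?sqr_ge0 ?normal_pdf_ge0.
  - by apply: emeasurable_funM => //; exact: measurable_funTS mpE.
  - exact: measurable_funTS mg.
  - move=> x /= /negP; rewrite in_itv /= -ler_norml -ltNge => sx.
    rewrite -EFinM lee_fin ler_wpM2r ?normal_pdf_ge0//.
    by rewrite -(real_normK (num_real s)) -(real_normK (num_real x)); nra.
apply: ge0_subset_integral => //; first exact: measurableC.
by move=> x _; rewrite lee_fin mulr_ge0 ?sqr_ge0 ?normal_pdf_ge0.
Qed.

Lemma gaussian_fourth_integrable (X : {RV P >-> R}) : gaussian_rv P X ->
  P.-integrable setT (fun w => ((X w) ^+ 4)%:E).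
Proof.
have mX : measurable_fun setT (fun w => ((X w) ^+ 4)%:E).
  by apply/measurable_EFinP; exact: measurable_funX.
move=> [m [s [[s0 XN]|XD]]].
- have mY : measurable_fun setT (fun w => (X w - m) ^+ 4).
    by apply: measurable_funX; exact: measurable_funB.
  have iY : P.-integrable setT (EFin \o (fun w => 8 * (X w - m) ^+ 4)).
    have iY : P.-integrable setT (EFin \o (fun w => (X w - m) ^+ 4)).
      apply/integrableP; split; first exact/measurable_EFinP.
      under eq_integral do rewrite gee0_abs ?lee_fin ?exprn_even_ge0//.
      exact: le_lt_trans (normal_fourth_moment s0 XN) (ltry _).
    exact: (integrableZl measurableT 8 iY).
  have ic : P.-integrable setT (EFin \o cst (8 * m ^+ 4)).
    exact: finite_measure_integrable_cst.
  apply: le_integrable (integrableD measurableT iY ic) => // w _.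
  have x4 : 0 <= X w ^+ 4 by rewrite exprn_even_ge0.
  have y4 : 0 <= 8 * (X w - m) ^+ 4 + 8 * m ^+ 4.
    by apply: addr_ge0; apply: mulr_ge0 => //; rewrite exprn_even_ge0.
  rewrite /= lee_fin ger0_norm// [leRHS]ger0_norm//.
  set x := X w; have -> : x = (x - m) + m by rewrite subrK.
  move: (x - m) => y; rewrite addrK.
  have := sqr_ge0 (y - m); have := sqr_ge0 (y ^+ 2 - m ^+ 2); have := sqr_ge0 y; have := sqr_ge0 m.
  nra.
- apply/integrableP; split=> //.
  under eq_integral do rewrite gee0_abs ?lee_fin ?exprn_even_ge0//.
  have mf : measurable_fun setT (fun x : R => x ^+ 4) by exact: measurable_funX.
  have f0 (x : R) : 0 <= x ^+ 4 by rewrite exprn_even_ge0.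
  by rewrite (dirac_law XD mf f0) ltry.
Qed.

Lemma EFin_Rintegral (f : Omega -> R) : P.-integrable setT (EFin \o f) ->
  ((\int[P]_w f w)%R)%:E = (\int[P]_w (f w)%:E)%E.
Proof. by move=> fi; rewrite /Rintegral fineK//; exact: integrable_fin_num. Qed.

Lemma le_integrable_real (f g : Omega -> R) : measurable_fun setT f ->
  P.-integrable setT (EFin \o g) -> (forall w, `|f w| <= g w) ->
  P.-integrable setT (EFin \o f).
Proof.
move=> mf gi fg; apply: le_integrable gi => //; first exact/measurable_EFinP.
by move=> w _; rewrite lee_fin (le_trans (fg w))// ler_norm.
Qed.

Lemma integrable_cst_prob (c : R) : P.-integrable setT (EFin \o cst c).
Proof. exact: finite_measure_integrable_cst. Qed.

(** The parameters [m] and [s] given by [gaussian_rv] are not identified with mean and standard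
    deviation. They are bounded through moments instead: [s^2 <= 8 E X^2] and, [X] being centred,
    [|m| = |E (X - m)| <= 65 |s|]. *)
Lemma gaussian_fourth_moment (X : {RV P >-> R}) : gaussian_rv P X ->
  \int[P]_w X w = 0 ->
  \int[P]_w (X w ^+ 4) <= gaussian_constant * (\int[P]_w (X w ^+ 2)) ^+ 2.
Proof.
move=> XG X0; have mX : measurable_fun setT X by exact: measurable_funPT.
have i4 : P.-integrable setT (EFin \o (fun w => X w ^+ 4)) by exact: gaussian_fourth_integrable.
have i5 : P.-integrable setT (EFin \o (fun w => 1 + X w ^+ 4)).
  exact: (integrableD measurableT (integrable_cst_prob 1) i4).
have i2 : P.-integrable setT (EFin \o (fun w => X w ^+ 2)).
  apply: (le_integrable_real _ i5); first exact: measurable_funX.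
  move=> w; rewrite ger0_norm ?sqr_ge0//.
  by have := sqr_ge0 (X w ^+ 2 - 1); have := sqr_ge0 (X w); nra.
have i1 : P.-integrable setT (EFin \o X).
  apply: (le_integrable_real _ i5) => // w.
  rewrite ler_norml; have := sqr_ge0 (X w ^+ 2 - 1); have := sqr_ge0 (X w - 1); have := sqr_ge0 (X w + 1).
  by move=> *; apply/andP; split; nra.
have K1 : 1 <= gaussian_constant by rewrite /gaussian_constant; lra.
case: XG => m [s [[s0 XN]|XD]]; last first.
  have e4 : \int[P]_w (X w ^+ 4) = m ^+ 4.
    apply: EFin_inj; rewrite EFin_Rintegral// (dirac_law (f := fun x => x ^+ 4) XD)//.
    by move=> x; rewrite exprn_even_ge0.
  have e2 : \int[P]_w (X w ^+ 2) = m ^+ 2.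
    apply: EFin_inj; rewrite EFin_Rintegral// (dirac_law (f := fun x => x ^+ 2) XD)//.
    by move=> x; rewrite sqr_ge0.
  by rewrite e4 e2 -exprM ler_peMl// exprn_even_ge0.
have sn0 : 0 < `|s| by rewrite normr_gt0.
have mY : measurable_fun setT (fun w => X w - m) by exact: measurable_funB.
have iY1 : P.-integrable setT (EFin \o (fun w => X w - m)).
  exact: (integrableB measurableT i1 (integrable_cst_prob m)).
have iY4 : P.-integrable setT (EFin \o (fun w => (X w - m) ^+ 4)).
  apply/integrableP; split; first by apply/measurable_EFinP; exact: measurable_funX.
  under eq_integral do rewrite gee0_abs ?lee_fin ?exprn_even_ge0//.
  exact: le_lt_trans (normal_fourth_moment s0 XN) (ltry _).
have EY4 : \int[P]_w ((X w - m) ^+ 4) <= 64 * s ^+ 4.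
  by rewrite -lee_fin EFin_Rintegral//; exact: normal_fourth_moment XN.
have EX2 : s ^+ 2 / 8 <= \int[P]_w (X w ^+ 2).
  by rewrite -lee_fin EFin_Rintegral//; exact: normal_second_moment XN.
have Icst c : \int[P]_w c = c.
  rewrite Rintegral_cst//; have -> : fine (P setT) = 1 by rewrite probability_setT.
  by rewrite mulr1.
have EY1 : \int[P]_w (X w - m) = - m.
  by rewrite RintegralB//; [rewrite X0 Icst sub0r|exact: integrable_cst_prob].
(* Integrating [|y| <= |s| + |s|^-3 y^4] at [y = X - m] gives [|s| + 64 |s|]. *)
have mb : `|m| <= 65 * `|s|.
  rewrite -normrN -EY1; apply: le_trans (le_normr_Rintegral measurableT iY1) _.
  have ib : P.-integrable setT (EFin \o (fun w => `|s| + `|s| ^- 3 * (X w - m) ^+ 4)).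
    exact: (integrableD measurableT (integrable_cst_prob `|s|)
      (integrableZl measurableT (`|s| ^- 3) iY4)).
  apply: (@le_trans _ _ (\int[P]_w (`|s| + `|s| ^- 3 * (X w - m) ^+ 4))).
    apply: le_Rintegral => //.
      by apply: (le_integrable_real _ (integrable_norm iY1)) => [|w];
        [exact: measurableT_comp|rewrite normr_id].
    move=> w _; set y := X w - m.
    have -> : y ^+ 4 = `|y| ^+ 4 by rewrite -normrX ger0_norm// exprn_even_ge0.
    case: (leP `|y| `|s|) => [ys|sy]; first by rewrite ler_wpDr// mulr_ge0 ?invr_ge0 ?exprn_ge0.
    rewrite ler_wpDl// mulrC ler_pdivlMr ?exprn_gt0// [leRHS]exprS ler_wpM2l//.
    by rewrite lerXn2r ?nnegrE// ltW.
  rewrite RintegralD//; [|exact: integrable_cst_prob|exact: (integrableZl measurableT _ iY4)].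
  rewrite Icst RintegralZl//.
  have -> : 65 * `|s| = `|s| + `|s| ^- 3 * (64 * s ^+ 4).
    have -> : s ^+ 4 = `|s| ^+ 4 by rewrite -normrX ger0_norm// exprn_even_ge0.
    by field; rewrite gt_eqF.
  by rewrite lerD2l ler_wpM2l// invr_ge0 exprn_ge0.
have m4 : m ^+ 4 <= 65 ^+ 4 * s ^+ 4.
  have -> : m ^+ 4 = `|m| ^+ 4 by rewrite -normrX ger0_norm// exprn_even_ge0.
  have -> : s ^+ 4 = `|s| ^+ 4 by rewrite -normrX ger0_norm// exprn_even_ge0.
  by rewrite -exprMn lerXn2r ?nnegrE// mulr_ge0.
have EX4 : \int[P]_w (X w ^+ 4) <= 8 * (64 * s ^+ 4) + 8 * m ^+ 4.
  have ib : P.-integrable setT (EFin \o (fun w => 8 * (X w - m) ^+ 4 + 8 * m ^+ 4)).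
    exact: (integrableD measurableT (integrableZl measurableT 8 iY4) (integrable_cst_prob _)).
  apply: (@le_trans _ _ (\int[P]_w (8 * (X w - m) ^+ 4 + 8 * m ^+ 4))).
    apply: le_Rintegral => // w _.
    set x := X w; have -> : x = (x - m) + m by rewrite subrK.
    move: (x - m) => y; rewrite addrK.
    have := sqr_ge0 (y - m); have := sqr_ge0 (y ^+ 2 - m ^+ 2); have := sqr_ge0 y; have := sqr_ge0 m.
    nra.
  rewrite RintegralD//; [|exact: (integrableZl measurableT _ iY4)|exact: integrable_cst_prob].
  by rewrite Icst RintegralZl// lerD2r ler_wpM2l.
have s4 : s ^+ 4 <= 64 * (\int[P]_w (X w ^+ 2)) ^+ 2.
  have : s ^+ 2 <= 8 * \int[P]_w (X w ^+ 2) by lra.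
  have -> : 64 * (\int[P]_w (X w ^+ 2)) ^+ 2 = (8 * \int[P]_w (X w ^+ 2)) ^+ 2 by rewrite exprMn; lra.
  move=> h; rewrite (_ : 4 = 2 * 2)%N// exprM lerXn2r ?nnegrE ?sqr_ge0//.
  exact: le_trans (sqr_ge0 _) h.
apply: le_trans EX4 _; rewrite /gaussian_constant; lra.
Qed.

End gaussian_moments.

(** * Independence *)

Section independence.
Context {R : realType} d (Omega : measurableType d) (P : probability Omega R).

Definition independent_classes (F G : set (set Omega)) : Prop :=
  forall A B, F A -> G B -> P (A `&` B) = (P A * P B)%E.

Lemma independent_classesC (F G : set (set Omega)) :
  independent_classes F G -> independent_classes G F.
Proof. by move=> FG A B GA FB; rewrite setIC muleC FG. Qed.

(** For fixed [B], the measurable sets [A] satisfying the product formula form a Dynkin system. *)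
Lemma independent_classes_sigma (F G : set (set Omega)) :
  setI_closed F -> F `<=` measurable -> G `<=` measurable ->
  independent_classes F G -> independent_classes <<s F>> G.
Proof.
move=> FI mF mG FG A B FA GB; have mB := mG _ GB.
suff: <<s F >> `<=` [set A | measurable A /\ P (A `&` B) = (P A * P B)%E].
  by move=> /(_ _ FA)[].
apply: lambda_system_subset => //; last by move=> C FC; split; [exact: mF|exact: FG].
apply/dynkin_lambda_system; split.
- by split; [exact: measurableT|rewrite setTI probability_setT mul1e].
- move=> C [mC PC]; split; first exact: measurableC.
  rewrite setIC -setDE measureD//; last exact: le_lt_trans (probability_le1 _ mB) (ltry _).
  have fC := fin_num_measure P C mC; have fB := fin_num_measure P B mB.
  rewrite [X in (_ - X)%E](_ : _ = (P C * P B)%E); last by rewrite setIC; exact: PC.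
  by rewrite probability_setC// muleBl// ?mul1e// fin_num_adde_defl// fin_numN.
- move=> C tC mPC; have mC n := proj1 (mPC n); split; first exact: bigcup_measurable.
  rewrite setI_bigcupl !measure_bigcup//; first last.
  + apply/trivIsetP => i j _ _ ij; rewrite setIACA.
    by move/trivIsetP : tC => /(_ i j Logic.I Logic.I ij) ->; rewrite set0I.
  + by move=> i _; exact: measurableI.
  have fB := fin_num_measure P B mB.
  rewrite muleC -(fineK fB) -nneseriesZl//.
  by apply: eq_eseriesr => i _; rewrite fineK// muleC; exact: (proj2 (mPC i)).
Qed.

(** By uniqueness of product measures the joint law is the product of the two laws; Fubini's theorem
    then separates the integrals. *)
Lemma independent_integral (f g : Omega -> R) :
  measurable_fun setT f -> measurable_fun setT g ->
  (forall A B, measurable A -> measurable B ->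
     P (f @^-1` A `&` g @^-1` B) = (P (f @^-1` A) * P (g @^-1` B))%E) ->
  P.-integrable setT (EFin \o f) -> P.-integrable setT (EFin \o g) ->
  P.-integrable setT (EFin \o (fun w => f w * g w)) /\
  \int[P]_w (f w * g w) = (\int[P]_w f w) * (\int[P]_w g w).
Proof.
move=> mf mg fg fi gi.
pose X : {RV P >-> R} := mfun_Sub (mem_set mf).
pose Y : {RV P >-> R} := mfun_Sub (mem_set mg).
pose Z w := (X w, Y w).
have mZ : measurable_fun setT Z by exact: measurable_fun_pair.
pose ZZ : {mfun Omega >-> (R * R)%type} := mfun_Sub (mem_set mZ).
pose h (z : R * R) := (z.1 * z.2)%:E.
have mh : measurable_fun setT h by apply/measurable_EFinP; exact: measurable_funM.
have mu_eq A : measurable A ->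
    (distribution P X \x distribution P Y)%E A = pushforward P ZZ A.
  apply: product_measure_unique => B C mB mC.
  rewrite /pushforward /=; exact: fg.
have absint (V : {RV P >-> R}) :
    (\int[distribution P V]_x `|x|%:E = \int[P]_w `|V w|%:E)%E.
  have ma : measurable_fun setT (EFin \o (fun x : R => `|x|)) by exact/measurable_EFinP.
  by rewrite -(ge0_integral_distribution V ma)// => y; rewrite lee_fin.
have idint (V : {RV P >-> R}) : P.-integrable setT (EFin \o V) ->
    (distribution P V).-integrable setT (EFin \o (@id R)).
  move=> /integrableP[_ Vi]; apply/integrableP; split; first exact/measurable_EFinP.
  by rewrite absint; apply: le_lt_trans Vi.
have EV (V : {RV P >-> R}) : P.-integrable setT (EFin \o V) ->
    (\int[distribution P V]_x x%:E = \int[P]_w (V w)%:E)%E.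
  move=> Vi; have mid : measurable_fun setT (EFin \o (@id R)) by exact/measurable_EFinP.
  by rewrite (integral_distribution mid).
have aY : (\int[distribution P Y]_y `|y|%:E < +oo)%E.
  by have /integrableP[_] := idint Y gi.
have aX : (\int[distribution P X]_y `|y|%:E < +oo)%E.
  by have /integrableP[_] := idint X fi.
have mab : measurable_fun setT (fun x : R => `|x|%:E) by exact/measurable_EFinP.
have hi : (distribution P X \x distribution P Y)%E.-integrable setT h.
  apply/(integrable12ltyP _ _ mh).
  have -> : (\int[distribution P X]_x \int[distribution P Y]_y `|h (x, y)| =
      \int[distribution P X]_x (`|x|%:E * \int[distribution P Y]_y `|y|%:E))%E.
    apply: eq_integral => x _; rewrite -ge0_integralZl//.
    by apply: eq_integral => y _; rewrite /h /= normrM EFinM.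
  rewrite ge0_integralZr//; last by apply: integral_ge0.
  by rewrite lte_mul_pinfty// ?integral_ge0// ge0_fin_numE// integral_ge0.
have hZ : (\int[distribution P X \x distribution P Y]_z `|h z| =
    \int[P]_w `|h (Z w)|)%E.
  transitivity (\int[pushforward P ZZ]_z `|h z|)%E.
    by apply: eq_measure_integral => A mA _; exact: mu_eq.
  by rewrite (ge0_integral_pushforward mZ P measurableT) //; exact: measurableT_comp.
have fgi : P.-integrable setT (EFin \o (fun w => f w * g w)).
  apply/integrableP; split; first by apply/measurable_EFinP; exact: measurable_funM.
  by move/integrableP : hi => [_]; rewrite hZ.
split=> //; apply: EFin_inj.
rewrite EFin_Rintegral// EFinM !EFin_Rintegral// -(EV X)// -(EV Y)//.
transitivity (\int[pushforward P ZZ]_z h z)%E.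
  by rewrite (integral_pushforward mZ mh).
transitivity (\int[distribution P X \x distribution P Y]_z h z)%E.
  by symmetry; apply: eq_measure_integral => A mA _; exact: mu_eq.
rewrite -(integral12_prod_meas1 hi) /fubini_F.
have fY : (\int[distribution P Y]_y y%:E)%E \is a fin_num.
  exact: integrable_fin_num (idint Y gi).
transitivity (\int[distribution P X]_x (x%:E * (\int[distribution P Y]_y y%:E)))%E.
  apply: eq_integral => x _; rewrite -(integralZl measurableT (idint Y gi)).
  by apply: eq_integral => y _; rewrite /h /= EFinM.
by rewrite -(fineK fY) (integralZr measurableT (idint X fi)).
Qed.

Lemma independent_classes_sub (F G F' G' : set (set Omega)) :
  F' `<=` F -> G' `<=` G -> independent_classes F G -> independent_classes F' G'.
Proof. by move=> FF GG FG A B FA GB; apply: FG; [exact: FF|exact: GG]. Qed.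

(** Unlike the union of the classes [S i], these intersections form a pi-system, as Dynkin's
    argument requires. *)
Definition cylinders (I : finType) (S : I -> set (set Omega)) (D : {set I}) : set (set Omega) :=
  [set C | exists2 A : I -> set Omega, (forall i, S i (A i)) &
     C = \bigcap_(i in [set` D]) A i].

Lemma cylinders_setI (I : finType) (S : I -> set (set Omega)) (D : {set I}) :
  (forall i, setI_closed (S i)) -> setI_closed (cylinders S D).
Proof.
move=> SI _ _ [A SA ->] [B SB ->]; exists (fun i => A i `&` B i).
  by move=> i; exact: SI.
by rewrite bigcapI.
Qed.

Lemma cylinders_measurable (I : finType) (S : I -> set (set Omega)) (D : {set I}) :
  (forall i, S i `<=` measurable) -> cylinders S D `<=` measurable.
Proof.
move=> Sm _ [A SA ->]; apply: fin_bigcap_measurable; first exact: finite_finset.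
by move=> i _; exact: Sm.
Qed.

Lemma sub_cylinders (I : finType) (S : I -> set (set Omega)) (D : {set I}) :
  (forall i, S i setT) -> \bigcup_(i in [set` D]) S i `<=` cylinders S D.
Proof.
move=> ST A [i /= iD SA]; exists (fun j => if j == i then A else setT).
  by move=> j; case: eqP => // ->.
apply/seteqP; split=> w.
  by move=> Aw j _ /=; case: ifP.
by move=> /(_ i iD) /=; rewrite eqxx.
Qed.

(** Dynkin's argument is applied to each side in turn. On cylinders, disjointness of [D] and [E]
    lets the two families of events be merged into one. *)
Lemma mutually_independent_disjoint (I : finType) (S : I -> set (set Omega)) (D E : {set I}) :
  (forall i, sigma_algebra setT (S i)) -> (forall i, S i `<=` measurable) ->
  mutually_independent P S -> (forall i, i \in D -> i \notin E) ->
  independent_classes <<s \bigcup_(i in [set` D]) S i >> <<s \bigcup_(i in [set` E]) S i >>.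
Proof.
move=> Ss Sm SP DE.
have SI i : setI_closed (S i).
  rewrite -(measurable_g_measurableTypeE (Ss i)) => A B mA mB.
  exact: (@measurableI _ (g_sigma_algebraType (S i))).
have ST i : S i setT.
  by rewrite -(measurable_g_measurableTypeE (Ss i)); exact: measurableT.
have CI K := @cylinders_setI I S K SI.
have Cm K := @cylinders_measurable I S K Sm.
have sm K : <<s cylinders S K >> `<=` measurable.
  by apply: smallest_sub => //; exact: sigma_algebra_measurable.
have sub (K : {set I}) : <<s \bigcup_(i in [set` K]) S i >> `<=` <<s cylinders S K >>.
  by apply: sub_sigma_algebra2; exact: sub_cylinders.
apply: (independent_classes_sub (sub D) (sub E)).
apply: independent_classes_sigma => //.
apply/independent_classesC; apply: independent_classes_sigma => //.
move=> _ _ [A SA ->] [B SB ->].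
pose C i := if i \in E then A i else B i.
have -> : \bigcap_(i in [set` E]) A i = \bigcap_(i in [set` E]) C i.
  by apply: eq_bigcapr => i /=; rewrite /C => ->.
have -> : \bigcap_(i in [set` D]) B i = \bigcap_(i in [set` D]) C i.
  apply: eq_bigcapr => i /= iD; rewrite /C.
  by rewrite (negbTE (DE _ iD)).
have SC i : S i (C i) by rewrite /C; case: ifP.
rewrite -bigcap_setU.
have -> : [set` E] `|` [set` D] = [set` (E :|: D)%SET].
  by apply/seteqP; split=> i /=; rewrite finset.in_setU => /orP.
rewrite !SP => [|i _|i _|i _]; try exact: SC.
rewrite (eq_bigl [predU E & D]) => [|i]; last by rewrite finset.in_setU.
rewrite bigU//; apply/pred0P => i /=; apply/negP => /andP[iE iD].
by have := DE i iD; rewrite iE.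
Qed.

(** The events are padded with the whole space to a full array; independence of the classes [F i]
    separates the rows, and independence within a row separates its entries. *)
Lemma mutually_independent_pair (I J : finType) (S : I -> J -> set (set Omega))
    (F : I -> set (set Omega)) :
  (forall i, sigma_algebra setT (F i)) -> (forall i j, S i j setT) ->
  (forall i j, S i j `<=` F i) ->
  (forall i, mutually_independent P (S i)) -> mutually_independent P F ->
  mutually_independent P (fun z : I * J => S z.1 z.2).
Proof.
move=> Fs ST SF SP FP K A SA.
pose C z := if z \in K then A z else setT.
have SC z : S z.1 z.2 (C z) by rewrite /C; case: ifP => // /SA.
have -> : \bigcap_(z in [set` K]) A z =
    \bigcap_(i in [set` [set: I]%SET]) \bigcap_(j in [set` [set: J]%SET]) C (i, j).
  apply/seteqP; split=> w Aw.
    by move=> i _ j _; rewrite /C; case: ifP => // ijK; exact: Aw.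
  move=> [i j] /= ijK; have := Aw i; rewrite /= finset.in_setT => /(_ isT j).
  by rewrite /= finset.in_setT /C ijK => /(_ isT).
rewrite FP; last first.
  move=> i _; rewrite -(measurable_g_measurableTypeE (Fs i)).
  apply: (@fin_bigcap_measurable _ (g_sigma_algebraType (F i))); first exact: finite_finset.
  move=> j _; rewrite /= (measurable_g_measurableTypeE (Fs i)).
  exact: SF (SC (i, j)).
transitivity (\prod_i \prod_j P (C (i, j)))%E.
  apply: eq_big => [i|i _]; first by rewrite finset.in_setT.
  rewrite (SP i [set: J]%SET (fun j => C (i, j))) => [|j _]; last exact: (SC (i, j)).
  by apply: eq_bigl => j; rewrite finset.in_setT.
rewrite pair_bigA /= [RHS]big_mkcond /=.
by apply: eq_bigr => -[i j] _; rewrite /C; case: ifP => // _; rewrite probability_setT.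
Qed.

Definition sub_measurable (F : set (set Omega)) (X : Omega -> R) : Prop :=
  @measurable_fun _ _ (g_sigma_algebraType F) R setT X.

Lemma sub_measurableW (F : set (set Omega)) (X : Omega -> R) :
  F `<=` measurable -> sub_measurable F X -> measurable_fun setT X.
Proof.
move=> Fm FX _ A mA; have := FX measurableT A mA; rewrite !setTI.
by apply: smallest_sub => //; exact: sigma_algebra_measurable.
Qed.

Lemma sub_measurable_subset (F G : set (set Omega)) (X : Omega -> R) :
  F `<=` <<s G >> -> sub_measurable F X -> sub_measurable G X.
Proof.
move=> FG FX _ A mA; have := FX measurableT A mA; rewrite !setTI.
by apply: smallest_sub => //; exact: smallest_sigma_algebra.
Qed.

Lemma sub_independent_integral (F G : set (set Omega)) (X Y : Omega -> R) :
  F `<=` measurable -> G `<=` measurable -> independent_classes <<s F >> <<s G >> ->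
  sub_measurable F X -> sub_measurable G Y ->
  P.-integrable setT (EFin \o X) -> P.-integrable setT (EFin \o Y) ->
  P.-integrable setT (EFin \o (fun w => X w * Y w)) /\
  \int[P]_w (X w * Y w) = (\int[P]_w X w) * (\int[P]_w Y w).
Proof.
move=> Fm Gm FG FX GY; apply: independent_integral.
- exact: sub_measurableW FX.
- exact: sub_measurableW GY.
- move=> A B mA mB; apply: FG.
    by have := FX measurableT A mA; rewrite setTI.
  by have := GY measurableT B mB; rewrite setTI.
Qed.

End independence.

(** * Mixed fractional Brownian motion *)

Section second_differences.
Context {R : realType}.
Implicit Types p : R.

Definition powR_diff p (e : nat) : R := e.+1%:R `^ p - e%:R `^ p.

Lemma powR_diff_ge0 p e : 0 <= p -> 0 <= powR_diff p e.
Proof. by move=> p0; rewrite subr_ge0 ge0_ler_powR ?nnegrE// ler_nat. Qed.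

Lemma powR_diff0 p : p != 0 -> powR_diff p 0 = 1.
Proof. by move=> p0; rewrite /powR_diff powR0// subr0 powR1. Qed.

Lemma powR_midpoint p (x y : R) : 1 <= p -> 0 <= x -> 0 <= y ->
  ((x + y) / 2) `^ p <= (x `^ p + y `^ p) / 2.
Proof.
move=> p1 x0 y0.
have -> : (x + y) / 2 = 2^-1 * x + 2^-1 * y by ring.
have -> : (x `^ p + y `^ p) / 2 = 2^-1 * x `^ p + 2^-1 * y `^ p by ring.
have h01 : 0 <= 2^-1 :> R by [].
have h11 : 2^-1 <= 1 :> R by rewrite invf_le1 ?ler1n.
rewrite {2 4}(_ : 2^-1 = 1 - 2^-1 :> R); last by lra.
by apply: (convex_powR p1 (Itv01 h01 h11)) => //=; rewrite ?inE/= ?in_itv/= ?x0 ?y0.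
Qed.

Lemma powR_diff_homo p e : 1 <= p -> powR_diff p e <= powR_diff p e.+1.
Proof.
move=> p1; have := @powR_midpoint p e%:R e.+2%:R p1 (ler0n _ _) (ler0n _ _).
have -> : (e%:R + e.+2%:R) / 2 = e.+1%:R :> R.
  by rewrite -[e.+2]addn2 -[e.+1]addn1 !natrD; lra.
rewrite /powR_diff; lra.
Qed.

(** Midpoint convexity of the inverse power [p^-1], applied to [e^p] and [(e + 2)^p], gives midpoint
    concavity. *)
Lemma powR_diff_anti p e : 0 < p <= 1 -> powR_diff p e.+1 <= powR_diff p e.
Proof.
move=> /andP[p0 p1]; have q1 : 1 <= p^-1 by rewrite invf_ge1.
have K x : 0 <= x -> (x `^ p) `^ p^-1 = x.
  by move=> x0; rewrite -powRrM divff ?gt_eqF// powRr1.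
have := @powR_midpoint p^-1 (e%:R `^ p) (e.+2%:R `^ p) q1 (powR_ge0 _ _) (powR_ge0 _ _).
rewrite !K//; have -> : (e%:R + e.+2%:R) / 2 = e.+1%:R :> R by rewrite -[e.+2]addn2 -[e.+1]addn1 !natrD; lra.
set m := _ / 2 => h.
have m0 : 0 <= m by rewrite divr_ge0// addr_ge0// powR_ge0.
have : (m `^ p^-1) `^ p <= e.+1%:R `^ p.
  by rewrite ge0_ler_powR ?nnegrE ?powR_ge0// ltW.
rewrite -powRrM mulVf ?gt_eqF// powRr1// /m /powR_diff; lra.
Qed.

(** A mean value bound obtained algebraically: with [i = 1 / (L + 1)] and [p <= 2],
    [(1 - i)^p >= (1 - i)^2 >= 1 - 2 i]. *)
Lemma powR_diff_le p L : 1 <= p <= 2 ->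
  powR_diff p L <= 2 * L.+1%:R `^ p / L.+1%:R.
Proof.
move=> /andP[p1 p2]; rewrite /powR_diff.
have L0 : 0 < L.+1%:R :> R by [].
have -> : L%:R = L.+1%:R * (L%:R / L.+1%:R) :> R by rewrite mulrCA divff ?mulr1// gt_eqF.
rewrite [X in _ - X <= _]powRM ?divr_ge0//.
have u01 : 0 <= L%:R / L.+1%:R :> R /\ L%:R / L.+1%:R <= 1 :> R.
  by split; [rewrite divr_ge0|rewrite ler_pdivrMr// mul1r ler_nat].
have uE : L%:R / L.+1%:R = 1 - L.+1%:R^-1 :> R by rewrite -natr1; field; rewrite natr1 gt_eqF.
have : (L%:R / L.+1%:R) ^+ 2 <= (L%:R / L.+1%:R) `^ p.
  rewrite -powR_mulrn ?divr_ge0//; case: (eqVneq (L%:R / L.+1%:R) (0 : R)) => [->|u0].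
    by rewrite !powR0// gt_eqF// (lt_le_trans _ p1).
  by apply: ger_powR => //; rewrite lt_neqAle eq_sym u0/= u01.1 u01.2.
move: (_ `^ p) => u; rewrite uE => hu.
have : 0 <= L.+1%:R `^ p :> R by apply: powR_ge0.
have : 0 <= L.+1%:R^-1 :> R by rewrite invr_ge0.
move: (L.+1%:R `^ p) (L.+1%:R^-1) hu => A i; rewrite -mulrA (mulrC A) => hu i0 A0.
have : 1 - 2 * i <= u by apply: le_trans hu; have := sqr_ge0 i; lra.
nra.
Qed.

(* The covariance of two increments over intervals of unit length at distance
   [e] of a fractional Brownian motion with [p = 2H]. *)
Definition fgn_cov p (e : nat) : R :=
  if e is e'.+1 then (powR_diff p e'.+1 - powR_diff p e') / 2 else 1.

(** The diagonal entry is 1. The entries on either side of it are halves of second differences, so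
    each side is at most half of the full sum. *)
Lemma sum_fgn_cov_le_diff p (L c : nat) : (c < L.+1)%N ->
  \sum_(0 <= c' < L.+1) `|fgn_cov p ((c - c') + (c' - c))| <=
  1 + \sum_(0 <= e < L) `|powR_diff p e.+1 - powR_diff p e|.
Proof.
move=> cL.
pose D e := `|powR_diff p e.+1 - powR_diff p e|.
have D0 e : 0 <= D e by exact: normr_ge0.
have DE e : `|fgn_cov p e.+1| = D e / 2 by rewrite /fgn_cov normrM [X in _ * X]ger0_norm.
have Dle k : (k <= L)%N -> \sum_(0 <= e < k) D e <= \sum_(0 <= e < L) D e.
  move=> kL; rewrite [leRHS](@big_cat_nat _ _ _ k)//= lerDl.
  by rewrite big_seq sumr_ge0.
rewrite (@big_cat_nat _ _ _ c)//=; last by rewrite ltnW.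
rewrite [X in _ + X <= _]big_ltn//= subnn addn0.
have -> : \sum_(0 <= c' < c) `|fgn_cov p ((c - c') + (c' - c))| = (\sum_(0 <= e < c) D e) / 2.
  rewrite big_nat_rev /= add0n mulr_suml; apply: eq_big_nat => e /andP[_ ec].
  by rewrite -DE; congr (`|fgn_cov p _|); lia.
have -> : \sum_(c.+1 <= c' < L.+1) `|fgn_cov p ((c - c') + (c' - c))| =
    (\sum_(0 <= e < L - c) D e) / 2.
  rewrite -{1}[c.+1]add0n big_addn subSS mulr_suml; apply: eq_big_nat => e _.
  by rewrite -DE; congr (`|fgn_cov p _|); lia.
have h1 := Dle c; have h2 := Dle (L - c)%N (leq_subr _ _).
have {}h1 : \sum_(0 <= e < c) D e <= \sum_(0 <= e < L) D e by apply: h1; rewrite -ltnS.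
rewrite /fgn_cov normr1; lra.
Qed.

(** First differences decrease, so the absolute second differences telescope to at most
    [powR_diff p 0 = 1]. *)
Lemma sum_fgn_cov_anti p (L c : nat) : 0 < p <= 1 -> (c < L)%N ->
  \sum_(0 <= c' < L) `|fgn_cov p ((c - c') + (c' - c))| <= 2.
Proof.
case: L => // L p01 cL; apply: le_trans (sum_fgn_cov_le_diff p cL) _.
have -> : \sum_(0 <= e < L) `|powR_diff p e.+1 - powR_diff p e| =
    powR_diff p 0 - powR_diff p L.
  rewrite -[RHS]opprB -(telescope_sumr (powR_diff p) (leq0n L)) -sumrN.
  apply: eq_bigr => e _; rewrite ler0_norm// subr_le0; exact: powR_diff_anti.
move: p01 => /andP[p0 _]; rewrite powR_diff0 ?gt_eqF//.
have := @powR_diff_ge0 p L (ltW p0); lra.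
Qed.

(** First differences increase, so the sum telescopes to the last of them, of order [L^(p - 1)]. *)
Lemma sum_fgn_cov_homo p (L c : nat) : 1 <= p <= 2 -> (c < L)%N ->
  \sum_(0 <= c' < L) `|fgn_cov p ((c - c') + (c' - c))| <= 1 + 2 * L%:R `^ p / L%:R.
Proof.
case: L => // L p12 cL; apply: le_trans (sum_fgn_cov_le_diff p cL) _.
rewrite lerD2l; apply: le_trans (powR_diff_le L p12).
have -> : \sum_(0 <= e < L) `|powR_diff p e.+1 - powR_diff p e| =
    powR_diff p L - powR_diff p 0.
  rewrite -(telescope_sumr (powR_diff p) (leq0n L)).
  apply: eq_bigr => e _; rewrite ger0_norm// subr_ge0.
  by apply: powR_diff_homo; case/andP : p12.
move: p12 => /andP[p1 _]; rewrite powR_diff0 ?gt_eqF//; last exact: lt_le_trans p1.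
lra.
Qed.

End second_differences.

(** * Calculus of second and fourth moments *)

Section moments.
Context {R : realType} d (Omega : measurableType d) (P : probability Omega R).
Implicit Types f g : Omega -> R.

Definition finite_moment (k : nat) f : Prop :=
  measurable_fun setT f /\ P.-integrable setT (EFin \o (fun w => f w ^+ k)).

Lemma finite_moment_le (k : nat) f g : measurable_fun setT f ->
  P.-integrable setT (EFin \o g) -> (forall w, `|f w ^+ k| <= g w) -> finite_moment k f.
Proof.
by move=> mf ig fg; split => //; apply: le_integrable_real ig fg; exact: measurable_funX.
Qed.

Lemma integrableD_real f g : P.-integrable setT (EFin \o f) ->
  P.-integrable setT (EFin \o g) -> P.-integrable setT (EFin \o (fun w => f w + g w)).
Proof. by move=> fi gi; exact: (integrableD measurableT fi gi). Qed.

Lemma integrableZ_real (c : R) f : P.-integrable setT (EFin \o f) ->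
  P.-integrable setT (EFin \o (fun w => c * f w)).
Proof. by move=> fi; exact: (integrableZl measurableT c fi). Qed.

Lemma integrable_sum_real (I : Type) (r : seq I) (F : I -> Omega -> R) :
  (forall i, P.-integrable setT (EFin \o F i)) ->
  P.-integrable setT (EFin \o (fun w => \sum_(i <- r) F i w)).
Proof.
move=> Fi; elim: r => [|i r IH].
  by under eq_fun do rewrite big_nil; exact: integrable_cst_prob.
under eq_fun do rewrite big_cons.
exact: integrableD_real.
Qed.

Lemma integral_sum_real (I : Type) (r : seq I) (F : I -> Omega -> R) :
  (forall i, P.-integrable setT (EFin \o F i)) ->
  \int[P]_w (\sum_(i <- r) F i w) = \sum_(i <- r) \int[P]_w F i w.
Proof.
move=> Fi; elim: r => [|i r IH].
  under eq_Rintegral do rewrite big_nil.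
  by rewrite big_nil Rintegral_cst// mul0r.
under eq_Rintegral do rewrite big_cons.
rewrite big_cons -IH RintegralD//; exact: integrable_sum_real.
Qed.

Lemma finite_moment42 f : finite_moment 4 f -> finite_moment 2 f.
Proof.
move=> [mf fi]; apply: (finite_moment_le mf (integrableD_real (integrable_cst_prob P 1) fi)).
move=> w /=; rewrite ger0_norm ?sqr_ge0//.
by have := sqr_ge0 (f w ^+ 2 - 1); have := sqr_ge0 (f w); nra.
Qed.

Lemma finite_moment2_integrable f : finite_moment 2 f -> P.-integrable setT (EFin \o f).
Proof.
move=> [mf fi]; apply: (le_integrable_real mf (integrableD_real (integrable_cst_prob P 1) fi)).
by move=> w /=; rewrite ler_norml; apply/andP; split;
  have := sqr_ge0 (f w - 1); have := sqr_ge0 (f w + 1); nra.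
Qed.

Lemma finite_moment2_mul f g : finite_moment 2 f -> finite_moment 2 g ->
  P.-integrable setT (EFin \o (fun w => f w * g w)).
Proof.
move=> [mf fi] [mg gi]; apply: (le_integrable_real _ (integrableD_real fi gi)).
  exact: measurable_funM.
by move=> w /=; rewrite ler_norml; apply/andP; split;
  have := sqr_ge0 (f w - g w); have := sqr_ge0 (f w + g w); nra.
Qed.

Lemma finite_moment4_mul f g : finite_moment 4 f -> finite_moment 4 g ->
  finite_moment 2 (fun w => f w * g w).
Proof.
move=> [mf fi] [mg gi]; apply: (finite_moment_le _ (integrableD_real fi gi)).
  exact: measurable_funM.
move=> w; rewrite ger0_norm ?sqr_ge0//.
have := sqr_ge0 (f w ^+ 2 - g w ^+ 2); have := sqr_ge0 (f w ^+ 2); have := sqr_ge0 (g w ^+ 2).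
nra.
Qed.

Lemma finite_momentZ k (c : R) f : finite_moment k f -> finite_moment k (fun w => c * f w).
Proof.
move=> [mf fi]; split; first exact: measurable_funM.
by under eq_fun do rewrite exprMn; exact: integrableZ_real.
Qed.

Lemma finite_moment0 k : finite_moment k.+1 (fun=> 0).
Proof.
split; first exact: measurable_cst.
by under eq_fun do rewrite expr0n /=; exact: integrable_cst_prob.
Qed.

Lemma finite_moment2D f g : finite_moment 2 f -> finite_moment 2 g ->
  finite_moment 2 (fun w => f w + g w).
Proof.
move=> [mf fi] [mg gi].
apply: (finite_moment_le _ (integrableZ_real 2 (integrableD_real fi gi))).
  exact: measurable_funD.
by move=> w; rewrite ger0_norm ?sqr_ge0//; have := sqr_ge0 (f w - g w); nra.
Qed.

Lemma finite_moment4D f g : finite_moment 4 f -> finite_moment 4 g ->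
  finite_moment 4 (fun w => f w + g w).
Proof.
move=> [mf fi] [mg gi].
apply: (finite_moment_le _ (integrableZ_real 8 (integrableD_real fi gi))).
  exact: measurable_funD.
move=> w; rewrite ger0_norm ?exprn_even_ge0//.
have := sqr_ge0 (f w - g w); have := sqr_ge0 (f w ^+ 2 - g w ^+ 2).
have := sqr_ge0 (f w); have := sqr_ge0 (g w).
nra.
Qed.

Lemma finite_moment2_sum (I : Type) (r : seq I) (F : I -> Omega -> R) :
  (forall i, finite_moment 2 (F i)) -> finite_moment 2 (fun w => \sum_(i <- r) F i w).
Proof.
move=> Fi; elim: r => [|i r IH].
  by under eq_fun do rewrite big_nil; exact: finite_moment0.
by under eq_fun do rewrite big_cons; exact: finite_moment2D.
Qed.

Lemma finite_moment4_sum (I : Type) (r : seq I) (F : I -> Omega -> R) :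
  (forall i, finite_moment 4 (F i)) -> finite_moment 4 (fun w => \sum_(i <- r) F i w).
Proof.
move=> Fi; elim: r => [|i r IH].
  by under eq_fun do rewrite big_nil; exact: finite_moment0.
by under eq_fun do rewrite big_cons; exact: finite_moment4D.
Qed.

Lemma le_integral_real f g : P.-integrable setT (EFin \o f) ->
  P.-integrable setT (EFin \o g) -> (forall w, f w <= g w) ->
  \int[P]_w f w <= \int[P]_w g w.
Proof. by move=> fi gi fg; apply: le_Rintegral. Qed.

Lemma integralZ_real (c : R) f : P.-integrable setT (EFin \o f) ->
  \int[P]_w (c * f w) = c * \int[P]_w f w.
Proof. by move=> fi; rewrite RintegralZl. Qed.

Lemma integralD_real f g : P.-integrable setT (EFin \o f) ->
  P.-integrable setT (EFin \o g) ->
  \int[P]_w (f w + g w) = \int[P]_w f w + \int[P]_w g w.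
Proof. by move=> fi gi; rewrite RintegralD. Qed.

(** Expansion of the sum of all [(y i - y j)^2]. *)
Lemma sqr_sum_le (n : nat) (y : 'I_n -> R) :
  (\sum_(i < n) y i) ^+ 2 <= n%:R * \sum_(i < n) y i ^+ 2.
Proof.
have : 0 <= \sum_(i < n) \sum_(j < n) (y i - y j) ^+ 2.
  by apply: sumr_ge0 => i _; apply: sumr_ge0 => j _; exact: sqr_ge0.
have -> : \sum_(i < n) \sum_(j < n) (y i - y j) ^+ 2 =
    2 * (n%:R * \sum_(i < n) y i ^+ 2) - 2 * (\sum_(i < n) y i) ^+ 2.
  have -> : (\sum_(i < n) y i) ^+ 2 = \sum_(i < n) \sum_(j < n) y i * y j.
    by rewrite expr2 mulr_suml; apply: eq_bigr => i _; rewrite mulr_sumr.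
  have -> : 2 * (n%:R * \sum_(i < n) y i ^+ 2) =
      \sum_(i < n) \sum_(j < n) (y i ^+ 2 + y j ^+ 2).
    rewrite [RHS](eq_bigr (fun i => n%:R * y i ^+ 2 + \sum_(j < n) y j ^+ 2)); last first.
      by move=> i _; rewrite big_split /= sumr_const card_ord mulr_natl.
    by rewrite big_split /= -mulr_sumr sumr_const card_ord -mulr_natl; ring.
  rewrite mulr_sumr -sumrB; apply: eq_bigr => i _.
  by rewrite mulr_sumr -sumrB; apply: eq_bigr => j _; ring.
lra.
Qed.

Lemma fourth_sum_le (n : nat) (y : 'I_n -> R) :
  (\sum_(i < n) y i) ^+ 4 <= n%:R ^+ 3 * \sum_(i < n) y i ^+ 4.
Proof.
have h1 := sqr_sum_le y; have h2 := sqr_sum_le (fun i => y i ^+ 2).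
rewrite (exprM _ 2 2); apply: (@le_trans _ _ ((n%:R * \sum_(i < n) y i ^+ 2) ^+ 2)).
  rewrite lerXn2r ?nnegrE ?sqr_ge0//; exact: le_trans (sqr_ge0 _) h1.
rewrite exprMn; set S := \sum_(i < n) y i ^+ 4.
have -> : n%:R ^+ 3 * S = n%:R ^+ 2 * (n%:R * S) by ring.
rewrite ler_wpM2l ?exprn_ge0// (le_trans h2)//.
by under eq_bigr do rewrite -exprM.
Qed.

End moments.

(** * Increments of one fractional Brownian motion *)

Section fBm_increments.
Context {R : realType} d (Omega : measurableType d) (P : probability Omega R).
Variables (T H : R) (dim : nat) (B : 'I_dim -> R -> {RV P >-> R}).
Hypotheses (H01 : 0 < H < 1) (BH : is_fBm P T H B).

Lemma fBm_finite_moment j t : 0 <= t <= T -> finite_moment P 4 (B j t).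
Proof.
move=> tT; split; first exact: measurable_funPT.
have h := @fBm_gaussian _ _ _ _ _ _ _ _ BH 1 (fun=> (j, t)) (fun=> 1).
have /gaussian_fourth_integrable := h (fun=> conj Logic.I tT).
congr (_.-integrable _ _); apply/funext => w /=.
by rewrite big_ord1 scale1r.
Qed.

Lemma fBm_increment_finite_moment j s t : 0 <= s <= T -> 0 <= t <= T ->
  finite_moment P 4 (fun w => B j t w - B j s w).
Proof.
move=> sT tT; have -> : (fun w => B j t w - B j s w) = (fun w => B j t w + -1 * B j s w).
  by apply/funext => w; rewrite mulN1r.
by apply: finite_moment4D; [|apply: finite_momentZ]; exact: fBm_finite_moment.
Qed.

Lemma fBm_mean j t : 0 <= t <= T -> \int[P]_w (B j t w) = 0.
Proof.
move=> tT; have := fBm_centred BH j tT; rewrite expectation_def => e.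
by rewrite /Rintegral e.
Qed.

Lemma fBm_product j s t : 0 <= s <= T -> 0 <= t <= T ->
  \int[P]_w (B j s w * B j t w) = fBm_cov H s t.
Proof.
move=> sT tT; have := fBm_covariance BH j sT tT.
rewrite unlock (fBm_centred BH j sT) (fBm_centred BH j tT) unlock /= => e.
have := congr1 fine e; rewrite /= => <-; rewrite /Rintegral; congr fine.
by apply: eq_integral => w _; congr EFin; transitivity ((B j s w - 0) * (B j t w - 0)) => //; rewrite !subr0.
Qed.

Lemma fBm_increment_product j s t u v :
  0 <= s <= T -> 0 <= t <= T -> 0 <= u <= T -> 0 <= v <= T ->
  \int[P]_w ((B j t w - B j s w) * (B j v w - B j u w)) =
  2^-1 * (`|t - u| `^ (2 * H) + `|s - v| `^ (2 * H) -
          `|t - v| `^ (2 * H) - `|s - u| `^ (2 * H)).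
Proof.
move=> sT tT uT vT.
have m2 r : 0 <= r <= T -> finite_moment P 2 (B j r).
  by move=> rT; exact/finite_moment42/fBm_finite_moment.
have i2 r r' : 0 <= r <= T -> 0 <= r' <= T ->
    P.-integrable setT (EFin \o (fun w => B j r w * B j r' w)).
  by move=> rT r'T; apply: finite_moment2_mul; exact: m2.
have -> : (fun w => (B j t w - B j s w) * (B j v w - B j u w)) =
    (fun w => B j t w * B j v w + (-1 * (B j t w * B j u w) +
       (-1 * (B j s w * B j v w) + B j s w * B j u w))).
  by apply/funext => w; ring.
rewrite !integralD_real ?integralZ_real//; try exact: i2; try (apply: integrableZ_real; exact: i2);
  try (by repeat (apply: integrableD_real; last 1 first); try (apply: integrableZ_real); exact: i2).
rewrite !fBm_product// /fBm_cov (distrC v t) (distrC u t) (distrC v s) (distrC u s); by field.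
Qed.

Lemma fBm_increment_sqr j s t : 0 <= s <= T -> 0 <= t <= T ->
  \int[P]_w ((B j t w - B j s w) ^+ 2) = `|t - s| `^ (2 * H).
Proof.
move=> sT tT; have -> : (fun w => (B j t w - B j s w) ^+ 2) =
  (fun w => (B j t w - B j s w) * (B j t w - B j s w)) by [].
rewrite fBm_increment_product// !subrr !normr0 powR0; last first.
  by case/andP : H01 => H0 _; rewrite mulf_neq0 ?gt_eqF.
by rewrite (distrC s); field.
Qed.

(** An increment is a linear combination of two values of the process, hence Gaussian. *)
Lemma fBm_increment_fourth j s t : 0 <= s <= T -> 0 <= t <= T ->
  \int[P]_w ((B j t w - B j s w) ^+ 4) <= gaussian_constant * (`|t - s| `^ (2 * H)) ^+ 2.
Proof.
move=> sT tT.
pose z (i : 'I_2) := (j, if i == 0 then t else s).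
pose c (i : 'I_2) : R := if i == 0 then 1 else -1.
have zT i : (setT `*` `[0, T]) (z i) by split => //=; case: ifP.
have XG := fBm_gaussian BH (n := 2) c zT.
set X := (\sum_(_ < _) _) in XG.
have XE w : X w = B j t w - B j s w.
  by rewrite /X big_ord_recl big_ord1 /c /z /= scale1r scaleN1r.
have X0 : \int[P]_w X w = 0.
  under eq_Rintegral do rewrite XE.
  rewrite RintegralB// ?fBm_mean ?subrr//.
    by apply/finite_moment2_integrable/finite_moment42/fBm_finite_moment.
  by apply/finite_moment2_integrable/finite_moment42/fBm_finite_moment.
have := gaussian_fourth_moment XG X0.
under eq_Rintegral do rewrite XE.
under [in leRHS]eq_Rintegral do rewrite XE.
by rewrite fBm_increment_sqr.
Qed.

End fBm_increments.

(** * Covariances and moments of the mixture *)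

Section mixture.
Context {R : realType} d (Omega : measurableType d) (P : probability Omega R).
Variables (T : R) (N dim : nat) (H a : 'I_N -> R) (B : 'I_N -> 'I_dim -> R -> {RV P >-> R}).
Hypotheses (T0 : 0 < T) (H01 : forall k, 0 < H k < 1).
Hypothesis BH : forall k, is_fBm P T (H k) (B k).
Hypothesis BI : mutually_independent P (fun k => process_sigma_algebra P T (B k)).

Local Notation dp m l := (dyadic_point T m l).

Definition component_sigma_algebra (z : 'I_N * 'I_dim) : set (set Omega) :=
  generated_sigma_algebra P `[0, T] (B z.1 z.2).

(** Indices are pairs of a process and a coordinate, so that [D] can gather one coordinate of all
    the processes. *)
Definition components (D : {set 'I_N * 'I_dim}) : set (set Omega) :=
  \bigcup_(z in [set` D]) component_sigma_algebra z.

Lemma component_sigma_algebra_measurable z : component_sigma_algebra z `<=` measurable.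
Proof.
apply: smallest_sub => [|A [t tT [C mC <-]]]; first exact: sigma_algebra_measurable.
exact: (@measurable_funPT _ _ _ _ (B z.1 z.2 t)).
Qed.

Lemma components_measurable D : components D `<=` measurable.
Proof. by move=> A [z _]; exact: component_sigma_algebra_measurable. Qed.

Lemma components_independent (D E : {set 'I_N * 'I_dim}) : (forall z, z \in D -> z \notin E) ->
  independent_classes P <<s components D >> <<s components E >>.
Proof.
apply: mutually_independent_disjoint.
- by move=> z; exact: smallest_sigma_algebra.
- exact: component_sigma_algebra_measurable.
- apply: (@mutually_independent_pair _ _ _ P _ _ (fun k j => component_sigma_algebra (k, j))
    (fun k => process_sigma_algebra P T (B k))) => //.
  + by move=> k; exact: smallest_sigma_algebra.
  + by move=> k j; exact: (@measurableT _ (g_sigma_algebraType _)).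
  + move=> k j; apply: sub_sigma_algebra2 => A [t tT At].
    by exists (j, t).
  + by move=> k; exact: fBm_components (BH k).
Qed.

Lemma sub_measurable_component (D : {set 'I_N * 'I_dim}) k j t : (k, j) \in D -> 0 <= t <= T ->
  sub_measurable (components D) (B k j t).
Proof.
move=> kjD tT; apply: (@sub_measurable_subset _ _ _ (component_sigma_algebra (k, j))).
  by move=> A kA; apply: sub_sigma_algebra; exists (k, j).
move=> _ A mA; apply: sub_sigma_algebra; apply: sub_sigma_algebra.
by exists t => //; exists A.
Qed.

Lemma mixed_fBmE w t j : mixed_fBm P a B w t 0 j = \sum_(k < N) a k * B k j t w.
Proof. by rewrite /mixed_fBm summxE; apply: eq_bigr => k _; rewrite !mxE. Qed.

Definition fBm_step m l k j (w : Omega) : R := B k j (dp m l.+1) w - B k j (dp m l) w.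

Definition mixed_step m l j (w : Omega) : R := increment T (mixed_fBm P a B w) m l j.

Lemma mixed_stepE m l j w : mixed_step m l j w = \sum_(k < N) a k * fBm_step m l k j w.
Proof.
rewrite /mixed_step /increment !mixed_fBmE -sumrB.
by apply: eq_bigr => k _; rewrite -mulrBr.
Qed.

Lemma dyadic_point_in m l : (l <= 2 ^ m)%N -> 0 <= dp m l <= T.
Proof. by move=> lm; rewrite dyadic_point_ge0// dyadic_point_leT. Qed.

Lemma fBm_step_moment m l k j : (l < 2 ^ m)%N -> finite_moment P 4 (fBm_step m l k j).
Proof.
by move=> lm; apply: (fBm_increment_finite_moment (BH k)); apply: dyadic_point_in => //; exact: ltnW.
Qed.

Definition mixed_diff s t j (w : Omega) : R :=
  mixed_fBm P a B w t 0 j - mixed_fBm P a B w s 0 j.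

Lemma mixed_diffE s t j :
  mixed_diff s t j = fun w => \sum_(k < N) a k * (B k j t w - B k j s w).
Proof.
apply/funext => w; rewrite /mixed_diff !mixed_fBmE -sumrB.
by apply: eq_bigr => k _; rewrite -mulrBr.
Qed.

Lemma mixed_diff_moment s t j : 0 <= s <= T -> 0 <= t <= T -> finite_moment P 4 (mixed_diff s t j).
Proof.
move=> sT tT; rewrite mixed_diffE.
by apply: finite_moment4_sum => k; apply: finite_momentZ; exact: (fBm_increment_finite_moment (BH k)).
Qed.

Lemma mixed_step_moment m l j : (l < 2 ^ m)%N -> finite_moment P 4 (mixed_step m l j).
Proof. by move=> lm; apply: mixed_diff_moment; apply: dyadic_point_in => //; exact: ltnW. Qed.

Lemma sub_measurable_diff (D : {set 'I_N * 'I_dim}) s t j : 0 <= s <= T -> 0 <= t <= T ->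
  (forall k, (k, j) \in D) -> sub_measurable (components D) (mixed_diff s t j).
Proof.
move=> sT tT jD; rewrite mixed_diffE.
apply: measurable_sum => k; apply: measurable_funM; first exact: measurable_cst.
by apply: measurable_funB; exact: sub_measurable_component.
Qed.

(** Every process [B k] enters the coordinate [j] of the mixture, so the splitting is by coordinate
    only. *)
Lemma component_independent_integral (j : 'I_dim) (X Y : Omega -> R) :
  sub_measurable (components [set z | z.2 != j]%SET) X ->
  sub_measurable (components [set z | z.2 == j]%SET) Y ->
  P.-integrable setT (EFin \o X) -> P.-integrable setT (EFin \o Y) ->
  P.-integrable setT (EFin \o (fun w => X w * Y w)) /\
  \int[P]_w (X w * Y w) = (\int[P]_w X w) * (\int[P]_w Y w).
Proof.
apply: sub_independent_integral; [exact: components_measurable..|].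
by apply: components_independent => z; rewrite !finset.in_set.
Qed.

Lemma fBm_step_mean m l k j : (l < 2 ^ m)%N -> \int[P]_w fBm_step m l k j w = 0.
Proof.
move=> lm; have h1 := dyadic_point_in lm; have h0 := dyadic_point_in (ltnW lm).
have i1 t : 0 <= t <= T -> P.-integrable setT (EFin \o B k j t).
  by move=> tT; apply/finite_moment2_integrable/finite_moment42/(fBm_finite_moment (BH k)).
rewrite RintegralB//; [|exact: i1..].
by rewrite !(fBm_mean (BH k))// subrr.
Qed.

(** Steps of different processes are independent and centred. *)
Lemma fBm_step_cross m l l' k k' j : (l < 2 ^ m)%N -> (l' < 2 ^ m)%N -> k != k' ->
  \int[P]_w (fBm_step m l k j w * fBm_step m l' k' j w) = 0.
Proof.
move=> lm lm' kk'.
have sm r i : (r < 2 ^ m)%N -> sub_measurable (components [set (i, j)]%SET) (fBm_step m r i j).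
  move=> rm; apply: measurable_funB; apply: sub_measurable_component; rewrite ?finset.in_set1//;
  by apply: dyadic_point_in => //; exact: ltnW.
have im r i : (r < 2 ^ m)%N -> P.-integrable setT (EFin \o (fBm_step m r i j)).
  by move=> rm; apply/finite_moment2_integrable/finite_moment42/fBm_step_moment.
rewrite (proj2 (sub_independent_integral (@components_measurable _) (@components_measurable _)
   _ (sm l k lm) (sm l' k' lm') (im l k lm) (im l' k' lm'))).
  by rewrite fBm_step_mean// mul0r.
apply: components_independent => z; rewrite !finset.in_set1 => /eqP ->.
by rewrite xpair_eqE (negbTE kk').
Qed.

(** In truncated subtraction [(l - l') + (l' - l)] is the distance [|l - l'|], on which alone the
    covariance depends by stationarity of increments. *)
Lemma fBm_step_product m l l' k j : (l < 2 ^ m)%N -> (l' < 2 ^ m)%N ->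
  \int[P]_w (fBm_step m l k j w * fBm_step m l' k j w) =
  (2 ^- m * T) `^ (2 * H k) * fgn_cov (2 * H k) ((l - l') + (l' - l)).
Proof.
move=> lm lm'; have h0 : 0 <= 2 ^- m * T by rewrite mulr_ge0 ?invr_ge0 ?exprn_ge0 ?ltW.
have H2 : 2 * H k != 0 by case/andP : (H01 k) => Hk _; rewrite mulf_neq0 ?gt_eqF.
rewrite (fBm_increment_product (BH k)); try (by apply: dyadic_point_in => //; exact: ltnW).
have dE r r' : `|dp m r - dp m r'| `^ (2 * H k) =
    (2 ^- m * T) `^ (2 * H k) * ((r - r') + (r' - r))%:R `^ (2 * H k).
  have -> : dp m r - dp m r' = (r%:R - r'%:R) * (2 ^- m * T) by rewrite /dyadic_point; ring.
  rewrite -powRM//; congr (_ `^ _); rewrite normrM mulrC (ger0_norm h0).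
  congr (_ * _); case: (leqP r r') => rr'.
    rewrite distrC ger0_norm ?subr_ge0 ?ler_nat// -natrB//.
    by move/eqP : rr' => ->; rewrite add0n.
  rewrite ger0_norm ?subr_ge0 ?ler_nat ?(ltnW rr')// -natrB ?(ltnW rr')//.
  by move/ltnW/eqP : rr' => ->; rewrite addn0.
rewrite !dE; set h := _ `^ _ in dE *; clearbody h.
case: (ltngtP l l') => [ll'|l'l|->].
- have [e el] : exists e, l' = (l + e.+1)%N by exists (l' - l).-1; lia.
  rewrite el /fgn_cov /powR_diff.
  rewrite (_ : (l - (l + e.+1) + (l + e.+1 - l) = e.+1)%N); last by lia.
  rewrite (_ : (l.+1 - (l + e.+1) + (l + e.+1 - l.+1) = e)%N); last by lia.
  rewrite (_ : (l - (l + e.+1).+1 + ((l + e.+1).+1 - l) = e.+2)%N); last by lia.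
  by field.
- have [e el] : exists e, l = (l' + e.+1)%N by exists (l - l').-1; lia.
  rewrite el /fgn_cov /powR_diff.
  rewrite (_ : (l' + e.+1 - l' + (l' - (l' + e.+1)) = e.+1)%N); last by lia.
  rewrite (_ : ((l' + e.+1).+1 - l' + (l' - (l' + e.+1).+1) = e.+2)%N); last by lia.
  rewrite (_ : ((l' + e.+1) - l'.+1 + (l'.+1 - (l' + e.+1)) = e)%N); last by lia.
  by field.
- rewrite !subnn /= subSnn (_ : (l' - l'.+1 = 0)%N) ?addn0 ?add0n; last by lia.
  by rewrite powR1 powR0//; field.
Qed.

Lemma mixed_step_product m l l' j : (l < 2 ^ m)%N -> (l' < 2 ^ m)%N ->
  \int[P]_w (mixed_step m l j w * mixed_step m l' j w) =
  \sum_(k < N) a k ^+ 2 * ((2 ^- m * T) `^ (2 * H k) * fgn_cov (2 * H k) ((l - l') + (l' - l))).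
Proof.
move=> lm lm'.
have ip k k' : P.-integrable setT
    (EFin \o (fun w => fBm_step m l k j w * fBm_step m l' k' j w)).
  by apply: finite_moment2_mul; apply/finite_moment42/fBm_step_moment.
have iaa k k' : P.-integrable setT
    (EFin \o (fun w => a k * a k' * (fBm_step m l k j w * fBm_step m l' k' j w))).
  exact: integrableZ_real.
have -> : (fun w => mixed_step m l j w * mixed_step m l' j w) =
    (fun w => \sum_(k < N) \sum_(k' < N) a k * a k' * (fBm_step m l k j w * fBm_step m l' k' j w)).
  apply/funext => w; rewrite !mixed_stepE mulr_suml; apply: eq_bigr => k _.
  by rewrite mulr_sumr; apply: eq_bigr => k' _; ring.
rewrite integral_sum_real; last by move=> k; exact: integrable_sum_real.
apply: eq_bigr => k _; rewrite integral_sum_real// (bigD1 k)//= big1.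
  by rewrite addr0 integralZ_real// fBm_step_product// expr2.
by move=> k' k'k; rewrite integralZ_real// fBm_step_cross ?mulr0// eq_sym.
Qed.

(** The factor by which the standard deviation of the roughest component shrinks from one generation
    to the next. *)
Definition hurst_ratio : R := 2 `^ (- min_hurst H).

Lemma min_hurst_le k : min_hurst H <= H k.
Proof. by rewrite /min_hurst; apply: bigmin_le_cond. Qed.

Lemma hurst_ratio_gt0 : 0 < hurst_ratio.
Proof. exact: powR_gt0. Qed.

Lemma dyadic_powR_le m k :
  (2 ^- m * T) `^ (2 * H k) <= T `^ (2 * H k) * hurst_ratio ^+ (2 * m).
Proof.
rewrite powRM ?invr_ge0 ?exprn_ge0 ?(ltW T0)// mulrC ler_wpM2l ?powR_ge0//.
rewrite -powR_invn// -powRrM /hurst_ratio -powR_mulrn ?powR_ge0// -powRrM.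
rewrite ler_powR ?ler1n// natrM; have := min_hurst_le k.
have : 0 <= m%:R :> R by []; nra.
Qed.

Lemma mixed_diff_fourth : exists2 C, 0 <= C & forall m s t j, 0 <= s <= T -> 0 <= t <= T ->
  `|t - s| <= 2 ^- m * T -> \int[P]_w (mixed_diff s t j w ^+ 4) <= C * hurst_ratio ^+ (4 * m).
Proof.
pose c k : R := a k ^+ 4 * (gaussian_constant * (T `^ (2 * H k)) ^+ 2).
have K0 : 0 <= gaussian_constant :> R by rewrite /gaussian_constant; lra.
have a40 k : 0 <= a k ^+ 4 by rewrite exprn_even_ge0.
have c0 k : 0 <= c k by rewrite /c; apply: mulr_ge0 => //; apply: mulr_ge0 => //; exact: sqr_ge0.
exists (N%:R ^+ 3 * \sum_(k < N) c k).
  by apply: mulr_ge0; [exact: exprn_ge0|exact: sumr_ge0].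
move=> m s t j sT tT stm.
have [mm i4] := mixed_diff_moment j sT tT.
have im k := fBm_increment_finite_moment (BH k) j sT tT.
have ib k : P.-integrable setT (EFin \o (fun w => (a k * (B k j t w - B k j s w)) ^+ 4)).
  by have [] := finite_momentZ (a k) (im k).
apply: (@le_trans _ _ (\int[P]_w (N%:R ^+ 3 * \sum_(k < N) (a k * (B k j t w - B k j s w)) ^+ 4))).
  apply: le_integral_real => //; first exact/integrableZ_real/integrable_sum_real.
  by move=> w; rewrite mixed_diffE; exact: fourth_sum_le.
rewrite integralZ_real ?integral_sum_real//; last exact: integrable_sum_real.
rewrite -[leRHS]mulrA ler_wpM2l ?exprn_ge0// mulr_suml; apply: ler_sum => k _.
under eq_Rintegral do rewrite exprMn.
rewrite integralZ_real; last by have [] := im k.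
rewrite /c -[leRHS]mulrA ler_wpM2l//.
apply: le_trans (fBm_increment_fourth (H01 k) (BH k) j sT tT) _.
rewrite -[leRHS]mulrA ler_wpM2l// (_ : (4 * m = (2 * m) * 2)%N); last by rewrite mulnAC.
rewrite exprM -exprMn lerXn2r ?nnegrE ?powR_ge0//; first by rewrite mulr_ge0 ?powR_ge0 ?exprn_ge0 ?powR_ge0.
apply: le_trans (dyadic_powR_le m k); apply: ge0_ler_powR => //.
- by case/andP : (H01 k) => Hk _; rewrite mulr_ge0 ?ltW.
- by rewrite nnegrE mulr_ge0 ?invr_ge0 ?exprn_ge0 ?ltW.
Qed.

(** Components with [2 H_k <= 1] have row sums at most twice the variance. For [2 H_k > 1] the
    growing row sums contribute [2 T^(2 H_k) 2^-m], and [2^-m <= hurst_ratio^(2m)] because the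
    smallest parameter is at most one half. *)
Lemma mixed_step_cov : min_hurst H <= 2^-1 -> exists2 C, 0 <= C & forall m l j, (l < 2 ^ m)%N ->
  \sum_(0 <= l' < 2 ^ m) `|\int[P]_w (mixed_step m l j w * mixed_step m l' j w)| <=
  C * hurst_ratio ^+ (2 * m).
Proof.
move=> H2; pose c k : R := a k ^+ 2 * (3 * T `^ (2 * H k)).
have a20 k : 0 <= a k ^+ 2 by exact: sqr_ge0.
have c0 k : 0 <= c k by rewrite /c; apply: mulr_ge0 => //; apply: mulr_ge0 => //; exact: powR_ge0.
exists (\sum_(k < N) c k); first exact: sumr_ge0.
move=> m l j lm.
pose h k := (2 ^- m * T) `^ (2 * H k); have h0 k : 0 <= h k by exact: powR_ge0.
apply: (@le_trans _ _ (\sum_(0 <= l' < 2 ^ m) \sum_(k < N)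
    a k ^+ 2 * (h k * `|fgn_cov (2 * H k) ((l - l') + (l' - l))|))).
  apply: ler_sum_nat => l' /andP[_ lm']; rewrite mixed_step_product//.
  apply: le_trans (ler_norm_sum _ _ _) _; apply: ler_sum => k _.
  by rewrite normrM (ger0_norm (a20 k)) normrM (ger0_norm (h0 k)).
rewrite exchange_big /= mulr_suml; apply: ler_sum => k _.
rewrite -mulr_sumr -mulr_sumr /c -[leRHS]mulrA ler_wpM2l//.
have hT : h k <= T `^ (2 * H k) * hurst_ratio ^+ (2 * m) := dyadic_powR_le m k.
have /andP[Hk0 Hk1] := H01 k.
have TH0 : 0 <= T `^ (2 * H k) by exact: powR_ge0.
have e0 : 0 <= hurst_ratio ^+ (2 * m) by rewrite exprn_ge0 ?ltW ?hurst_ratio_gt0.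
case: (leP (2 * H k) 1) => Hk.
  have p1 : 0 < 2 * H k <= 1 by rewrite Hk mulr_gt0.
  apply: (@le_trans _ _ (h k * 2)); first by rewrite ler_wpM2l// sum_fgn_cov_anti.
  rewrite -[leRHS]mulrA; have := mulr_ge0 TH0 e0; lra.
have p2 : 1 <= 2 * H k <= 2 by rewrite (ltW Hk)/=; lra.
have := sum_fgn_cov_homo p2 lm; move: (\sum_(0 <= _ < _) _) => S Sle.
have L0 : 0 < (2 ^ m)%:R :> R by rewrite ltr0n expn_gt0.
have hL : h k * (2 ^ m)%:R `^ (2 * H k) = T `^ (2 * H k).
  rewrite -powRM ?(ltW L0)//; last by rewrite mulr_ge0 ?invr_ge0 ?exprn_ge0 ?(ltW T0).
  by congr (_ `^ _); rewrite natrX mulrAC mulVf ?mul1r// expf_neq0.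
have iL : (2 ^ m)%:R^-1 <= hurst_ratio ^+ (2 * m).
  rewrite natrX -powR_invn// /hurst_ratio -powR_mulrn ?powR_ge0// -powRrM.
  rewrite ler_powR ?ler1n// natrM; have : 0 <= m%:R :> R by []; nra.
apply: (@le_trans _ _ (h k * (1 + 2 * (2 ^ m)%:R `^ (2 * H k) / (2 ^ m)%:R))).
  by rewrite ler_wpM2l.
have -> : h k * (1 + 2 * (2 ^ m)%:R `^ (2 * H k) / (2 ^ m)%:R) =
    h k + 2 * (h k * (2 ^ m)%:R `^ (2 * H k)) * (2 ^ m)%:R^-1 by ring.
rewrite hL.
have -> : 3 * T `^ (2 * H k) * hurst_ratio ^+ (2 * m) =
   T `^ (2 * H k) * hurst_ratio ^+ (2 * m) + 2 * T `^ (2 * H k) * hurst_ratio ^+ (2 * m) by ring.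
by apply: lerD => //; rewrite ler_wpM2l// mulr_ge0.
Qed.

End mixture.

(** * Second moments of the areas *)

Section area_expansion.
Context {R : realType}.
Variables (T : R) (dim : nat) (x : R -> 'rV[R]_dim) (m : nat).
Hypothesis T0 : 0 < T.

Local Notation dp := (dyadic_point T).
Local Notation sg := (dyadic_signature T x).
Local Notation a i j := (increment T x m.+1 (i * 2) j).
Local Notation b i j := (increment T x m.+1 (i * 2).+1 j).

(** The level two part of [exp(a) exp(b) - exp(a + b)], that is, the Levy area of the two half
    steps. *)
Definition area2 i j k : R := 2^-1 * (a i j * b i k) - 2^-1 * (b i j * a i k).

(** The level three part of the same difference: mixed words in [a] and [b] have the coefficient
    [1/2 - 1/6] or [-1/6], pure words cancel, and the total vanishes for [j = k = l]. *)
Definition area3 i j k l : R :=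
  3^-1 * (a i j * a i k * b i l) - 6^-1 * (a i j * b i k * a i l) -
  6^-1 * (b i j * a i k * a i l) + 3^-1 * (a i j * b i k * b i l) -
  6^-1 * (b i j * a i k * b i l) - 6^-1 * (b i j * b i k * a i l).

Lemma dyadic_point_half i : dp m i = dp m.+1 (i * 2).
Proof. by rewrite -(dyadic_point_refine T m 1 i) addn1 expn1. Qed.

Lemma increment_half i j : increment T x m i j = a i j + b i j.
Proof.
rewrite /increment (dyadic_point_half i) (dyadic_point_half i.+1) mulSn add2n.
ring.
Qed.

Lemma signature_full n i w : (i < 2 ^ n)%N ->
  sg n (dp n i) (dp n i.+1) w = (\prod_(j <- w) increment T x n i j) / (size w)`!%:R.
Proof.
move=> lt; have h0 : 2 ^- n * T != 0 by rewrite mulf_neq0 ?invr_neq0 ?expf_neq0// gt_eqF.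
rewrite (dyadic_signature_linear T0 _ _ lt)// ?ler_dyadic//.
by congr (_ / _); apply: eq_bigr => j _; rewrite dyadic_pointS divff ?mul1r.
Qed.

Lemma signature_half i w : (i < 2 ^ m)%N ->
  sg m.+1 (dp m i) (dp m i.+1) w = \sum_(q < (size w).+1)
    (\prod_(j <- take q w) a i j) / (size (take q w))`!%:R *
    ((\prod_(j <- drop q w) b i j) / (size (drop q w))`!%:R).
Proof.
move=> im; rewrite (dyadic_point_half i) (dyadic_point_half i.+1) mulSn add2n.
have im2 : ((i * 2).+1 < 2 ^ m.+1)%N by rewrite expnS mulnC; lia.
rewrite (dyadic_signature_chen T0 _ _ _ (t := dp m.+1 (i * 2).+1)); first last.
- by rewrite dyadic_point_leT.
- by rewrite ler_dyadic.
- by rewrite ler_dyadic.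
- exact: dyadic_point_ge0.
apply: eq_bigr => q _; rewrite !signature_full//; exact: ltnW.
Qed.

Lemma area2E i j k : (i < 2 ^ m)%N ->
  sg m.+1 (dp m i) (dp m i.+1) [:: j; k] - sg m (dp m i) (dp m i.+1) [:: j; k] = area2 i j k.
Proof.
move=> im; rewrite signature_half// signature_full//.
rewrite !big_ord_recl big_ord0 /= !big_cons !big_nil /= !increment_half /area2.
rewrite (_ : 0`! = 1)%N// (_ : 1`! = 1)%N// (_ : 2`! = 2)%N//.
by field.
Qed.

Lemma area3E i j k l : (i < 2 ^ m)%N ->
  sg m.+1 (dp m i) (dp m i.+1) [:: j; k; l] - sg m (dp m i) (dp m i.+1) [:: j; k; l] =
  area3 i j k l.
Proof.
move=> im; rewrite signature_half// signature_full//.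
rewrite !big_ord_recl big_ord0 /= !big_cons !big_nil /= !increment_half /area3.
rewrite (_ : 0`! = 1)%N// (_ : 1`! = 1)%N// (_ : 2`! = 2)%N// (_ : 3`! = 6)%N//.
by field.
Qed.

Local Notation D A r w := (sg m.+1 (dp m A) (dp m (A + r)) w - sg m (dp m A) (dp m (A + r)) w).

Lemma signature_level1 A r j : (A + r <= 2 ^ m)%N ->
  (sg m (dp m A) (dp m (A + r)) [:: j] = x (dp m (A + r)) 0 j - x (dp m A) 0 j) *
  (sg m.+1 (dp m A) (dp m (A + r)) [:: j] = x (dp m (A + r)) 0 j - x (dp m A) 0 j).
Proof.
move=> Ar; have h : 0 <= dp m A by exact: dyadic_point_ge0.
have h' : dp m A <= dp m (A + r) by rewrite ler_dyadic// leq_addr.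
have h'' : dp m (A + r) <= T by rewrite dyadic_point_leT.
split; rewrite dyadic_signature1//.
  by rewrite !dyadic_approx_point.
by rewrite (dyadic_point_half A) (dyadic_point_half (A + r)) !dyadic_approx_point.
Qed.

Lemma chen_step n A r w : (A + r < 2 ^ m)%N -> sg n (dp m A) (dp m (A + r.+1)) w =
  \sum_(q < (size w).+1) sg n (dp m A) (dp m (A + r)) (take q w) *
    sg n (dp m (A + r)) (dp m (A + r).+1) (drop q w).
Proof.
move=> Ar; rewrite addnS (dyadic_signature_chen T0 _ _ _ (t := dp m (A + r)))//.
- exact: dyadic_point_ge0.
- by rewrite ler_dyadic// leq_addr.
- by rewrite ler_dyadic.
- by rewrite dyadic_point_leT.
Qed.

Lemma level1_eq A r j : (A + r <= 2 ^ m)%N -> D A r [:: j] = 0.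
Proof. by move=> Ar; rewrite !signature_level1// subrr. Qed.

Lemma dyadic_signature_diag n s w : 0 <= s <= T -> (0 < size w)%N -> sg n s s w = 0.
Proof.
move=> /andP[s0 sT] w0; have [K K0 h] := dyadic_signature_bound T0 x n.
apply/eqP; rewrite -normr_le0; apply: le_trans (h w s s s0 (lexx s) sT) _.
by rewrite subrr mulr0 expr0n gtn_eqF.
Qed.

Lemma chen_sum2 (f g : seq 'I_dim -> R) j k : f [::] = 1 -> g [::] = 1 ->
  \sum_(q < (size [:: j; k]).+1) f (take q [:: j; k]) * g (drop q [:: j; k]) =
  g [:: j; k] + f [:: j] * g [:: k] + f [:: j; k].
Proof. by move=> f0 g0; rewrite !big_ord_recl big_ord0 /= f0 g0; ring. Qed.

Lemma chen_sum3 (f g : seq 'I_dim -> R) j k l : f [::] = 1 -> g [::] = 1 ->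
  \sum_(q < (size [:: j; k; l]).+1) f (take q [:: j; k; l]) * g (drop q [:: j; k; l]) =
  g [:: j; k; l] + f [:: j] * g [:: k; l] + f [:: j; k] * g [:: l] + f [:: j; k; l].
Proof. by move=> f0 g0; rewrite !big_ord_recl big_ord0 /= f0 g0; ring. Qed.

(** Induction on the number of cells: the cross terms of Chen's relation are products of first
    levels, which coincide for the two interpolations at grid points. *)
Lemma level2_expansion A r j k : (A + r <= 2 ^ m)%N ->
  D A r [:: j; k] = \sum_(i < r) area2 (A + i) j k.
Proof.
elim: r => [|r IH] Ar.
  rewrite addn0 in Ar *; have AT : 0 <= dp m A <= T.
    by rewrite dyadic_point_ge0// dyadic_point_leT.
  by rewrite big_ord0 !dyadic_signature_diag// subrr.
have Ar' : (A + r < 2 ^ m)%N by rewrite -addnS.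
rewrite big_ord_recr /= -IH; last exact: ltnW.
rewrite -area2E// !chen_step// !chen_sum2//.
rewrite !(signature_level1 _ (ltnW Ar')).
have := signature_level1 (A := A + r) (r := 1) k; rewrite addn1 => /(_ Ar') [-> ->].
by move: (dyadic_signature T x m.+1) (dyadic_signature T x m) => s1 s0; ring.
Qed.

(** The area of a cell is flanked by the first level from [A] to the cell or from the cell to
    [A + r]. Adding a cell lengthens the latter, which accounts for the cross term containing the
    level two difference. *)
Lemma level3_expansion A r j k l : (A + r <= 2 ^ m)%N ->
  D A r [:: j; k; l] = \sum_(i < r)
    ((x (dp m (A + i)) 0 j - x (dp m A) 0 j) * area2 (A + i) k l + area3 (A + i) j k l +
     area2 (A + i) j k * (x (dp m (A + r)) 0 l - x (dp m (A + i).+1) 0 l)).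
Proof.
elim: r => [|r IH] Ar.
  rewrite addn0 in Ar *; have AT : 0 <= dp m A <= T.
    by rewrite dyadic_point_ge0// dyadic_point_leT.
  by rewrite big_ord0 !dyadic_signature_diag// subrr.
have Ar' : (A + r < 2 ^ m)%N by rewrite -addnS.
have Ar'' := ltnW Ar'.
have L2 := level2_expansion j k Ar''.
have {}IH := IH Ar''.
rewrite !chen_step// !chen_sum3//.
rewrite !(signature_level1 _ Ar'').
have := signature_level1 (A := A + r) (r := 1) l; rewrite addn1 => /(_ Ar') [-> ->].
rewrite -addnS.
(* [F q] is the summand for a block ending at [A + q]; only the right factor depends on [q]. *)
pose F q i := (x (dp m (A + i)) 0 j - x (dp m A) 0 j) * area2 (A + i) k l + area3 (A + i) j k l +
     area2 (A + i) j k * (x (dp m (A + q)) 0 l - x (dp m (A + i).+1) 0 l).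
have -> : \sum_(i < r.+1) F r.+1 i = \sum_(i < r) F r i +
    (\sum_(i < r) area2 (A + i) j k) * (x (dp m (A + r.+1)) 0 l - x (dp m (A + r)) 0 l) +
    ((x (dp m (A + r)) 0 j - x (dp m A) 0 j) * area2 (A + r) k l + area3 (A + r) j k l).
  rewrite big_ord_recr /= mulr_suml -big_split /=; congr (_ + _).
    by apply: eq_bigr => i _; rewrite /F; ring.
  by rewrite /F addnS; ring.
rewrite -IH -L2 -area3E// -area2E// addnS.
by move: (dyadic_signature T x m.+1) (dyadic_signature T x m) => s1 s0; ring.
Qed.

End area_expansion.

(** * Bounds in mean square *)

Section l2_bounds.
Context {R : realType} d (Omega : measurableType d) (P : probability Omega R).
Implicit Types f g : Omega -> R.

Definition l2_le f (K : R) : Prop :=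
  finite_moment P 2 f /\ \int[P]_w (f w ^+ 2) <= K.

Lemma l2_le_mono f (K L : R) : K <= L -> l2_le f K -> l2_le f L.
Proof. by move=> KL [mf fK]; split => //; exact: le_trans KL. Qed.

Lemma l2_leD f g (K L : R) : l2_le f K -> l2_le g L ->
  l2_le (fun w => f w + g w) (2 * K + 2 * L).
Proof.
move=> [[mf fi] fK] [[mg gi] gL]; have m2 := finite_moment2D (conj mf fi) (conj mg gi).
split=> //; apply: (@le_trans _ _ (\int[P]_w (2 * f w ^+ 2 + 2 * g w ^+ 2))).
  apply: le_integral_real; [exact: m2.2|by apply: integrableD_real; exact: integrableZ_real|].
  by move=> w; have := sqr_ge0 (f w - g w); nra.
rewrite integralD_real ?integralZ_real//; try exact: integrableZ_real.
by apply: lerD; rewrite ler_wpM2l.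
Qed.

Lemma l2_leZ f (c K : R) : l2_le f K -> l2_le (fun w => c * f w) (c ^+ 2 * K).
Proof.
move=> [mf fK]; split; first exact: finite_momentZ.
under eq_Rintegral do rewrite exprMn.
by rewrite integralZ_real ?ler_wpM2l ?sqr_ge0//; exact: mf.2.
Qed.

(** Iteration of [(f + g)^2 <= 2 f^2 + 2 g^2], with [2 + 2 * 4^n <= 4^(n + 1)]. *)
Lemma l2_le_seq (s : seq (Omega -> R)) (K : R) : 0 <= K ->
  (forall f, List.In f s -> l2_le f K) ->
  l2_le (fun w => \sum_(f <- s) f w) (4 ^+ size s * K).
Proof.
move=> K0; elim: s => [|f s IH] sK.
  have -> : (fun w => \sum_(f <- [::] : seq (Omega -> R)) f w) = fun=> 0.
    by apply/funext => w; rewrite big_nil.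
  split; first exact: finite_moment0.
  by under eq_Rintegral do rewrite expr0n /=; rewrite Rintegral_cst// !mul0r mul1r.
have -> : (fun w => \sum_(g <- f :: s) g w) = (fun w => f w + \sum_(g <- s) g w).
  by apply/funext => w; rewrite big_cons.
apply: l2_le_mono (l2_leD (sK f (or_introl erefl)) (IH _)); last by move=> g gs; apply: sK; right.
rewrite exprS; have : 1 <= 4 ^+ size s :> R by rewrite exprn_ege1 ?ler1n.
move: (4 ^+ size s) => x x1; nra.
Qed.

(** An arithmetic-geometric inequality with the weights [v^2 / u^2] and [u^2 / v^2], which balance
    the two fourth moments, takes the place of Cauchy-Schwarz. *)
Lemma fourth_mul_le f g (C u v : R) : finite_moment P 4 f -> finite_moment P 4 g -> 0 < u -> 0 < v ->
  \int[P]_w (f w ^+ 4) <= C * u ^+ 4 -> \int[P]_w (g w ^+ 4) <= C * v ^+ 4 ->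
  l2_le (fun w => f w * g w) (C * (u ^+ 2 * v ^+ 2)).
Proof.
move=> [mf fi] [mg gi] u0 v0 fC gC.
have m2 := finite_moment4_mul (conj mf fi) (conj mg gi); split=> //.
pose c := v ^+ 2 / u ^+ 2; pose e := u ^+ 2 / v ^+ 2.
have c0 : 0 <= c by rewrite divr_ge0 ?sqr_ge0.
have e0 : 0 <= e by rewrite divr_ge0 ?sqr_ge0.
have ce : c * e = 1 by rewrite /c /e; field; rewrite !gt_eqF.
apply: (@le_trans _ _ (\int[P]_w (c / 2 * f w ^+ 4 + e / 2 * g w ^+ 4))).
  apply: le_integral_real; [exact: m2.2|by apply: integrableD_real; exact: integrableZ_real|].
  move=> w; have -> : c / 2 * f w ^+ 4 + e / 2 * g w ^+ 4 = (f w * g w) ^+ 2 * (c * e) +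
      (c / 2 * (f w ^+ 2 - e * g w ^+ 2) ^+ 2 + (1 - c * e) * (e / 2 * g w ^+ 4)) by field.
  rewrite ce subrr mul0r addr0 mulr1 lerDl; apply: mulr_ge0; first exact: divr_ge0.
  exact: sqr_ge0.
rewrite integralD_real ?integralZ_real//; try exact: integrableZ_real.
have -> : C * (u ^+ 2 * v ^+ 2) = c / 2 * (C * u ^+ 4) + e / 2 * (C * v ^+ 4).
  by rewrite /c /e; field; rewrite !gt_eqF.
by apply: lerD; rewrite ler_wpM2l// divr_ge0.
Qed.

Lemma sum_inj_le (I J : finType) (h : I -> J) (F : J -> R) : injective h -> (forall j, 0 <= F j) ->
  \sum_i F (h i) <= \sum_j F j.
Proof.
move=> hi F0; rewrite (_ : \sum_i F (h i) = \sum_(j in [set h i | i in I]%SET) F j).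
  rewrite [leRHS](bigID (mem [set h i | i in I]%SET)) /= lerDl; exact: sumr_ge0.
by rewrite big_imset //= => i i' _ _; exact: hi.
Qed.

End l2_bounds.

(** * Decoupling and mean square bounds for the areas *)

Section area_moments.
Context {R : realType} d (Omega : measurableType d) (P : probability Omega R).
Variables (T : R) (N dim : nat) (H a : 'I_N -> R) (B : 'I_N -> 'I_dim -> R -> {RV P >-> R}).
Hypotheses (T0 : 0 < T) (H01 : forall k, 0 < H k < 1).
Hypothesis BH : forall k, is_fBm P T (H k) (B k).
Hypothesis BI : mutually_independent P (fun k => process_sigma_algebra P T (B k)).
Variable C : R.
Hypothesis C1 : 1 <= C.
Local Notation h := (hurst_ratio H).
Local Notation dp := (dyadic_point T).
Local Notation U := (mixed_diff (P := P) a B).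
Local Notation z := (mixed_step (P := P) T a B).
Hypothesis fourthC : forall m s t j, 0 <= s <= T -> 0 <= t <= T ->
  `|t - s| <= 2 ^- m * T -> \int[P]_w (U s t j w ^+ 4) <= C * h ^+ (4 * m).
Hypothesis covC : forall m l j, (l < 2 ^ m)%N ->
  \sum_(0 <= l' < 2 ^ m) `|\int[P]_w (z m l j w * z m l' j w)| <= C * h ^+ (2 * m).

Let other (j : 'I_dim) : {set 'I_N * 'I_dim} := [set z | z.2 != j]%SET.

(** The [G i] enter only through the uniform bound [g] on [|E (G_i G_i')|]; all decorrelation comes
    from the steps, and each of the [r] rows costs one row sum of their covariances. The boolean [e]
    selects a half of the cell. *)
Lemma cross_sum_le m A r (e : bool) j (G : 'I_r -> Omega -> R) (g : R) :
  (A + r <= 2 ^ m)%N -> 0 <= g ->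
  (forall i, sub_measurable (components T B (other j)) (G i)) ->
  (forall i, l2_le P (G i) g) ->
  l2_le P (fun w => \sum_(i < r) G i w * z m.+1 ((A + i) * 2 + e) j w)
    (r%:R * g * (C * h ^+ (2 * m.+1))).
Proof.
move=> Ar g0 sG G2.
have lt (i : 'I_r) : ((A + i) * 2 + e < 2 ^ m.+1)%N.
  have : (A + i < 2 ^ m)%N by apply: leq_trans Ar; rewrite ltn_add2l.
  rewrite expnS; move: (2 ^ m)%N => q; case: (e) => /=; lia.
pose c (i : 'I_r) : 'I_(2 ^ m.+1) := Ordinal (lt i).
have cinj : injective c.
  move=> i i' /(congr1 val) /= /eqP; rewrite eqn_add2r eqn_pmul2r// eqn_add2l => /eqP ii'.
  exact: val_inj.
pose Z i := z m.+1 ((A + i) * 2 + e) j.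
have mZ (i : 'I_r) : finite_moment P 4 (Z i).
  by apply: (mixed_step_moment a T0 BH); exact: lt.
have m2Z (i : 'I_r) := finite_moment42 (mZ i).
have sZ (i : 'I_r) : sub_measurable (components T B [set z | z.2 == j]%SET) (Z i).
  apply: sub_measurable_diff; [apply: (dyadic_point_in T0); exact/ltnW/lt
    |apply: (dyadic_point_in T0); exact: lt|].
  by move=> k; rewrite finset.in_set.
have GZ (i i' : 'I_r) :
    P.-integrable setT (EFin \o (fun w => (G i w * G i' w) * (Z i w * Z i' w))) /\
    \int[P]_w ((G i w * G i' w) * (Z i w * Z i' w)) =
    (\int[P]_w (G i w * G i' w)) * (\int[P]_w (Z i w * Z i' w)).
  apply: (component_independent_integral BH BI (j := j)).
  - by apply: measurable_funM; exact: sG.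
  - by apply: measurable_funM; exact: sZ.
  - by apply: finite_moment2_mul; [exact: (G2 i).1|exact: (G2 i').1].
  - exact: finite_moment2_mul.
have mGZ (i : 'I_r) : finite_moment P 2 (fun w => G i w * Z i w).
  split; first by apply: measurable_funM; [exact: (G2 i).1.1|exact: (mZ i).1].
  have := (GZ i i).1; congr (_.-integrable _ _); apply/funext => w /=; congr EFin; ring.
have GG i i' : `|\int[P]_w (G i w * G i' w)| <= g.
  have [[mi ii] gi] := G2 i; have [[mi' ii'] gi'] := G2 i'.
  have iGG := finite_moment2_mul (G2 i).1 (G2 i').1.
  apply: le_trans (le_normr_Rintegral measurableT iGG) _.
  apply: (@le_trans _ _ (\int[P]_w (2^-1 * G i w ^+ 2 + 2^-1 * G i' w ^+ 2))).
    apply: le_integral_real; first exact: integrable_norm.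
      by apply: integrableD_real; exact: integrableZ_real.
    by move=> w; rewrite ler_norml; apply/andP; split;
      have := sqr_ge0 (G i w - G i' w); have := sqr_ge0 (G i w + G i' w); nra.
  rewrite integralD_real ?integralZ_real//; try exact: integrableZ_real.
  lra.
split; first exact: finite_moment2_sum.
have -> : (fun w => (\sum_(i < r) G i w * Z i w) ^+ 2) =
    (fun w => \sum_(i < r) \sum_(i' < r) (G i w * G i' w) * (Z i w * Z i' w)).
  apply/funext => w; rewrite expr2 mulr_suml; apply: eq_bigr => i _.
  by rewrite mulr_sumr; apply: eq_bigr => i' _; ring.
have iGZ (i i' : 'I_r) := (GZ i i').1.
rewrite integral_sum_real; last by move=> i; exact: integrable_sum_real.
have -> : r%:R * g * (C * h ^+ (2 * m.+1)) = \sum_(i < r) g * (C * h ^+ (2 * m.+1)).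
  by rewrite sumr_const card_ord -[RHS]mulr_natl -mulrA.
apply: ler_sum => i _; rewrite integral_sum_real//.
apply: (@le_trans _ _ (\sum_(i' < r) g * `|\int[P]_w (Z i w * Z i' w)|)).
  apply: ler_sum => i' _; rewrite (GZ i i').2; apply: le_trans (ler_norm _) _.
  by rewrite normrM ler_wpM2r.
rewrite -mulr_sumr ler_wpM2l//; apply: le_trans (covC j (lt i)).
rewrite big_mkord.
(* The chosen half cells are distinct, so their row sum is part of the one over all [2^(m + 1)]
   cells. *)
exact: (sum_inj_le (h := c) (F := fun l : 'I__ => `|\int[P]_w (Z i w * z m.+1 l j w)|) cinj).
Qed.

Lemma sub_measurable_other j k s t : 0 <= s <= T -> 0 <= t <= T -> k != j ->
  sub_measurable (components T B (other j)) (U s t k).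
Proof. by move=> sT tT kj; apply: sub_measurable_diff => // i; rewrite finset.in_set. Qed.

Lemma h_gt0 : 0 < h. Proof. exact: hurst_ratio_gt0. Qed.

Lemma pair_l2 n n' s t s' t' j k : 0 <= s <= T -> 0 <= t <= T -> 0 <= s' <= T -> 0 <= t' <= T ->
  `|t - s| <= 2 ^- n * T -> `|t' - s'| <= 2 ^- n' * T ->
  l2_le P (fun w => U s t j w * U s' t' k w) (C * (h ^+ (2 * n) * h ^+ (2 * n'))).
Proof.
move=> sT tT s'T t'T st s't'.
rewrite !(mulnC 2) !exprM; apply: fourth_mul_le.
- exact: (mixed_diff_moment a BH).
- exact: (mixed_diff_moment a BH).
- by rewrite exprn_gt0// h_gt0.
- by rewrite exprn_gt0// h_gt0.
- by rewrite -exprM mulnC; exact: fourthC.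
- by rewrite -exprM mulnC; exact: fourthC.
Qed.

(** The product bound with the constant 1 as second factor, whose fourth moment is at most [C] since
    [C >= 1]. *)
Lemma single_l2 n s t j : 0 <= s <= T -> 0 <= t <= T -> `|t - s| <= 2 ^- n * T ->
  l2_le P (U s t j) (C * h ^+ (2 * n)).
Proof.
move=> sT tT st.
have m1 : finite_moment P 4 (fun=> 1 : R).
  by split; [exact: measurable_cst|under eq_fun do rewrite expr1n; exact: integrable_cst_prob].
have i1 : \int[P]_w (1 ^+ 4) <= C * 1 ^+ 4 :> R.
  rewrite !expr1n mulr1 Rintegral_cst//.
  have -> : fine (P setT) = 1 by rewrite probability_setT.
  by rewrite mulr1.
have e4 : C * h ^+ (4 * n) = C * (h ^+ n) ^+ 4 by rewrite -exprM mulnC.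
have hn0 : 0 < h ^+ n by rewrite exprn_gt0// h_gt0.
have fU := fourthC j sT tT st; rewrite e4 in fU.
have := fourth_mul_le (mixed_diff_moment a BH j sT tT) m1 hn0 ltr01 fU i1.
have -> : C * ((h ^+ n) ^+ 2 * 1 ^+ 2) = C * h ^+ (2 * n).
  by rewrite expr1n mulr1 -exprM mulnC.
by congr (l2_le _ _ _); apply/funext => w; rewrite mulr1.
Qed.

Variables (n m A r : nat).
Hypotheses (Ar : (A + r <= 2 ^ m)%N) (nm : (n <= m)%N) (rn : (r * 2 ^ n <= 2 ^ m)%N).
Hypothesis h1 : h <= 1.

(** Bounds for sums over a block of [r] cells of generation [m], no longer than an interval of
    generation [n]. Each cell contributes the square of a step variance; in [K3] the factor [h^(2n)]
    comes from a third increment of length at most [2^-n T]. *)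
Let K2 : R := C ^+ 2 * r%:R * h ^+ (4 * m).
Let K3 : R := C ^+ 2 * r%:R * h ^+ (2 * n) * h ^+ (4 * m).

Definition step_start (i : nat) (e : bool) := dp m.+1 ((A + i) * 2 + e).
Definition step_end (i : nat) (e : bool) := dp m.+1 ((A + i) * 2 + e).+1.

Local Notation zz i e j := (z m.+1 ((A + i) * 2 + e) j).

Lemma half_lt (i : 'I_r) (e : bool) : ((A + i) * 2 + e < 2 ^ m.+1)%N.
Proof.
have : (A + i < 2 ^ m)%N by apply: leq_trans Ar; rewrite ltn_add2l.
by rewrite expnS; move: (2 ^ m)%N => q; case: e => /=; lia.
Qed.

Lemma half_in (i : 'I_r) (e : bool) :
  (0 <= step_start i e <= T) * (0 <= step_end i e <= T) *
  (`|step_end i e - step_start i e| <= 2 ^- m.+1 * T) *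
  (`|step_end i e - step_start i e| <= 2 ^- n * T).
Proof.
have lt := half_lt i e; have hT : 0 <= 2 ^- m.+1 * T by rewrite mulr_ge0 ?invr_ge0 ?exprn_ge0 ?ltW.
have e1 : `|step_end i e - step_start i e| = 2 ^- m.+1 * T.
  by rewrite /step_end /step_start dyadic_pointS ger0_norm.
have h2 : 2 ^- m.+1 * T <= 2 ^- n * T.
  by rewrite ler_wpM2r ?(ltW T0)// lef_pV2 ?posrE ?exprn_gt0// ler_weXn2l ?ler1n// ltnW.
do !split; rewrite ?e1//; apply: (dyadic_point_in T0) => //; exact: ltnW.
Qed.

Lemma h_exp_le p q : (p <= q)%N -> h ^+ q <= h ^+ p.
Proof. by move=> pq; apply: ler_wiXn2l => //; rewrite ltW ?h_gt0. Qed.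

Lemma hX_ge0 p : 0 <= h ^+ p. Proof. by rewrite exprn_ge0 ?ltW ?h_gt0. Qed.

Let C0 : 0 <= C. Proof. exact: le_trans C1. Qed.

Lemma K2_ge0 : 0 <= K2.
Proof. by rewrite /K2; apply: mulr_ge0 (hX_ge0 _); apply: mulr_ge0 => //; exact: sqr_ge0. Qed.

Lemma K3_ge0 : 0 <= K3.
Proof.
rewrite /K3; apply: mulr_ge0 (hX_ge0 _); apply: mulr_ge0 (hX_ge0 _).
by apply: mulr_ge0 => //; exact: sqr_ge0.
Qed.

Lemma double_sum_l2 (e e' : bool) j k : j != k ->
  l2_le P (fun w => \sum_(i < r) zz i e j w * zz i e' k w) K2.
Proof.
move=> jk; apply: (@l2_le_mono _ _ _ _ _ (r%:R * (C * h ^+ (2 * m.+1)) * (C * h ^+ (2 * m.+1)))).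
  have -> : r%:R * (C * h ^+ (2 * m.+1)) * (C * h ^+ (2 * m.+1)) =
    C ^+ 2 * r%:R * (h ^+ (2 * m.+1) * h ^+ (2 * m.+1)) by ring.
  rewrite /K2 ler_wpM2l//; first by apply: mulr_ge0 => //; exact: sqr_ge0.
  by rewrite -exprD; apply: h_exp_le; lia.
apply: (cross_sum_le e' (G := fun i => zz i e j)) => //.
- by apply: mulr_ge0 (hX_ge0 _).
- by move=> i; have [[[h1' h2'] _] _] := half_in i e; exact: sub_measurable_other.
- by move=> i; have [[[h1' h2'] h3'] _] := half_in i e; exact: single_l2.
Qed.

(** The letter [k] differs from [p] and [j], so the last step is decoupled; the product of the other
    two factors is bounded through fourth moments. *)
Lemma triple_sum_l2 (s t : 'I_r -> R) (e e' : bool) p j k : p != k -> j != k ->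
  (forall i, 0 <= s i <= T) -> (forall i, 0 <= t i <= T) ->
  (forall i, `|t i - s i| <= 2 ^- n * T) ->
  l2_le P (fun w => \sum_(i < r) U (s i) (t i) p w * zz i e j w * zz i e' k w) K3.
Proof.
move=> pk jk sT tT st.
apply: (@l2_le_mono _ _ _ _ _ (r%:R * (C * (h ^+ (2 * n) * h ^+ (2 * m.+1))) * (C * h ^+ (2 * m.+1)))).
  have -> : r%:R * (C * (h ^+ (2 * n) * h ^+ (2 * m.+1))) * (C * h ^+ (2 * m.+1)) =
    C ^+ 2 * r%:R * h ^+ (2 * n) * (h ^+ (2 * m.+1) * h ^+ (2 * m.+1)) by ring.
  rewrite /K3 ler_wpM2l//.
    by apply: mulr_ge0 (hX_ge0 _); apply: mulr_ge0 => //; exact: sqr_ge0.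
  by rewrite -exprD; apply: h_exp_le; lia.
apply: (cross_sum_le e' (G := fun i w => U (s i) (t i) p w * zz i e j w)) => //.
- by apply: mulr_ge0 => //; apply: mulr_ge0; exact: hX_ge0.
- move=> i; have [[[h1' h2'] _] _] := half_in i e.
  by apply: measurable_funM; exact: sub_measurable_other.
- by move=> i; have [[[h1' h2'] h3'] _] := half_in i e; exact: pair_l2.
Qed.

(* Whatever the letters k != l, one of them differs from the two others, and
   the corresponding factor is the one to decouple. *)
Lemma diff_step_step_l2 (s t : 'I_r -> R) (e e' : bool) j k l : k != l ->
  (forall i, 0 <= s i <= T) -> (forall i, 0 <= t i <= T) ->
  (forall i, `|t i - s i| <= 2 ^- n * T) ->
  l2_le P (fun w => \sum_(i < r) U (s i) (t i) j w * zz i e k w * zz i e' l w) K3.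
Proof.
move=> kl sT tT st; have [jl|jl] := eqVneq j l; last exact: triple_sum_l2.
have jk : j != k by rewrite jl eq_sym.
have lk : l != k by rewrite eq_sym.
have -> : (fun w => \sum_(i < r) U (s i) (t i) j w * zz i e k w * zz i e' l w) =
   (fun w => \sum_(i < r) U (s i) (t i) j w * zz i e' l w * zz i e k w).
  by apply/funext => w; apply: eq_bigr => i _; ring.
exact: triple_sum_l2.
Qed.

(** One of the three steps is regarded as an increment of length at most [2^-n T]. If [k = l] the
    factors are first cycled, so that the two remaining letters differ as [diff_step_step_l2]
    requires. *)
Lemma step_step_step_l2 (e e' e'' : bool) j k l : ~~ ((j == k) && (k == l)) ->
  l2_le P (fun w => \sum_(i < r) zz i e j w * zz i e' k w * zz i e'' l w) K3.
Proof.
have hT e0 : (forall i : 'I_r, 0 <= step_start i e0 <= T) /\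
    (forall i : 'I_r, 0 <= step_end i e0 <= T) /\
    (forall i : 'I_r, `|step_end i e0 - step_start i e0| <= 2 ^- n * T).
  by split; [|split] => i; have [[[? ?] ?] ?] := half_in i e0.
move=> jkl; have [kl|kl] := eqVneq k l; last first.
  have [sT [tT st]] := hT e.
  exact: (diff_step_step_l2 (s := fun i => step_start i e) (t := fun i => step_end i e)).
have jk : j != k by move: jkl; rewrite kl eqxx andbT.
have -> : (fun w => \sum_(i < r) zz i e j w * zz i e' k w * zz i e'' l w) =
   (fun w => \sum_(i < r) zz i e'' l w * zz i e j w * zz i e' k w).
  by apply/funext => w; apply: eq_bigr => i _; ring.
have [sT [tT st]] := hT e''.
exact: (diff_step_step_l2 (s := fun i => step_start i e'') (t := fun i => step_end i e'')).
Qed.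

Local Notation path w := (mixed_fBm P a B w).

Lemma area2_step i j k w : area2 T (path w) m (A + i) j k =
  2^-1 * (zz i false j w * zz i true k w) + - 2^-1 * (zz i true j w * zz i false k w).
Proof. by rewrite /area2 /mixed_step addn0 addn1 mulNr. Qed.

Lemma l2_leZ1 f (c K : R) : 0 <= K -> `|c| <= 1 -> l2_le P f K -> l2_le P (fun w => c * f w) K.
Proof.
move=> K0 c1 fK; apply: l2_le_mono (l2_leZ c fK); rewrite ler_piMl//.
by rewrite -real_normK ?num_real// expr_le1.
Qed.

Lemma l2_zero (K : R) : 0 <= K -> l2_le P (fun=> 0) K.
Proof.
move=> K0; split; first exact: finite_moment0.
by under eq_Rintegral do rewrite expr0n /=; rewrite Rintegral_cst// mul0r.
Qed.

Let half1 : `|2^-1| <= 1 :> R. Proof. by rewrite ger0_norm ?invf_le1 ?ler1n. Qed.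
Let halfN1 : `|- 2^-1| <= 1 :> R. Proof. by rewrite normrN. Qed.
Let third1 : `|3^-1| <= 1 :> R. Proof. by rewrite ger0_norm ?invf_le1 ?ler1n. Qed.
Let sixthN1 : `|- 6^-1| <= 1 :> R.
Proof. by rewrite normrN ger0_norm ?invf_le1 ?ler1n. Qed.

(** Antisymmetry disposes of [j = k]; otherwise the two products have distinct letters. *)
Lemma area2_sum_l2 j k :
  l2_le P (fun w => \sum_(i < r) area2 T (path w) m (A + i) j k) (4 ^+ 2 * K2).
Proof.
have K0 := K2_ge0.
have [->|jk] := eqVneq j k.
  rewrite (_ : (fun w => _) = fun=> 0); first by apply: l2_zero; exact: mulr_ge0.
  by apply/funext => w; rewrite big1// => i _; rewrite area2_step; ring.
rewrite (_ : (fun w => _) = fun w => \sum_(f <- [::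
    (fun w => 2^-1 * \sum_(i < r) zz i false j w * zz i true k w);
    (fun w => - 2^-1 * \sum_(i < r) zz i true j w * zz i false k w)]) f w); last first.
  apply/funext => w; rewrite !big_cons big_nil addr0 !mulr_sumr -big_split /=.
  by apply: eq_bigr => i _; rewrite area2_step.
apply: (l2_le_seq K0) => f [<-|[<-|[]]].
  by apply: (l2_leZ1 K0 half1); exact: double_sum_l2.
by apply: (l2_leZ1 K0 halfN1); exact: double_sum_l2.
Qed.

Lemma diff_area2_sum_l2 (s t : 'I_r -> R) j k l :
  (forall i, 0 <= s i <= T) -> (forall i, 0 <= t i <= T) ->
  (forall i, `|t i - s i| <= 2 ^- n * T) ->
  l2_le P (fun w => \sum_(i < r) U (s i) (t i) j w * area2 T (path w) m (A + i) k l) (4 ^+ 2 * K3).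
Proof.
move=> sT tT st; have K0 := K3_ge0.
have [->|kl] := eqVneq k l.
  rewrite (_ : (fun w => _) = fun=> 0); first by apply: l2_zero; exact: mulr_ge0.
  by apply/funext => w; rewrite big1// => i _; rewrite area2_step; ring.
rewrite (_ : (fun w => _) = fun w => \sum_(f <- [::
    (fun w => 2^-1 * \sum_(i < r) U (s i) (t i) j w * zz i false k w * zz i true l w);
    (fun w => - 2^-1 * \sum_(i < r) U (s i) (t i) j w * zz i true k w * zz i false l w)]) f w);
  last first.
  apply/funext => w; rewrite !big_cons big_nil addr0 !mulr_sumr -big_split /=.
  by apply: eq_bigr => i _; rewrite area2_step; ring.
apply: (l2_le_seq K0) => f [<-|[<-|[]]].
  by apply: (l2_leZ1 K0 half1); exact: diff_step_step_l2.
by apply: (l2_leZ1 K0 halfN1); exact: diff_step_step_l2.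
Qed.

(** Three equal letters cannot be decoupled, but then the six terms cancel; in all other cases each
    of the six products is bounded separately. *)
Lemma area3_sum_l2 j k l :
  l2_le P (fun w => \sum_(i < r) area3 T (path w) m (A + i) j k l) (4 ^+ 6 * K3).
Proof.
have K0 := K3_ge0.
have area3_step i w : area3 T (path w) m (A + i) j k l =
    3^-1 * (zz i false j w * zz i false k w * zz i true l w) +
    (- 6^-1 * (zz i false j w * zz i true k w * zz i false l w) +
    (- 6^-1 * (zz i true j w * zz i false k w * zz i false l w) +
    (3^-1 * (zz i false j w * zz i true k w * zz i true l w) +
    (- 6^-1 * (zz i true j w * zz i false k w * zz i true l w) +
    - 6^-1 * (zz i true j w * zz i true k w * zz i false l w))))).
  by rewrite /area3 /mixed_step addn0 addn1; ring.
have [/andP[/eqP -> /eqP ->]|jkl] := boolP ((j == k) && (k == l)).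
  rewrite (_ : (fun w => _) = fun=> 0); first by apply: l2_zero; exact: mulr_ge0.
  by apply/funext => w; rewrite big1// => i _; rewrite /area3; field.
rewrite (_ : (fun w => _) = fun w => \sum_(f <- [::
    (fun w => 3^-1 * \sum_(i < r) zz i false j w * zz i false k w * zz i true l w);
    (fun w => - 6^-1 * \sum_(i < r) zz i false j w * zz i true k w * zz i false l w);
    (fun w => - 6^-1 * \sum_(i < r) zz i true j w * zz i false k w * zz i false l w);
    (fun w => 3^-1 * \sum_(i < r) zz i false j w * zz i true k w * zz i true l w);
    (fun w => - 6^-1 * \sum_(i < r) zz i true j w * zz i false k w * zz i true l w);
    (fun w => - 6^-1 * \sum_(i < r) zz i true j w * zz i true k w * zz i false l w)]) f w);
  last first.
  apply/funext => w; rewrite !big_cons big_nil addr0 !mulr_sumr -!big_split /=.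
  by apply: eq_bigr => i _; rewrite area3_step.
apply: (l2_le_seq K0) => f [<-|[<-|[<-|[<-|[<-|[<-|[]]]]]]].
- by apply: (l2_leZ1 K0 third1); exact: step_step_step_l2.
- by apply: (l2_leZ1 K0 sixthN1); exact: step_step_step_l2.
- by apply: (l2_leZ1 K0 sixthN1); exact: step_step_step_l2.
- by apply: (l2_leZ1 K0 third1); exact: step_step_step_l2.
- by apply: (l2_leZ1 K0 sixthN1); exact: step_step_step_l2.
- by apply: (l2_leZ1 K0 sixthN1); exact: step_step_step_l2.
Qed.

Local Notation D w v := (dyadic_signature T (path w) m.+1 (dp m A) (dp m (A + r)) v -
  dyadic_signature T (path w) m (dp m A) (dp m (A + r)) v).

Lemma level2_l2 j k : l2_le P (fun w => D w [:: j; k]) (4 ^+ 2 * K2).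
Proof.
rewrite (_ : (fun w => _) = fun w => \sum_(i < r) area2 T (path w) m (A + i) j k).
  exact: area2_sum_l2.
by apply/funext => w; rewrite level2_expansion.
Qed.

Lemma level3_l2 j k l : l2_le P (fun w => D w [:: j; k; l]) (4 ^+ 9 * K3).
Proof.
have K0 := K3_ge0.
have inT (i : nat) : (i <= r)%N -> 0 <= dp m (A + i) <= T.
  by move=> ir; apply: (dyadic_point_in T0); apply: leq_trans Ar; rewrite leq_add2l.
have dist (i i' : nat) : (i <= r)%N -> (i' <= i)%N -> `|dp m (A + i) - dp m (A + i')| <= 2 ^- n * T.
  move=> ir ii'; rewrite /dyadic_point -!mulrA -mulrBl -natrB ?leq_add2l// subnDl.
  rewrite ger0_norm; last by rewrite mulr_ge0// mulr_ge0 ?invr_ge0 ?exprn_ge0 ?ltW.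
  rewrite mulrA ler_wpM2r ?(ltW T0)// ler_pdivrMr ?exprn_gt0// mulrC.
  rewrite ler_pdivlMr ?exprn_gt0// -!natrX -natrM ler_nat (leq_trans _ rn)// leq_mul2r.
  by rewrite (leq_trans (leq_subr _ _))// orbT.
rewrite (_ : (fun w => _) = fun w => \sum_(f <- [::
    (fun w => \sum_(i < r) U (dp m A) (dp m (A + i)) j w * area2 T (path w) m (A + i) k l);
    (fun w => \sum_(i < r) area3 T (path w) m (A + i) j k l);
    (fun w => \sum_(i < r) U (dp m (A + i).+1) (dp m (A + r)) l w *
       area2 T (path w) m (A + i) j k)]) f w); last first.
  apply/funext => w; rewrite level3_expansion// !big_cons big_nil addr0 -!big_split /=.
  by apply: eq_bigr => i _; rewrite /mixed_diff; ring.
have -> : 4 ^+ 9 * K3 = 4 ^+ 3 * (4 ^+ 6 * K3) by rewrite mulrA -exprD.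
have mono (f : Omega -> R) : l2_le P f (4 ^+ 2 * K3) -> l2_le P f (4 ^+ 6 * K3).
  by apply: l2_le_mono; rewrite ler_wpM2r//; lra.
have K6 : 0 <= 4 ^+ 6 * K3 by apply: mulr_ge0.
apply: (l2_le_seq K6) => f [<-|[<-|[<-|[]]]].
- apply: mono; apply: diff_area2_sum_l2 => i.
  + by rewrite -[A]addn0; exact: inT.
  + by apply: inT; exact: ltnW.
  + by rewrite -{2}[A]addn0; apply: dist => //; exact: ltnW.
- exact: area3_sum_l2.
- apply: mono; apply: diff_area2_sum_l2 => i.
  + by rewrite -addnS; apply: inT.
  + exact: inT.
  + by rewrite -addnS; exact: dist.
Qed.

End area_moments.

(** The interval of generation [n] is a block of [2^r] cells of generation [n + r]. The bound decays
    in [r] like [(2 h^4)^r], with [h] the Hurst ratio, and the extra power of [h] is present only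
    for three letters. *)
Lemma area_l2 (R : realType) d (Omega : measurableType d) (P : probability Omega R)
    (T : R) (N dim : nat) (H a : 'I_N -> R) (B : 'I_N -> 'I_dim -> R -> {RV P >-> R}) :
  0 < T -> (forall k, 0 < H k < 1) -> (forall k, is_fBm P T (H k) (B k)) ->
  mutually_independent P (fun k => process_sigma_algebra P T (B k)) ->
  0 < min_hurst H <= 2^-1 ->
  exists2 K, 0 <= K & forall n r l v, (l < 2 ^ n)%N -> (size v == 2) || (size v == 3) ->
    l2_le P (fun w =>
      dyadic_signature T (mixed_fBm P a B w) (n + r).+1 (dyadic_point T n l) (dyadic_point T n l.+1) v -
      dyadic_signature T (mixed_fBm P a B w) (n + r) (dyadic_point T n l) (dyadic_point T n l.+1) v)
    (K * 2 ^+ r * hurst_ratio H ^+ (2 * n * (size v - 2)) * hurst_ratio H ^+ (4 * (n + r))).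
Proof.
move=> T0 H01 BH BI /andP[H0 H2].
have [C4 C40 f4] := mixed_diff_fourth a T0 H01 BH.
have [C2 C20 c2] := mixed_step_cov a T0 H01 BH BI H2.
(* One constant for both moment estimates, and at least 1. *)
pose C := 1 + C4 + C2.
have C1 : 1 <= C by rewrite /C; lra.
have hh0 := hurst_ratio_gt0 H.
have f4' m s t j : 0 <= s <= T -> 0 <= t <= T -> `|t - s| <= 2 ^- m * T ->
    \int[P]_w (mixed_diff a B s t j w ^+ 4) <= C * hurst_ratio H ^+ (4 * m).
  move=> sT tT st; apply: le_trans (f4 m s t j sT tT st) _.
  by rewrite ler_wpM2r ?exprn_ge0 ?ltW//; rewrite /C; lra.
have c2' m l j : (l < 2 ^ m)%N ->
    \sum_(0 <= l' < 2 ^ m) `|\int[P]_w (mixed_step T a B m l j w * mixed_step T a B m l' j w)|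
    <= C * hurst_ratio H ^+ (2 * m).
  move=> lm; apply: le_trans (c2 m l j lm) _.
  by rewrite ler_wpM2r ?exprn_ge0 ?ltW//; rewrite /C; lra.
have h1 : hurst_ratio H <= 1.
  by rewrite /hurst_ratio -[leRHS](powRr0 2) ler_powR ?ler1n// oppr_le0 ltW.
exists (4 ^+ 9 * C ^+ 2); first by apply: mulr_ge0 => //; exact: sqr_ge0.
move=> n r l v ln sv.
have e1 : dyadic_point T n l = dyadic_point T (n + r) (l * 2 ^ r) by rewrite dyadic_point_refine.
have e2 : dyadic_point T n l.+1 = dyadic_point T (n + r) (l * 2 ^ r + 2 ^ r).
  by rewrite [(l * _ + _)%N]addnC -mulSn dyadic_point_refine.
have Ar : (l * 2 ^ r + 2 ^ r <= 2 ^ (n + r))%N by rewrite addnC -mulSn expnD leq_mul2r ln orbT.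
have rn : (2 ^ r * 2 ^ n <= 2 ^ (n + r))%N by rewrite expnD mulnC.
rewrite e1 e2; case: v sv => [|j [|k [|i [|]]]]// _.
- have := level2_l2 T0 BH BI C1 f4' c2' Ar (leq_addr r n) rn h1 j k; apply: l2_le_mono.
  rewrite natrX subnn muln0 expr0 mulr1.
  have : 0 <= C ^+ 2 * 2 ^+ r * hurst_ratio H ^+ (4 * (n + r)).
    by apply: mulr_ge0; [apply: mulr_ge0; [exact: sqr_ge0|exact: exprn_ge0]|rewrite exprn_ge0 ?ltW].
  set x := C ^+ 2 * _ * _ => x0.
  have -> : 4 ^+ 9 * C ^+ 2 * 2 ^+ r * hurst_ratio H ^+ (4 * (n + r)) = 4 ^+ 9 * x.
    by rewrite /x !mulrA.
  by rewrite ler_wpM2r//; lra.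
- have := level3_l2 T0 BH BI C1 f4' c2' Ar (leq_addr r n) rn h1 j k i; apply: l2_le_mono.
  by rewrite natrX subn2 /= muln1 -!mulrA.
Qed.

(** * Summable weights *)

Section energy.
Context {R : realType} {dim : nat} (T al rho : R) (k0 : nat) (x : R -> 'rV[R]_dim).
Local Notation dp := (dyadic_point T).

Definition cell_signature m n l w : R := dyadic_signature T x m (dp n l) (dp n l.+1) w.

(* For [n <= m] this dominates [2^(-Hn) rho^(4(m-n))], see [scale_ge]. *)
Definition energy_scale (n m : nat) : R := (2 `^ (- al)) ^+ n * rho ^+ (2 * (n + m)).

(** The leading 1 makes powers of the energy increase with the exponent. Fourth powers of the first
    levels of two successive interpolations cover the generations on which these are affine; squares
    of the differences over at least two letters cover [n <= m]. *)
Definition energy (n m l : nat) : R :=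
  1 + (if (m <= n)%N then \sum_(j < dim) (cell_signature m n l [:: j] / energy_scale n m) ^+ 4 else 0)
  + (if (m < n)%N then \sum_(j < dim) (cell_signature m.+1 n l [:: j] / energy_scale n m) ^+ 4 else 0)
  + (if (n <= m)%N then \sum_(v : k0.-bseq 'I_dim | (1 < size v)%N)
       ((cell_signature m.+1 n l v - cell_signature m n l v) / energy_scale n m ^+ size v) ^+ 2
     else 0).

(** The factor [2^-n] compensates for the [2^n] cells of a generation, and [rho^(n + m)] makes the
    expectations summable. *)
Definition energy_weight (n m l : nat) : R := 2 ^- n * rho ^+ (n + m) * energy n m l.

Hypotheses (T0 : 0 < T) (al4 : 4^-1 <= al) (al1 : al <= 1) (rho0 : 0 < rho) (rho1 : rho < 1).

Let part1_ge0 n m l (b : bool) (q : nat) : 0 <=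
  (if b then \sum_(j < dim) (cell_signature q n l [:: j] / energy_scale n m) ^+ 4 else 0).
Proof. by case: b => //; apply: sumr_ge0 => j _; rewrite exprn_even_ge0. Qed.

Let part2_ge0 n m l : 0 <= (if (n <= m)%N then \sum_(v : k0.-bseq 'I_dim | (1 < size v)%N)
       ((cell_signature m.+1 n l v - cell_signature m n l v) / energy_scale n m ^+ size v) ^+ 2
     else 0).
Proof. by case: ifP => // _; apply: sumr_ge0 => v _; exact: sqr_ge0. Qed.

Lemma energy_ge1 n m l : 1 <= energy n m l.
Proof.
rewrite /energy; have := part1_ge0 n m l (m <= n)%N m.
have := part1_ge0 n m l (m < n)%N m.+1; have := part2_ge0 n m l; lra.
Qed.

Lemma energy_scale_gt0 n m : 0 < energy_scale n m.
Proof. by rewrite /energy_scale mulr_gt0// exprn_gt0// powR_gt0. Qed.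

Lemma energy_weight_ge0 n m l : 0 <= energy_weight n m l.
Proof.
rewrite /energy_weight; apply: mulr_ge0; last exact: le_trans (energy_ge1 n m l).
by apply: mulr_ge0; rewrite ?invr_ge0 exprn_ge0// ltW.
Qed.

Lemma le_powR_root (u V : R) k : 1 <= V -> u ^+ k.+1 <= V -> 0 <= u -> u <= V `^ (k.+1%:R^-1).
Proof.
move=> V1 uV u0.
have -> : u = (u ^+ k.+1) `^ (k.+1%:R^-1).
  by rewrite -powR_mulrn// -powRrM divff// powRr1.
by apply: ge0_ler_powR; rewrite ?nnegrE ?invr_ge0 ?exprn_ge0// (le_trans ler01).
Qed.

(** Since [V >= 1], the exponent [1 / (k + 1)] may be raised to [e]. *)
Lemma scaled_le (u V b e : R) k : 1 <= V -> 0 < b -> (u / b) ^+ k.+1 <= V -> ~~ odd k.+1 ->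
  k.+1%:R^-1 <= e -> `|u| <= b * V `^ e.
Proof.
move=> V1 b0 uV ok ke.
have uVn : (`|u| / b) ^+ k.+1 <= V.
  have -> : `|u| / b = `|u / b| by rewrite normrM [X in _ = _ * X]ger0_norm// invr_ge0 ltW.
  by rewrite -normrX ger0_norm// exprn_even_ge0.
have := le_powR_root V1 uVn (divr_ge0 (normr_ge0 _) (ltW b0)).
rewrite ler_pdivrMr// mulrC => /le_trans; apply; rewrite ler_wpM2l ?(ltW b0)//.
exact: ler_powR.
Qed.

Lemma cell_signature_coarse m n l w : (m <= n)%N -> (l < 2 ^ n)%N ->
  cell_signature m n l w = (\prod_(j <- w) cell_signature m n l [:: j]) / (size w)`!%:R.
Proof.
move=> mn ln; set l' := (l %/ 2 ^ (n - m))%N.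
have lm : (l' < 2 ^ m)%N by rewrite ltn_divLR ?expn_gt0// -expnD subnKC.
have refine i : dp m i = dp n (i * 2 ^ (n - m)).
  by rewrite -(dyadic_point_refine T m (n - m) i) subnKC.
have e1 := refine l'; have e2 := refine l'.+1.
have h1 : dp m l' <= dp n l by rewrite e1 ler_dyadic// leq_divM.
have h2 : dp n l <= dp n l.+1 by rewrite ler_dyadic.
have h3 : dp n l.+1 <= dp m l'.+1 by rewrite e2 ler_dyadic// ltn_ceil// expn_gt0.
rewrite /cell_signature (dyadic_signature_linear T0 _ _ lm h1 h2 h3).
congr (_ / _); apply: eq_bigr => j _.
by rewrite (dyadic_signature_linear T0 _ _ lm h1 h2 h3) big_seq1 /= divr1.
Qed.

Lemma cell_signature_coarse_le m n l w (B : R) : (m <= n)%N -> (l < 2 ^ n)%N ->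
  (forall j, `|cell_signature m n l [:: j]| <= B) -> `|cell_signature m n l w| <= B ^+ size w.
Proof.
move=> mn ln sB; rewrite cell_signature_coarse// normrM.
rewrite [X in _ * X <= _]ger0_norm ?invr_ge0//.
apply: (@le_trans _ _ (`|\prod_(j <- w) cell_signature m n l [:: j]|)).
  by rewrite ler_piMr// invf_le1 ?ltr0n ?fact_gt0// ler1n fact_gt0.
elim: w => [|j w IH]; first by rewrite big_nil normr1.
by rewrite big_cons normrM exprS; apply: ler_pM.
Qed.

Lemma energy_coarse n m l w : (m <= n)%N -> (l < 2 ^ n)%N ->
  `|cell_signature m n l w| <= (energy_scale n m * energy n m l `^ al) ^+ size w.
Proof.
move=> mn ln; apply: cell_signature_coarse_le => // j.
apply: (scaled_le (k := 3)) => //; [exact: energy_ge1|exact: energy_scale_gt0|].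
rewrite /energy mn; set f := fun j => (cell_signature m n l [:: j] / energy_scale n m) ^+ 4.
have : f j <= \sum_(j < dim) f j.
  by rewrite (bigD1 j)//= lerDl sumr_ge0// => i _; rewrite /f exprn_even_ge0.
have := part1_ge0 n m l (m < n)%N m.+1; have := part2_ge0 n m l; rewrite /f; lra.
Qed.

Lemma energy_coarse_succ n m l w : (m < n)%N -> (l < 2 ^ n)%N ->
  `|cell_signature m.+1 n l w| <= (energy_scale n m * energy n m l `^ al) ^+ size w.
Proof.
move=> mn ln; apply: cell_signature_coarse_le => // j.
apply: (scaled_le (k := 3)) => //; [exact: energy_ge1|exact: energy_scale_gt0|].
rewrite /energy mn; set f := fun j => (cell_signature m.+1 n l [:: j] / energy_scale n m) ^+ 4.
have : f j <= \sum_(j < dim) f j.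
  by rewrite (bigD1 j)//= lerDl sumr_ge0// => i _; rewrite /f exprn_even_ge0.
have := part1_ge0 n m l (m <= n)%N m; have := part2_ge0 n m l; rewrite /f; lra.
Qed.

(** For two letters or more [1/2 <= al |w|], so squares suffice; for one letter the difference
    vanishes. *)
Lemma energy_fine n m l w : (n <= m)%N -> (l < 2 ^ n)%N -> (0 < size w <= k0)%N ->
  `|cell_signature m.+1 n l w - cell_signature m n l w| <=
  (energy_scale n m * energy n m l `^ al) ^+ size w.
Proof.
move=> nm ln /andP[w0 wk]; have b0 := energy_scale_gt0 n m.
case: (ltngtP (size w) 1) => [|w1|w1]; first by rewrite ltnNge w0.
  have bk0 : 0 < energy_scale n m ^+ size w by rewrite exprn_gt0.
  apply: le_trans (scaled_le (k := 1) (e := al * (size w)%:R) (energy_ge1 n m l) bk0 _ _ _) _ => //.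
  - rewrite /energy nm; set v := insub_bseq k0 w.
    have vw : v = w :> seq _ by rewrite /v /insub_bseq val_insubd wk.
    set f := fun v : k0.-bseq 'I_dim =>
       ((cell_signature m.+1 n l v - cell_signature m n l v) / energy_scale n m ^+ size v) ^+ 2.
    have : f v <= \sum_(v : k0.-bseq 'I_dim | (1 < size v)%N) f v.
      by rewrite (bigD1 v) ?vw//= lerDl sumr_ge0// => i _; exact: sqr_ge0.
    have := part1_ge0 n m l (m <= n)%N m; have := part1_ge0 n m l (m < n)%N m.+1.
    rewrite /f vw; lra.
  - have s2 : 2 <= (size w)%:R :> R by rewrite ler_nat.
    have := ler_pM (_ : 0 <= 4^-1 :> R) (ler0n _ 2) al4 s2.
    rewrite invr_ge0 ler0n => /(_ isT); lra.
  - rewrite [leRHS]exprMn (powRrM _ al) powR_mulrn; first exact: lexx.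
    exact: powR_ge0.
case: w w0 w1 {wk} => [|j [|]]// _ _.
have := level1_eq x (m := m) T0 (A := l * 2 ^ (m - n)) (r := 2 ^ (m - n)) j.
have refine i : dp m (i * 2 ^ (m - n)) = dp n i.
  by rewrite -(dyadic_point_refine T n (m - n) i) subnKC.
have e1 := refine l; have e2 := refine l.+1; rewrite mulSn addnC in e2.
have lm : (l * 2 ^ (m - n) + 2 ^ (m - n) <= 2 ^ m)%N.
  by rewrite addnC -mulSn -{2}(subnKC nm) expnD leq_mul2r ln orbT.
rewrite e1 e2 => /(_ lm) e; rewrite /cell_signature e normr0.
by rewrite exprn_ge0// mulr_ge0 ?powR_ge0// ltW.
Qed.

(** Half of the factor [rho^(2(n + m))] in the scale is kept; the other half is at most
    [rho^(al (n + m))], the contribution of the weight, because [al <= 1]. *)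
Lemma energy_scale_weight n m l :
  energy_scale n m * energy n m l `^ al <= rho ^+ (n + m) * energy_weight n m l `^ al.
Proof.
have V0 : 0 <= energy n m l by exact: le_trans (energy_ge1 n m l).
have al0 : 0 <= al by apply: le_trans al4.
rewrite /energy_weight powRM ?mulr_ge0 ?invr_ge0 ?exprn_ge0 ?(ltW rho0)//.
rewrite mulrA; apply: ler_wpM2r; first exact: powR_ge0.
rewrite powRM ?invr_ge0 ?exprn_ge0 ?(ltW rho0)// /energy_scale.
have -> : (2 ^- n) `^ al = (2 `^ (- al)) ^+ n.
  by rewrite -powR_invn// -powRrM -[RHS]powR_mulrn ?powR_ge0// -powRrM; congr (_ `^ _); ring.
rewrite mulrCA; apply: ler_wpM2l; first by rewrite exprn_ge0 ?powR_ge0.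
rewrite mul2n -addnn exprD; apply: ler_wpM2l; first by rewrite exprn_ge0// ltW.
by apply: ger1_powR => //; rewrite exprn_gt0//= exprn_ile1 ?ltW.
Qed.

Lemma weight_base n l w : (l < 2 ^ n)%N -> (0 < size w <= k0)%N ->
  `|dyadic_signature T x 0 (dp n l) (dp n l.+1) w| <=
  (2 * rho ^+ n * energy_weight n 0 l `^ al) ^+ size w.
Proof.
move=> ln wk; apply: le_trans (energy_coarse w (leq0n n) ln) _.
have := energy_scale_weight n 0 l; rewrite addn0 => h.
have b0 := energy_scale_gt0 n 0; have V0 := powR_ge0 (energy n 0 l) al.
have W0 := powR_ge0 (energy_weight n 0 l) al.
have r0 : 0 <= rho ^+ n by rewrite exprn_ge0// ltW.
have rW := mulr_ge0 r0 W0.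
rewrite lerXn2r ?nnegrE//; [exact: mulr_ge0 (ltW b0) V0|by rewrite -mulrA mulr_ge0|].
by rewrite -mulrA; lra.
Qed.

(** For [m < n] the two signatures are bounded separately and the resulting factor 2 is absorbed by
    [2^|w|]; for [n <= m] the difference itself is estimated. *)
Lemma weight_step n m l w : (l < 2 ^ n)%N -> (0 < size w <= k0)%N ->
  `|dyadic_signature T x m.+1 (dp n l) (dp n l.+1) w - dyadic_signature T x m (dp n l) (dp n l.+1) w|
  <= (2 * rho ^+ (n + m) * energy_weight n m l `^ al) ^+ size w.
Proof.
move=> ln wk; have h := energy_scale_weight n m l.
have b0 := energy_scale_gt0 n m; have V0 := powR_ge0 (energy n m l) al.
have u0 := mulr_ge0 (ltW b0) V0.
apply: (@le_trans _ _ ((2 * (energy_scale n m * energy n m l `^ al)) ^+ size w)); last first.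
  rewrite -[2 * rho ^+ _ * _]mulrA lerXn2r ?nnegrE//; first exact: mulr_ge0.
    by apply: mulr_ge0 => //; exact: le_trans h.
  by rewrite ler_wpM2l.
have w0 : (0 < size w)%N by case/andP : wk.
rewrite exprMn; have uk := exprn_ge0 (size w) u0.
have two : 2 <= 2 ^+ size w :> R by rewrite -[leLHS]expr1 ler_weXn2l ?ler1n.
case: (ltnP m n) => mn.
  apply: (@le_trans _ _ (2 * (energy_scale n m * energy n m l `^ al) ^+ size w)).
    apply: le_trans (ler_normB _ _) _.
    have := energy_coarse_succ w mn ln; have := energy_coarse w (ltnW mn) ln.
    rewrite /cell_signature; lra.
  by rewrite ler_wpM2r.
apply: le_trans (energy_fine mn ln wk) _; rewrite ler_peMl//; apply: le_trans two.
by rewrite ler1n.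
Qed.

End energy.

(** * Measurability of the signatures *)

Section signature_measurability.
Context {R : realType} d (Omega : measurableType d) (dim : nat) (T : R).
Variable X : Omega -> R -> 'rV[R]_dim.
Hypothesis T0 : 0 < T.
Hypothesis mX : forall t j, 0 <= t <= T -> measurable_fun setT (fun w => X w t 0 j).
Local Notation dp := (dyadic_point T).

Let measurable_piece m l s t v : (l < 2 ^ m)%N -> dp m l <= s -> s <= t -> t <= dp m l.+1 ->
  measurable_fun setT (fun w => dyadic_signature T (X w) m s t v).
Proof.
move=> lm ls st tl.
have in0T i : (i <= 2 ^ m)%N -> 0 <= dp m i <= T by move=> im; exact: dyadic_point_in.
under eq_fun do rewrite (dyadic_signature_linear T0 _ _ lm ls st tl).
apply: measurable_funM; last exact: measurable_cst.
apply: measurable_prod => j _; apply: measurable_funM; first exact: measurable_cst.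
by apply: measurable_funB; apply: mX; apply: in0T => //; exact: ltnW.
Qed.

(** On one piece the signature is polynomial in the values of the path at grid points; Chen's
    relation adds the pieces one at a time. *)
Lemma dyadic_signature_measurable m s t v : 0 <= s -> s <= t -> t <= T ->
  measurable_fun setT (fun w => dyadic_signature T (X w) m s t v).
Proof.
have main r : (r <= 2 ^ m)%N -> forall s t v, 0 <= s -> s <= t -> t <= dp m r ->
    measurable_fun setT (fun w => dyadic_signature T (X w) m s t v).
  elim: r => [|r IH] rm {}s {}t {}v s0 st tr.
    rewrite dyadic_point0 in tr.
    have s00 : s = 0 by apply/le_anti; rewrite s0 (le_trans st).
    have t00 : t = 0 by apply/le_anti; rewrite tr (le_trans s0).
    apply: (@measurable_piece m 0); rewrite ?s00 ?t00 ?dyadic_point0//; first by rewrite expn_gt0.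
    exact: dyadic_point_ge0.
  have [tl|lt] := leP t (dp m r); first exact: IH (ltnW rm) _ _ _ _ _ _.
  have [ls|sl] := leP (dp m r) s; first exact: (@measurable_piece m r).
  have tT : t <= T by apply: le_trans tr _; rewrite dyadic_point_leT.
  under eq_fun do rewrite (dyadic_signature_chen T0 _ _ _ s0 (ltW sl) (ltW lt) tT).
  apply: measurable_sum => q; apply: measurable_funM.
    by apply: (IH (ltnW rm)) => //; exact: ltW.
  by apply: (@measurable_piece m r) => //; exact: ltW.
by move=> s0 st tT; apply: (main (2 ^ m)%N) => //; rewrite dyadic_point_end.
Qed.

End signature_measurability.

(** * From bounded expectations to almost sure bounds *)

Section almost_sure_bound.
Context {R : realType} d (Omega : measurableType d) (P : probability Omega R).

(** Monotone convergence: the limit has a finite integral, hence is finite almost everywhere. *)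
Lemma ae_bounded (S : nat -> Omega -> R) (K : R) :
  (forall N, P.-integrable setT (EFin \o S N)) -> (forall N w, 0 <= S N w) ->
  (forall w, nondecreasing_seq (fun N => S N w)) ->
  (forall N, \int[P]_w S N w <= K) ->
  {ae P, forall w, exists M, forall N, S N w <= M}.
Proof.
move=> Si S0 Snd SK.
have mS N : measurable_fun setT (EFin \o S N) by exact: (measurable_int _ (Si N)).
have ndS w : nondecreasing_seq (fun N => (S N w)%:E).
  by move=> i j ij; rewrite lee_fin; exact: Snd.
pose f w : \bar R := limn (fun N => (S N w)%:E).
have cf w : (fun N => (S N w)%:E) @ \oo --> f w by exact: ereal_nondecreasing_is_cvgn.
have f0 w : (0 <= f w)%E.
  apply: lime_ge; first exact: cf.
  by apply: nearW => N; rewrite lee_fin.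
have fi : P.-integrable setT f.
  apply/integrableP; split; first by apply: (emeasurable_fun_cvg (fun N => EFin \o S N)) => // w _; exact: cf.
  under eq_integral do rewrite gee0_abs//.
  rewrite monotone_convergence//; last by move=> N w _; rewrite lee_fin.
  apply: le_lt_trans (ltry K); apply: lime_le.
    apply: ereal_nondecreasing_is_cvgn => i j ij.
    by apply: ge0_le_integral => //;
      first [exact: mS | by move=> w _; rewrite lee_fin | by move=> w _; rewrite lee_fin; exact: Snd].
  by apply: nearW => N; rewrite -EFin_Rintegral ?lee_fin.
have := integrable_ae measurableT fi; apply: filterS => w /(_ Logic.I) fw.
exists (fine (f w)) => N; rewrite -lee_fin fineK//.
rewrite /f (cvg_lim _ (ereal_nondecreasing_cvgn (ndS w)))//.
by apply: ereal_sup_ubound; exists N.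
Qed.

End almost_sure_bound.

(** Origin of the power 24 of [rho]: the square of an area of at most three letters, with a decay
    [rho^(4r)] for each letter. *)
Lemma fine_exponent_le (r k : nat) : (k <= 3)%N -> (4 * r * (k * 2) <= 24 * r)%N.
Proof. nia. Qed.

(** * Expectation of the energies *)

Section expected_energy.
Context {R : realType} d (Omega : measurableType d) (P : probability Omega R).
Variables (T : R) (N dim : nat) (H a : 'I_N -> R) (B : 'I_N -> 'I_dim -> R -> {RV P >-> R}).
Hypotheses (T0 : 0 < T).
Hypothesis BH : forall k, is_fBm P T (H k) (B k).
Variables (al rho C K : R) (k0 : nat).
Local Notation h := (hurst_ratio H).
Local Notation dp := (dyadic_point T).
Local Notation path w := (mixed_fBm P a B w).
Local Notation cell w := (cell_signature T (path w)).
Local Notation scale := (energy_scale al rho).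
Hypothesis C0 : 0 <= C.
Hypothesis K0 : 0 <= K.
Hypothesis fourthC : forall m s t j, 0 <= s <= T -> 0 <= t <= T ->
  `|t - s| <= 2 ^- m * T -> \int[P]_w (mixed_diff (P := P) a B s t j w ^+ 4) <= C * h ^+ (4 * m).
Hypothesis areaK : forall n r l v, (l < 2 ^ n)%N -> (1 < size v <= k0)%N ->
  l2_le P (fun w => cell w (n + r).+1 n l v - cell w (n + r) n l v)
    (K * 2 ^+ r * h ^+ (2 * n * (size v - 2)) * h ^+ (4 * (n + r))).
Hypotheses (rho0 : 0 < rho) (rho1 : rho < 1) (k03 : (k0 <= 3)%N).
Hypotheses (h2 : 2^-1 <= h) (hal : h <= 2 `^ (- al) * rho ^+ 4) (hrho : 2 * h ^+ 4 <= rho ^+ 24).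

Let h0 : 0 < h. Proof. exact: hurst_ratio_gt0. Qed.
Let scale0 n m : 0 < scale n m. Proof. exact: energy_scale_gt0. Qed.

(** At [m = n + r] the scale contains [rho^(4n + 2r)]; the part [4n] turns [2^(-al n)] into at least
    [h^n], and [2r <= 4r]. *)
Lemma scale_ge n r : h ^+ n * rho ^+ (4 * r) <= scale n (n + r).
Proof.
rewrite /energy_scale.
apply: (@le_trans _ _ ((2 `^ (- al) * rho ^+ 4) ^+ n * rho ^+ (4 * r))).
  rewrite ler_wpM2r ?exprn_ge0 ?(ltW rho0)// lerXn2r ?nnegrE ?(ltW h0)//.
  by rewrite mulr_ge0 ?powR_ge0// exprn_ge0// ltW.
rewrite exprMn -exprM -mulrA -exprD ler_wpM2l ?exprn_ge0 ?powR_ge0//.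
by apply: ler_wiXn2l; rewrite ?(ltW rho0) ?(ltW rho1)//; lia.
Qed.

Lemma scale_ge_coarse n m : (m <= n)%N -> h ^+ n <= scale n m.
Proof.
move=> mn; rewrite /energy_scale.
apply: (@le_trans _ _ ((2 `^ (- al) * rho ^+ 4) ^+ n)).
  rewrite lerXn2r ?nnegrE ?(ltW h0)//.
  by rewrite mulr_ge0 ?powR_ge0// exprn_ge0// ltW.
rewrite exprMn -exprM ler_wpM2l ?exprn_ge0 ?powR_ge0//.
by apply: ler_wiXn2l; rewrite ?(ltW rho0) ?(ltW rho1)//; lia.
Qed.

(** Over a cell of generation [n] the [q]-th interpolation moves by [2^-(n - q)] times a step of
    generation [q], and [1/2 <= h] turns the resulting size into at most [h^n]. *)
Lemma cell_coarse_moment q n m l j : (q <= n)%N -> (m <= n)%N -> (l < 2 ^ n)%N ->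
  P.-integrable setT (EFin \o (fun w => (cell w q n l [:: j] / scale n m) ^+ 4)) /\
  \int[P]_w ((cell w q n l [:: j] / scale n m) ^+ 4) <= C.
Proof.
move=> qn mn ln; set l' := (l %/ 2 ^ (n - q))%N.
have lq : (l' < 2 ^ q)%N by rewrite ltn_divLR ?expn_gt0// -expnD subnKC.
have refine i : dp q i = dp n (i * 2 ^ (n - q)).
  by rewrite -(dyadic_point_refine T q (n - q) i) subnKC.
have e1 := refine l'; have e2 := refine l'.+1.
have i1 : dp q l' <= dp n l by rewrite e1 ler_dyadic// leq_divM.
have i2 : dp n l <= dp n l.+1 by rewrite ler_dyadic.
have i3 : dp n l.+1 <= dp q l'.+1 by rewrite e2 ler_dyadic// ltn_ceil// expn_gt0.
pose c := 2 ^- n / 2 ^- q / scale n m.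
have cE w : (cell w q n l [:: j] / scale n m) ^+ 4 =
    c ^+ 4 * mixed_diff a B (dp q l') (dp q l'.+1) j w ^+ 4.
  rewrite /cell_signature (dyadic_signature_linear T0 _ _ lq i1 i2 i3) big_seq1 /= divr1.
  rewrite dyadic_pointS -exprMn /c /mixed_diff /increment; congr (_ ^+ 4).
  by field; rewrite !gt_eqF ?exprn_gt0.
have inT i : (i <= 2 ^ q)%N -> 0 <= dp q i <= T by exact: dyadic_point_in.
have [mz iz] := mixed_diff_moment a BH j (inT _ (ltnW lq)) (inT _ lq).
have fz : \int[P]_w (mixed_diff a B (dp q l') (dp q l'.+1) j w ^+ 4) <= C * h ^+ (4 * q).
  apply: fourthC; [exact: inT (ltnW lq)|exact: inT|].
  have hq : 0 <= 2 ^- q * T by rewrite mulr_ge0 ?invr_ge0 ?exprn_ge0 ?(ltW T0).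
  by rewrite dyadic_pointS ger0_norm.
split; first by under eq_fun do rewrite cE; exact: integrableZ_real.
under eq_Rintegral do rewrite cE; rewrite integralZ_real//.
have c40 : 0 <= c ^+ 4 by rewrite exprn_even_ge0.
apply: le_trans (ler_wpM2l c40 fz) _; rewrite mulrCA ler_piMr// mulnC exprM -exprMn.
rewrite expr_le1//; last first.
  by rewrite mulr_ge0 ?exprn_ge0 ?(ltW h0)// /c !mulr_ge0 ?invr_ge0 ?exprn_ge0 ?invr_ge0 ?exprn_ge0 ?(ltW (scale0 _ _)).
have e2h : 2 ^- n / 2 ^- q <= h ^+ (n - q).
  apply: (@le_trans _ _ (2^-1 ^+ (n - q))); last by rewrite lerXn2r ?nnegrE ?(ltW h0).
  rewrite -{1}(subnKC qn) exprD exprVn invfM invrK mulrAC mulVf ?mul1r//.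
have -> : c * h ^+ q = (2 ^- n / 2 ^- q * h ^+ q) / scale n m by rewrite /c mulrAC.
rewrite ler_pdivrMr ?scale0// mul1r; apply: le_trans (scale_ge_coarse mn).
by rewrite -{2}(subnK qn) exprD ler_wpM2r// exprn_ge0// ltW.
Qed.

(** For a word of length [k] the exponents combine to [h^(2nk) (2 h^4)^r]; the first factor is
    matched by the scale, the second by its decay in [r]. *)
Lemma cell_fine_moment n m l (v : seq 'I_dim) : (n <= m)%N -> (l < 2 ^ n)%N -> (1 < size v <= k0)%N ->
  P.-integrable setT (EFin \o
    (fun w => ((cell w m.+1 n l v - cell w m n l v) / scale n m ^+ size v) ^+ 2)) /\
  \int[P]_w (((cell w m.+1 n l v - cell w m n l v) / scale n m ^+ size v) ^+ 2) <= K.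
Proof.
move=> nm ln vk; have := areaK (m - n) ln vk; rewrite subnKC//; set r := (m - n)%N.
move=> [[mD iD] DK].
set b := scale n m ^+ size v; have b0 : 0 < b by rewrite exprn_gt0.
have bE w : ((cell w m.+1 n l v - cell w m n l v) / b) ^+ 2 =
    b ^- 2 * (cell w m.+1 n l v - cell w m n l v) ^+ 2.
  by rewrite expr_div_n mulrC.
split; first by under eq_fun do rewrite bE; exact: integrableZ_real.
under eq_Rintegral do rewrite bE; rewrite integralZ_real// mulrC ler_pdivrMr ?exprn_gt0//.
apply: le_trans DK _; rewrite -!mulrA ler_wpM2l//.
have sb := scale_ge n r; rewrite subnKC// in sb.
set k := size v in vk b0 bE *; have /andP[k1 kk0] := vk.
have k3 : (k <= 3)%N by apply: leq_trans k03.
apply: (@le_trans _ _ ((h ^+ n * rho ^+ (4 * r)) ^+ (k * 2))); last first.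
  rewrite /b -exprM lerXn2r ?nnegrE ?(ltW (scale0 _ _))//.
  by rewrite mulr_ge0 ?exprn_ge0 ?(ltW h0) ?(ltW rho0).
have hr : (2 * h ^+ 4) ^+ r <= rho ^+ (4 * r * (k * 2)).
  apply: (@le_trans _ _ (rho ^+ 24 ^+ r)).
    by rewrite lerXn2r ?nnegrE ?exprn_ge0 ?(ltW rho0)// mulr_ge0 ?exprn_ge0 ?(ltW h0).
  rewrite -exprM; apply: ler_wiXn2l; rewrite ?(ltW rho0) ?(ltW rho1)//.
  exact: fine_exponent_le.
rewrite exprMn -!exprM.
have -> : 2 ^+ r * (h ^+ (2 * n * (k - 2)) * h ^+ (4 * m)) = h ^+ (n * (k * 2)) * (2 * h ^+ 4) ^+ r.
  rewrite exprMn -exprM [RHS]mulrCA -!exprD; congr (_ * h ^+ _).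
  rewrite -(subnKC nm) -/r; have [q ->] : exists q, k = (q + 2)%N by exists (k - 2)%N; rewrite subnK.
  rewrite addnK; ring.
by rewrite ler_wpM2l// exprn_ge0// ltW.
Qed.

Definition energy_bound : R := 1 + dim%:R * C + dim%:R * C + #|{: k0.-bseq 'I_dim}|%:R * K.

Lemma energy_moment n m l : (l < 2 ^ n)%N ->
  P.-integrable setT (EFin \o (fun w => energy T al rho k0 (path w) n m l)) /\
  \int[P]_w energy T al rho k0 (path w) n m l <= energy_bound.
Proof.
move=> ln; rewrite /energy.
pose E1 q (b : bool) w : R := if b then \sum_(j < dim) (cell w q n l [:: j] / scale n m) ^+ 4 else 0.
have hE1 q (b : bool) : (b -> (q <= n)%N && (m <= n)%N) ->
    P.-integrable setT (EFin \o E1 q b) /\ \int[P]_w E1 q b w <= dim%:R * C.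
  rewrite /E1; case: b => [/(_ isT) /andP[qn mn]|_].
    have hc j := cell_coarse_moment j qn mn ln.
    have ij j := (hc j).1; split; first exact: integrable_sum_real.
    rewrite integral_sum_real//; apply: le_trans (ler_sum _ (fun j _ => (hc j).2)) _.
    by rewrite sumr_const card_ord mulr_natl.
  split; first exact: integrable_cst_prob.
  by rewrite Rintegral_cst// mul0r; apply: mulr_ge0.
pose E2 w : R := if (n <= m)%N then \sum_(v : k0.-bseq 'I_dim | (1 < size v)%N)
       ((cell w m.+1 n l v - cell w m n l v) / scale n m ^+ size v) ^+ 2 else 0.
have hE2 : P.-integrable setT (EFin \o E2) /\ \int[P]_w E2 w <= #|{: k0.-bseq 'I_dim}|%:R * K.
  rewrite /E2; case: (leqP n m) => nm; last first.
    split; first exact: integrable_cst_prob.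
    by rewrite Rintegral_cst// mul0r; apply: mulr_ge0.
  pose F (v : k0.-bseq 'I_dim) w : R := if (1 < size v)%N then
    ((cell w m.+1 n l v - cell w m n l v) / scale n m ^+ size v) ^+ 2 else 0.
  have hF v : P.-integrable setT (EFin \o F v) /\ \int[P]_w F v w <= K.
    rewrite /F; case: (ltnP 1 (size v)) => v1; last first.
      by split; [exact: integrable_cst_prob|rewrite Rintegral_cst// mul0r].
    by apply: cell_fine_moment => //; rewrite v1 size_bseq.
  have -> : (fun w => \sum_(v : k0.-bseq 'I_dim | (1 < size v)%N)
       ((cell w m.+1 n l v - cell w m n l v) / scale n m ^+ size v) ^+ 2) =
    (fun w => \sum_(v : k0.-bseq 'I_dim) F v w) by apply/funext => w; rewrite big_mkcond.
  have iF v := (hF v).1; split; first exact: integrable_sum_real.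
  rewrite integral_sum_real//; apply: le_trans (ler_sum _ (fun v _ => (hF v).2)) _.
  by rewrite sumr_const mulr_natl.
have [i1 b1] := hE1 m (m <= n)%N (fun mn => introT andP (conj mn mn)).
have [i1' b1'] := hE1 m.+1 (m < n)%N (fun mn => introT andP (conj mn (ltnW mn))).
have [i2 b2] := hE2.
have ic := integrable_cst_prob P 1.
have i12 := integrableD_real ic i1; have i123 := integrableD_real i12 i1'.
split; first exact: integrableD_real i123 i2.
rewrite (integralD_real i123 i2) (integralD_real i12 i1') (integralD_real ic i1) /energy_bound.
rewrite Rintegral_cst//; have -> : fine (P setT) = 1 by rewrite probability_setT.
rewrite mulr1; lra.
Qed.

End expected_energy.

(** * The limit rough path *)

Section exponents.
Context {R : realType}.
Implicit Types Hm p al : R.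

(** The exponent is the larger of a threshold, [1/4] or [1/2] according to [Hm], and the midpoint of
    [1/p] and [Hm]. *)
Lemma regularity_exponent Hm p : 4^-1 < Hm -> Hm < 1 -> Hm^-1 < p ->
  exists k0 al, [/\ (0 < k0 <= 3)%N, 4^-1 <= al < Hm, 1 <= al * p,
    1 <= k0.+1%:R * al & (1 < k0)%N -> Hm <= 2^-1].
Proof.
move=> H4 H1 Hp; have H0 : 0 < Hm by apply: lt_trans H4; rewrite invr_gt0.
have p0 : 0 < p by apply: lt_trans Hp; rewrite invr_gt0.
have pH : p^-1 < Hm by rewrite invf_plt ?posrE.
have main (c : R) : c < Hm -> exists2 al, c <= al < Hm & 1 <= al * p.
  move=> cH; exists (Num.max c ((p^-1 + Hm) / 2)).
    by rewrite le_max lexx/= gt_max cH/=; lra.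
  rewrite -ler_pdivrMr// div1r le_max; apply/orP; right; lra.
have [H2|H2] := leP Hm 2^-1.
  have [al /andP[al4 alH] alp] := main _ H4; exists 3%N, al.
  split; rewrite ?al4 ?alH//; lra.
have [al /andP[al2 alH] alp] := main _ H2; exists 1%N, al.
by split; rewrite ?alH ?andbT//; lra.
Qed.

(** With [rho = 2^(-e/4)] the first inequality requires [e <= Hm - al]; the second compares
    [2^(1 - 4 Hm)] with [2^(-6e)] and requires [6 e <= 4 Hm - 1]. *)
Lemma decay_rate Hm al : 4^-1 < Hm -> al < Hm -> exists2 rho, 0 < rho < 1 &
  2 `^ (- Hm) <= 2 `^ (- al) * rho ^+ 4 /\ 2 * (2 `^ (- Hm)) ^+ 4 <= rho ^+ 24.
Proof.
move=> H4 alH; pose e := Num.min (Hm - al) ((4 * Hm - 1) / 6).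
have e0 : 0 < e by rewrite lt_min subr_gt0 alH/=; lra.
have e1 : e <= Hm - al by rewrite ge_min lexx.
have e2 : e <= (4 * Hm - 1) / 6 by rewrite ge_min lexx orbT.
exists (2 `^ (- (e / 4))).
  rewrite powR_gt0//= -[ltRHS](powRr0 2) lt_neqAle ler_powR ?ler1n//; last by lra.
  rewrite andbT; apply/eqP => /(congr1 (@ln R)); rewrite !ln_powR mul0r => /eqP.
  rewrite mulf_eq0 oppr_eq0 gt_eqF/=; last by rewrite divr_gt0.
  by rewrite gt_eqF// ln_gt0// ltr1n.
have two : 2 = 2 `^ 1 :> R by rewrite powRr1.
rewrite -!powR_mulrn ?powR_ge0// -!powRrM; split.
  by rewrite -powRD ?pnatr_eq0 ?implybT// ler_powR ?ler1n//; lra.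
by rewrite {1}two -powRD ?pnatr_eq0 ?implybT// ler_powR ?ler1n//; lra.
Qed.

End exponents.

Lemma mixed_fBm_continuous (R : realType) d (Omega : measurableType d) (P : probability Omega R)
    (T : R) (N dim : nat) (a : 'I_N -> R) (B : 'I_N -> 'I_dim -> R -> {RV P >-> R}) (w : Omega) :
  (forall k j, {within `[0, T], continuous (fun t => B k j t w)}) ->
  forall j, {within `[0, T], continuous (fun t => mixed_fBm P a B w t 0 j)}.
Proof.
move=> cB j; rewrite (_ : (fun t => _) = fun t => \sum_(k < N) a k * B k j t w); last first.
  by apply/funext => t; rewrite mixed_fBmE.
apply/subspace_continuousP => t tT /=.
apply: cvg_big => [|k _]; first exact: add_continuous.
apply: cvgM; first exact: cvg_cst.
by have /subspace_continuousP := cB k j; exact.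
Qed.

Lemma mixed_fBm_measurable (R : realType) d (Omega : measurableType d) (P : probability Omega R)
    (N dim : nat) (a : 'I_N -> R) (B : 'I_N -> 'I_dim -> R -> {RV P >-> R}) t j :
  measurable_fun setT (fun w => mixed_fBm P a B w t 0 j).
Proof.
under eq_fun do rewrite mixed_fBmE.
by apply: measurable_sum => k; apply: measurable_funM => //; exact: measurable_cst.
Qed.

(** * First level, geometricity and uniqueness of the limit *)

Section limit_properties.
Context {R : realType} {dim : nat} (T p : R) (x : R -> 'rV[R]_dim).
Hypotheses (T0 : 0 < T) (p1 : 1 <= p).
Variable L : R -> R -> trunc_tensor R dim (Num.truncn p).
Hypothesis cx : forall j, {within `[0, T], continuous (fun t => x t 0 j)}.
Hypothesis Lr : rough_path T p L.
Hypothesis Lc : pvar_cvg T p (dyadic_rough_path T p x) L.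
Hypothesis Ls : forall s t (v : (Num.truncn p).-bseq 'I_dim), 0 <= s -> s <= t -> t <= T ->
  (fun m => dyadic_signature T x m s t v) @ \oo --> L s t v.

Lemma limit_level1 s t : 0 <= s -> s <= t -> t <= T -> level1 (L s t) = x t - x s.
Proof.
move=> s0 st tT; apply/rowP => j; rewrite !mxE.
have v1 : insub_bseq (Num.truncn p) [:: j] = [:: j] :> seq _.
  by rewrite insub_bseqK//= truncn_gt0.
rewrite -(cvg_lim _ (Ls s0 st tT))//; apply: cvg_lim => //; rewrite v1.
under eq_fun do rewrite dyadic_signature1//.
by apply: cvgB; apply: dyadic_approx_cvg => //; rewrite ?s0 ?tT ?(le_trans st) ?(le_trans s0).
Qed.

Lemma limit_geometric : geometric_rough_path T p L.
Proof.
split=> //; exists (dyadic_linear_approx T x); split => // m.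
exact: piecewise_smooth_dyadic_approx.
Qed.

Lemma limit_subsequence (phi : nat -> nat) : phi @ \oo --> \oo ->
  pvar_cvg T p (fun m => dyadic_rough_path T p x (phi m)) L.
Proof. by move=> phioo; exact: (cvg_comp phi (fun m => rough_dist T p (dyadic_rough_path T p x m) L) phioo Lc). Qed.

Lemma limit_unique (phi psi : nat -> nat) X Y : phi @ \oo --> \oo -> psi @ \oo --> \oo ->
  rough_path T p X -> rough_path T p Y ->
  pvar_cvg T p (fun m => dyadic_rough_path T p x (phi m)) X ->
  pvar_cvg T p (fun m => dyadic_rough_path T p x (psi m)) Y -> eq_on_simplex T X Y.
Proof.
move=> phioo psioo [mX _] [mY _] cX cY.
exact: (pvar_cvg_unique p1 mX mY Lc phioo psioo cX cY).
Qed.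

End limit_properties.

(** The [2^n] cells cancel the factor [2^-n], which leaves the square of a geometric series. *)
Lemma energy_weight_summable (R : realType) d (Omega : measurableType d) (P : probability Omega R)
    (q : nat -> nat -> nat -> Omega -> R) (rho C : R) : 0 < rho < 1 -> 0 <= C ->
  (forall n m l w, 0 <= q n m l w) ->
  (forall n m l, (l < 2 ^ n)%N -> P.-integrable setT (EFin \o q n m l) /\
     \int[P]_w q n m l w <= 2 ^- n * rho ^+ (n + m) * C) ->
  {ae P, forall w, exists S, forall N, \sum_(n < N) \sum_(m < N) \sum_(l < 2 ^ n) q n m l w <= S}.
Proof.
move=> /andP[rho0 rho1] C0 q0 qC.
have iq n m (l : 'I_(2 ^ n)) : P.-integrable setT (EFin \o q n m l) := (qC n m l (ltn_ord l)).1.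
have i1 n m : P.-integrable setT (EFin \o (fun w => \sum_(l < 2 ^ n) q n m l w)).
  by apply: integrable_sum_real => l; exact: iq.
have i2 N n : P.-integrable setT (EFin \o (fun w => \sum_(m < N) \sum_(l < 2 ^ n) q n m l w)).
  by apply: integrable_sum_real => m; exact: i1.
apply: (@ae_bounded _ _ _ _ _ (C / (1 - rho) ^+ 2)) => [N|N w|w N N' NN'|N].
- by apply: integrable_sum_real => n; exact: i2.
- by do 3 (apply: sumr_ge0 => ? _).
- apply: (@le_trans _ _ (\sum_(n < N) \sum_(m < N') \sum_(l < 2 ^ n) q n m l w)).
    apply: ler_sum => n _; rewrite -(big_mkord xpredT (fun m => \sum_(l < 2 ^ n) q n m l w)).
    rewrite -(big_mkord xpredT (fun m => \sum_(l < 2 ^ n) q n m l w)).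
    rewrite [leRHS](@big_cat_nat _ _ _ N)//= lerDl.
    by do 2 (apply: sumr_ge0 => ? _).
  rewrite -(big_mkord xpredT (fun n => \sum_(m < N') \sum_(l < 2 ^ n) q n m l w)).
  rewrite -(big_mkord xpredT (fun n => \sum_(m < N') \sum_(l < 2 ^ n) q n m l w)).
  rewrite [leRHS](@big_cat_nat _ _ _ N)//= lerDl.
  by do 3 (apply: sumr_ge0 => ? _).
rewrite integral_sum_real//.
apply: (@le_trans _ _ (\sum_(n < N) \sum_(m < N) rho ^+ n * (rho ^+ m * C))).
  apply: ler_sum => n _; rewrite integral_sum_real//; apply: ler_sum => m _.
  rewrite integral_sum_real//.
  apply: (@le_trans _ _ (\sum_(l < 2 ^ n) 2 ^- n * rho ^+ (n + m) * C)).
    by apply: ler_sum => l _; exact: (qC n m l (ltn_ord l)).2.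
  rewrite sumr_const card_ord -[leLHS]mulr_natl natrX exprD -!mulrA mulrA divff ?mul1r//.
have g : \sum_(n < N) rho ^+ n <= (1 - rho)^-1.
  have := @geometric_sum_le _ rho 0 N; rewrite big_mkord expr0 div1r; apply => //.
  by rewrite (ltW rho0).
have g0 : 0 <= \sum_(n < N) rho ^+ n by apply: sumr_ge0 => n _; rewrite exprn_ge0 ?ltW.
have -> : \sum_(n < N) \sum_(m < N) rho ^+ n * (rho ^+ m * C) = (\sum_(n < N) rho ^+ n) ^+ 2 * C.
  rewrite expr2 -mulrA mulr_suml; apply: eq_bigr => n _.
  by rewrite mulr_suml mulr_sumr.
rewrite mulrC -exprVn ler_wpM2l// lerXn2r ?nnegrE// invr_ge0 subr_ge0; exact: ltW.
Qed.

Lemma min_hurst_lt1 (R : realType) (N : nat) (H : 'I_N -> R) : (1 <= N)%N ->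
  (forall k, 0 < H k < 1) -> min_hurst H < 1.
Proof.
move=> N1 H01; apply: le_lt_trans (min_hurst_le H (Ordinal N1)) _.
by case/andP : (H01 (Ordinal N1)).
Qed.

(** Two sequences of dyadic approximations are encoded as reindexings [phi] and [psi] tending to
    infinity; their limits can be compared only on the simplex, outside of which values are
    ignored. *)
Theorem theorem3p1 (R : realType) (disp : measure_display)
    (Omega : measurableType disp) (P : probability Omega R)
    (T : R) (N dim : nat) (H a : 'I_N -> R)
    (B : 'I_N -> 'I_dim -> R -> {RV P >-> R}) :
  measure_is_complete P ->
  0 < T -> (1 <= N)%N -> (1 <= dim)%N ->
  (forall k, 0 < H k < 1) ->
  4^-1 < min_hurst H ->
  (exists k, a k != 0) ->
  (forall k, is_fBm P T (H k) (B k)) ->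
  mutually_independent P (fun k => process_sigma_algebra P T (B k)) ->
  forall p : R, (min_hurst H)^-1 < p ->
  exists MM : Omega -> R -> R -> trunc_tensor R dim (Num.truncn p),
    (forall s t w, 0 <= s -> s <= t -> t <= T ->
       measurable_fun setT (fun omega => MM omega s t w)) /\
    {ae P, forall omega,
      let M := mixed_fBm P a B omega in
      [/\ pvar_cvg T p (dyadic_rough_path T p M) (MM omega),
          geometric_rough_path T p (MM omega),
          (forall s t, 0 <= s -> s <= t -> t <= T ->
             level1 (MM omega s t) = M t - M s) &
          forall phi psi : nat -> nat,
            phi @ \oo --> \oo -> psi @ \oo --> \oo ->
            [/\ pvar_cvg T p (fun m => dyadic_rough_path T p M (phi m)) (MM omega),
                pvar_cvg T p (fun m => dyadic_rough_path T p M (psi m)) (MM omega) &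
                forall X Y, rough_path T p X -> rough_path T p Y ->
                  pvar_cvg T p (fun m => dyadic_rough_path T p M (phi m)) X ->
                  pvar_cvg T p (fun m => dyadic_rough_path T p M (psi m)) Y ->
                  eq_on_simplex T X Y]]}.
Proof.
move=> cP T0 N1 _ H01 H4 _ BH BI p Hp.
have H1 := min_hurst_lt1 N1 H01; have H0 : 0 < min_hurst H by apply: lt_trans H4; rewrite invr_gt0.
have p1 : 1 <= p by apply: ltW; apply: lt_trans Hp; rewrite invf_gt1.
have [k0 [al [k03 /andP[al4 alH] alp k0al k0H]]] := regularity_exponent H4 H1 Hp.
have [rho rho01 [hal hrho]] := decay_rate H4 alH; have /andP[rho0 rho1] := rho01.
have al1 : al <= 1 by rewrite ltW// (lt_trans alH).
have al0 : 0 <= al by apply: le_trans al4; rewrite invr_ge0.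
have [C C0 fourthC] := mixed_diff_fourth a T0 H01 BH.
have h2 : 2^-1 <= hurst_ratio H.
  by rewrite /hurst_ratio -powR_inv1// ler_powR ?ler1n// lerN2 ltW.
have [K K0 areaK] : exists2 K, 0 <= K & forall n r l v, (l < 2 ^ n)%N -> (1 < size v <= k0)%N ->
  l2_le P (fun w => cell_signature T (mixed_fBm P a B w) (n + r).+1 n l v -
      cell_signature T (mixed_fBm P a B w) (n + r) n l v)
    (K * 2 ^+ r * hurst_ratio H ^+ (2 * n * (size v - 2)) * hurst_ratio H ^+ (4 * (n + r))).
  (* For [k0 = 1] no word has a length in the required range, so the area estimate is invoked only
     when the smallest parameter is at most one half. *)
  have [k1|k1] := leqP k0 1.
    exists 0 => // n r l v _ /andP[v1 vk].
    by have := leq_trans (leq_trans v1 vk) k1; rewrite ltnn.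
  have H02 : 0 < min_hurst H <= 2^-1 by rewrite H0 k0H.
  have [K K0 KA] := area_l2 a T0 H01 BH BI H02.
  exists K => // n r l v ln /andP[v1 vk]; apply: KA => //.
  have : (size v <= 3)%N by apply: leq_trans vk _; case/andP : k03.
  by move: v1; case: (size v) => [|[|[|[|]]]].
have k03' : (k0 <= 3)%N by case/andP : k03.
have k00 : (0 < k0)%N by case/andP : k03.
pose path w := mixed_fBm P a B w.
pose q n m l w := energy_weight T al rho k0 (path w) n m l.
have q0 n m l w : 0 <= q n m l w by exact: energy_weight_ge0.
pose Cb := energy_bound dim C K k0.
have Cb0 : 0 <= Cb by rewrite /Cb /energy_bound !addr_ge0// mulr_ge0.
have qC n m l : (l < 2 ^ n)%N -> P.-integrable setT (EFin \o q n m l) /\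
     \int[P]_w q n m l w <= 2 ^- n * rho ^+ (n + m) * Cb.
  move=> ln; have [ie Ee] := energy_moment T0 BH C0 K0 fourthC areaK rho0 rho1 k03' h2 hal hrho m ln.
  split; first exact: integrableZ_real.
  rewrite /q /energy_weight integralZ_real// ler_wpM2l//.
  by rewrite mulr_ge0 ?invr_ge0 ?exprn_ge0 ?ltW.
have bounded := energy_weight_summable rho01 Cb0 q0 qC.
have cont : {ae P, forall w, forall k j, {within `[0, T], continuous (fun t => B k j t w)}}.
  by apply: filter_forall => k; exact: fBm_continuous (BH k).
(* The event on which the weights are summable and all paths continuous; on it the rest is
   deterministic. *)
pose G : set Omega := [set w |
  (exists S, forall N, \sum_(n < N) \sum_(m < N) \sum_(l < 2 ^ n) q n m l w <= S) /\
  (forall k j, {within `[0, T], continuous (fun t => B k j t w)})].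
have aeG : {ae P, forall w, G w} by apply: filterS2 bounded cont => w; split.
(* The complement of [G] is negligible, hence measurable by completeness of [P]. *)
have mG : measurable G by rewrite -[G]setCK; apply: measurableC; exact: cP.
have hrho' : 0 <= rho < 1 by rewrite (ltW rho0).
have good w : G w -> [/\
    forall s t v, 0 <= s -> s <= t -> t <= T ->
      (fun m => dyadic_signature T (path w) m s t v) @ \oo --> signature_limit T (path w) s t v,
    rough_path T p (rough_limit T p (path w)) &
    pvar_cvg T p (dyadic_rough_path T p (path w)) (rough_limit T p (path w))].
  move=> [[S qS] _]; have q0w n m l := q0 n m l w; have c0 : 0 <= 2 :> R by [].
  have base := weight_base (k0 := k0) (path w) T0 al4 al1 rho0 rho1.
  have step := weight_step (k0 := k0) (path w) T0 al4 al1 rho0 rho1.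
  split=> [s t v s0 st tT||].
  - exact: (dyadic_signature_cvg T0 q0w qS hrho' c0 k00 al0 k0al base step s0 st tT).
  - exact: (rough_limit_rough_path T0 p1 q0w qS hrho' c0 k00 al0 k0al alp base step).
  - exact: (rough_limit_cvg T0 p1 q0w qS hrho' c0 k00 al0 k0al alp base step).
(* The indicator sets the limit to 0 off [G], so that the correspondingly modified approximations
   converge everywhere and measurability passes to the limit. *)
pose MM w s t : trunc_tensor R dim (Num.truncn p) :=
  [ffun v : (Num.truncn p).-bseq 'I_dim => \1_G w * signature_limit T (path w) s t v].
exists MM; split.
  move=> s t v s0 st tT.
  pose h m w : R := \1_G w * dyadic_signature T (path w) m s t v.
  apply: (@measurable_fun_cvg _ _ _ _ h).
    move=> m; apply: measurable_funM; first exact: measurable_indic.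
    by apply: dyadic_signature_measurable => // u j _; exact: mixed_fBm_measurable.
  move=> w _; rewrite /h ffunE; case: (pselect (G w)) => Gw.
    by have [sigc _ _] := good w Gw; apply: cvgM; [exact: cvg_cst|exact: sigc].
  have e0 : \1_G w = 0 :> R by rewrite indicE memNset.
  by rewrite e0 mul0r; under eq_fun do rewrite mul0r; exact: cvg_cst.
move: aeG; apply: filterS => w Gw.
have MME : MM w = rough_limit T p (path w).
  apply/funext => s; apply/funext => t; apply/ffunP => v; rewrite !ffunE.
  by rewrite indicE mem_set// mul1r.
have [sigc rp pc] := good w Gw; rewrite /= MME.
have cx j : {within `[0, T], continuous (fun t => path w t 0 j)}.
  by case: Gw => _ cB; exact: mixed_fBm_continuous.
have sl s t (v : (Num.truncn p).-bseq 'I_dim) : 0 <= s -> s <= t -> t <= T ->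
    (fun m => dyadic_signature T (path w) m s t v) @ \oo --> rough_limit T p (path w) s t v.
  by move=> s0 st tT; rewrite ffunE; exact: sigc.
split.
- exact: pc.
- exact: (limit_geometric T0 rp pc).
- by move=> s t s0 st tT; exact: (limit_level1 T0 p1 cx sl s0 st tT).
- move=> phi psi phioo psioo; split.
  + exact: (limit_subsequence pc phioo).
  + exact: (limit_subsequence pc psioo).
  + by move=> X Y rX rY cX cY; exact: (limit_unique p1 pc phioo psioo rX rY cX cY).
Qed.
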